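(* Let $W^J$ and $(W')^{J'}$ be Hermitian symmetric pairs from the list in the context. Let $u\le v$ in $W^J$ with diagrams $M\subseteq\Lambda$, and let $u'\le v'$ in $(W')^{J'}$ with diagrams $M'\subseteq\Lambda'$. If $\Lambda\setminus M$ and $\Lambda'\setminus M'$ are skew diagrams of the same shape $\lambda\setminus\mu$ (a skew partition), then $$R^{J}_{u,v}(q)=R^{J'}_{u',v'}(q).$$
   Context: **Coxeter conventions.** $W$ is a Weyl group with simple reflections $S=\{s_1,\dots,s_n\}$ in Bourbaki numbering and length function $\ell$. For $J\subset S$, $W_J=\langle J\rangle$ and $W^J=\{w\in W:\ell(ws)>\ell(w)\text{ for all }s\in J\}$. $D_L(w)=\{s\in S:\ell(sw)<\ell(w)\}$. $\le$ is the Bruhat order restricted to $W^J$. **Relative $R$-polynomials.** $R^J_{u,v}(q)$ denotes Deodhar's relative $R$-polynomial of type $x=-1$: the unique family $\{R^J_{u,v}\}_{u,v\in W^J}\subset\mathbb Z[q]$ with $R^J_{u,v}=0$ if $u\not\le v$; $R^J_{u,u}=1$; and for $u<v$, $s\in D_L(v)$: $R^J_{u,v}=R^J_{su,sv}$ if $su<u$; $R^J_{u,v}=q\,R^J_{u,sv}$ if $u<su\notin W^J$; $R^J_{u,v}=(q-1)R^J_{u,sv}+q\,R^J_{su,sv}$ if $u<su\in W^J$. **Hermitian symmetric pairs and ambient diagrams.** Each pair $W^J=W/W_J$ below has an ambient diagram, a finite set of boxes $(i,j)$ (row $i$ from the top, column $j$ from the left) with labels; label $k$ means $s_k$. - $A_n/(A_{p-1}\times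 A_{n-p})$, $J=S\setminus\{s_p\}$: boxes $1\le i\le n+1-p$, $1\le j\le p$, label $p+i-j$. - $C_n/A_{n-1}$, $J=S\setminus\{s_n\}$: boxes $1\le i\le j\le n$, label $n-(j-i)$. - $B_n/B_{n-1}$, $J=S\setminus\{s_1\}$: boxes $(1,j)$, $1\le j\le n$, label $j$; boxes $(i,n)$, $2\le i\le n$, label $n+1-i$. - $D_n/A_{n-1}$, $J=S\setminus\{s_n\}$: boxes $1\le i\le j\le n-1$; $(i,i)$ has label $n$ for $i$ odd and $n-1$ for $i$ even; $(i,j)$ with $j>i$ has label $n-1-(j-i)$. - $D_n/D_{n-1}$, $J=S\setminus\{s_1\}$: $(1,j)$ has label $j$ for $1\le j\le n-2$; $(1,n-1)$ has label $n$; $(2,n-2)$ has label $n-1$; $(i,n-1)$, $2\le i\le n-1$, has label $n-i$. - $E_6/D_5$, $J=S\setminus\{s_1\}$: row 1, columns 1–5: $1,3,4,5,6$; row 2, columns 3–5: $2,4,5$; row 3, columns 4–6: $3,4,2$; row 4, columns 4–8: $1,3,4,5,6$. - $E_7/E_6$, $J=S\setminus\{s_7\}$: row 1, columns 1–6: $7,6,5,4,3,1$; row 2, columns 4–6: $2,4,3$; row 3, columns 5–7: $5,4,2$; row 4, columns 5–9: $6,5,4,3,1$; row 5, columns 5–9: $7,6,5,4,3$; row 6, columns 8–9: $2,4$; rows 7, 8, 9, column 9: $5$, $6$, $7$ respectively. **Diagrams of elements.** A subdiagram is a set of boxes of the ambient diagram which, with each box $(i,j)$, contains every ambient box $(i',j')$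 with $i'\le i$, $j'\le j$. Subdiagrams correspond bijectively to elements of $W^J$: if the labels, read along rows left to right and rows top to bottom, are $s_{i_1},\dots,s_{i_r}$, the subdiagram is the diagram of $w=s_{i_r}\cdots s_{i_1}$, and $\ell(w)=r$. For $u\le v$ with diagrams $M,\Lambda$ one has $M\subseteq\Lambda$. **Shapes.** The shape of a skew diagram $\Lambda\setminus M$ is its set of boxes with the labels forgotten, regarded up to translation in the plane; a skew partition is such a shape. *)

(* Defs.v *)
From mathcomp Require Import all_boot all_order all_algebra all_fingroup.
From mathcomp Require Import mxrepresentation.
From mathcomp Require Import finmap.

Set Implicit Arguments.
Unset Strict Implicit.
Unset Printing Implicit Defensive.

(* Nodes of Dynkin diagrams, rows and columns are natural numbers counted
   from 1; nodes are numbered as in Bourbaki's plates. *)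

Inductive dynkin : Type :=
| TypeA of nat | TypeB of nat | TypeC of nat | TypeD of nat | TypeE6 | TypeE7.

Definition rank (X : dynkin) : nat :=
  match X with
  | TypeA n | TypeB n | TypeC n | TypeD n => n
  | TypeE6 => 6
  | TypeE7 => 7
  end.

(* The bonds i - j with i < j. *)
Definition bond (X : dynkin) (i j : nat) : bool :=
  match X with
  | TypeA _ | TypeB _ | TypeC _ => j == i.+1
  | TypeD n => ((j == i.+1) && (j < n)) || ((j == n) && (j == i.+2))
  | TypeE6 | TypeE7 =>
      (i, j) \in [:: (1, 3); (2, 4); (3, 4); (4, 5); (5, 6); (6, 7)]
  end.

(* [cartan X i j] is n(alpha_i, alpha_j) = <alpha_i, alpha_j^vee>, so that
   s_j (alpha_i) = alpha_i - n(alpha_i, alpha_j) alpha_j; the last simple root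
   is short in type B and long in type C. *)
Definition cartan (X : dynkin) (i j : nat) : int :=
  if i == j then 2%R else
  if ~~ (bond X i j || bond X j i) then 0%R else
  match X with
  | TypeB n => if (i, j) == (n.-1, n) then (- 2)%R else (-1)%R
  | TypeC n => if (i, j) == (n, n.-1) then (- 2)%R else (-1)%R
  | _ => (-1)%R
  end.

(* The matrix of s_i, acting on column vectors of coordinates in the basis of
   simple roots: column l holds the coordinates of s_i (alpha_l). *)
Definition simple_reflection_mx (X : dynkin) (i : nat) : 'M[int]_(rank X) :=
  \matrix_(k, l) ((k == l)%:R - (k.+1 == i)%:R * cartan X l.+1 i)%R.

(* A Weyl group of type X, up to isomorphism: a group generated by elements
   s_1, ..., s_n which acts faithfully on the root lattice, with s_i acting as
   the i-th simple reflection.  The values of [refl] outside 1, ..., n are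
   irrelevant. *)
Record weyl_group (X : dynkin) : Type := WeylGroup {
  weyl_sort :> finGroupType;
  refl : nat -> weyl_sort;
  root_action : mx_representation int [set: weyl_sort] (rank X);
  root_action_faithful : mx_faithful root_action;
  root_action_refl : forall i, 1 <= i <= rank X ->
    root_action (refl i) = simple_reflection_mx X i;
  refl_generate : <<[set refl i.+1 | i : 'I_(rank X)]>>%g = [set: weyl_sort]
}.

Section Coxeter.

Variables (X : dynkin) (W : weyl_group X).
Local Notation n := (rank X).
Local Notation s := (@refl X W).

Local Open Scope group_scope.

Definition has_word (w : W) (k : nat) : bool :=
  [exists t : k.-tuple 'I_n, w == \prod_(i <- t) s i.+1].

(* The least k such that w has a word with k letters; there is one with
   k < #|W|. *)
Definition length (w : W) : nat := find (has_word w) (iota 0 #|W|).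

Definition reflection (t : W) : bool :=
  [exists i : 'I_n, [exists w : W, t == s i.+1 ^ w]].

Definition bruhat (u v : W) : bool :=
  connect (fun x y : W =>
    [exists t : W, [&& reflection t, y == x * t & (length x < length y)%N]]) u v.

Definition bruhat_lt (u v : W) : bool := (u != v) && bruhat u v.

(* W^J, where J is given by the set of indices of its simple reflections. *)
Definition quotient_reps (J : pred nat) : {set W} :=
  [set w | [forall i : 'I_n, J i.+1 ==> (length w < length (w * s i.+1)%g)%N]].

Definition left_descent (w : W) (i : nat) : bool :=
  (1 <= i <= n)%N && (length (s i * w)%g < length w)%N.

Local Open Scope ring_scope.

(* [R] is the family of relative R-polynomials of W^J of type x = -1; only its
   values at pairs of elements of W^J matter. *)
Record relative_R_polynomials (J : pred nat) (R : W -> W -> {poly int}) : Prop :=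
  RelativeRPolynomials {
    relR_nle : {in quotient_reps J &, forall u v, ~~ bruhat u v -> R u v = 0};
    relR_diag : {in quotient_reps J, forall u, R u u = 1};
    relR_down : {in quotient_reps J &, forall u v i,
      bruhat_lt u v -> left_descent v i ->
      bruhat_lt (s i * u)%g u ->
      R u v = R (s i * u)%g (s i * v)%g};
    relR_out : {in quotient_reps J &, forall u v i,
      bruhat_lt u v -> left_descent v i ->
      bruhat_lt u (s i * u)%g -> (s i * u)%g \notin quotient_reps J ->
      R u v = 'X * R u (s i * v)%g};
    relR_up : {in quotient_reps J &, forall u v i,
      bruhat_lt u v -> left_descent v i ->
      bruhat_lt u (s i * u)%g -> (s i * u)%g \in quotient_reps J ->
      R u v = ('X - 1) * R u (s i * v)%g + 'X * R (s i * u)%g (s i * v)%g}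
  }.

End Coxeter.

Inductive hermitian_pair : Type :=
| A_AA of nat & nat   (* [A_AA n p] is A_n / (A_(p-1) x A_(n-p)) *)
| C_A of nat          (* C_n / A_(n-1) *)
| B_B of nat          (* B_n / B_(n-1) *)
| D_A of nat          (* D_n / A_(n-1) *)
| D_D of nat          (* D_n / D_(n-1) *)
| E6_D5
| E7_E6.

(* The ranks are those of Bourbaki's plates. *)
Definition admissible (H : hermitian_pair) : bool :=
  match H with
  | A_AA n p => 1 <= p <= n
  | C_A n | B_B n => 2 <= n
  | D_A n | D_D n => 3 <= n
  | E6_D5 | E7_E6 => true
  end.

Definition hdynkin (H : hermitian_pair) : dynkin :=
  match H with
  | A_AA n _ => TypeA n
  | C_A n => TypeC n
  | B_B n => TypeB n
  | D_A n | D_D n => TypeD n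
  | E6_D5 => TypeE6
  | E7_E6 => TypeE7
  end.

(* The index of the simple reflection that is not in J. *)
Definition omitted (H : hermitian_pair) : nat :=
  match H with
  | A_AA _ p => p
  | C_A n | D_A n => n
  | B_B _ | D_D _ | E6_D5 => 1
  | E7_E6 => 7
  end.

Definition hJ (H : hermitian_pair) : pred nat :=
  [pred i | (1 <= i <= rank (hdynkin H)) && (i != omitted H)].

(* The box (i, j) is in row i from the top and column j from the left. *)
Definition box := (nat * nat)%type.

(* Row i of the table is given by the column of its first box and the labels of
   its boxes, which are consecutive. *)
Definition table_label (rows : seq (nat * seq nat)) (i j : nat) : option nat :=
  if i is i'.+1 then
    let: (j0, labels) := nth (0, [::]) rows i' in
    if j0 <= j then onth labels (j - j0) else None
  else None.

Definition E6_table : seq (nat * seq nat) :=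
  [:: (1, [:: 1; 3; 4; 5; 6]); (3, [:: 2; 4; 5]); (4, [:: 3; 4; 2]);
      (4, [:: 1; 3; 4; 5; 6])].

Definition E7_table : seq (nat * seq nat) :=
  [:: (1, [:: 7; 6; 5; 4; 3; 1]); (4, [:: 2; 4; 3]); (5, [:: 5; 4; 2]);
      (5, [:: 6; 5; 4; 3; 1]); (5, [:: 7; 6; 5; 4; 3]); (8, [:: 2; 4]);
      (9, [:: 5]); (9, [:: 6]); (9, [:: 7])].

(* The label of a box, or [None] outside the ambient diagram. *)
Definition label (H : hermitian_pair) (b : box) : option nat :=
  let: (i, j) := b in
  match H with
  | A_AA n p =>
      if (1 <= i <= n + 1 - p) && (1 <= j <= p) then Some (p + i - j) else None
  | C_A n => if (1 <= i <= j) && (j <= n) then Some (n - (j - i)) else None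
  | B_B n =>
      if (i == 1) && (1 <= j <= n) then Some j else
      if (2 <= i <= n) && (j == n) then Some (n + 1 - i) else None
  | D_A n =>
      if (1 <= i <= j) && (j <= n - 1) then
        if i == j then Some (if odd i then n else n - 1)
        else Some (n - 1 - (j - i))
      else None
  | D_D n =>
      if (i == 1) && (1 <= j <= n - 2) then Some j else
      if (i == 1) && (j == n - 1) then Some n else
      if (i == 2) && (j == n - 2) then Some (n - 1) else
      if (2 <= i <= n - 1) && (j == n - 1) then Some (n - i) else None
  | E6_D5 => table_label E6_table i j
  | E7_E6 => table_label E7_table i j
  end.

Definition ambient (H : hermitian_pair) : pred box := [pred b | label H b].

Local Open Scope fset_scope.

Definition subdiagram (H : hermitian_pair) (M : {fset box}) : Prop :=
  (forall b, b \in M -> b \in ambient H) /\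
  (forall b b', b \in M -> b' \in ambient H ->
     b'.1 <= b.1 -> b'.2 <= b.2 -> b' \in M).

(* Along rows from left to right, rows from top to bottom. *)
Definition reading_order (b b' : box) : bool :=
  (b.1 < b'.1) || ((b.1 == b'.1) && (b.2 <= b'.2)).

Definition reading_word (H : hermitian_pair) (M : {fset box}) : seq nat :=
  pmap (label H) (sort reading_order M).

(* A reading word i_1, ..., i_r gives s_(i_r) ... s_(i_1). *)
Definition diagram_element (H : hermitian_pair) (W : weyl_group (hdynkin H))
    (M : {fset box}) : W :=
  (\prod_(k <- rev (reading_word H M)) refl W k)%g.

Definition is_diagram_of (H : hermitian_pair) (W : weyl_group (hdynkin H))
    (M : {fset box}) (w : W) : Prop :=
  subdiagram H M /\ w = diagram_element W M.

Definition translate (c : int * int) (D : {fset box}) : {fset int * int} :=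
  [fset ((b.1%:Z + c.1)%R, (b.2%:Z + c.2)%R) | b in D].

(* D and D' coincide up to a translation of the plane. *)
Definition same_shape (D D' : {fset box}) : Prop :=
  exists c : int * int, translate c D = translate (0%R, 0%R) D'.

(* Main.v *)
(* Write [st M i] for 1, -1 or 0 according as [M] has an addable box, a
   removable box or no such box labelled i.  These are the coordinates of the
   image under the element of [M] of the fundamental coweight fixed by W_J: the
   pairs being cominuscule, adding a box changes [st] by a row of the Cartan
   matrix.  This identifies lengths, membership in W^J and the three cases of the
   recursion with the combinatorics of boxes.

   The recursion says that f_L := (M |-> R_(M,L)) is obtained from f_(L - b) by an
   operator [hecke]; these operators satisfy the braid relations, so
   [hecke i f_L = q f_L] when [st L i = 0].  Hence the recursion can also be run by
   adding boxes to [M].  Let c be the first box of the skew diagram in reading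
   order, w and h the lengths of the run to the right of c and of the run down
   from its end, and b the last box of the latter.  If h < w (resp. h > w) then R is
   q times the polynomial obtained by removing b from [L] (resp. adding c to [M]);
   if h = w then it is (q - 1) R_(M, L - b) + q R_(M + c, L - b).  This rule, which
   only refers to the shape, is valid for all the infinite families because there
   a label determines a diagonal.  For E6 and E7 it may fail, but only for shapes
   which do not occur in the infinite families; two such skew diagrams of the same
   shape always have a common reduction, found by exhaustion. *)

Require Import Defs.
From mathcomp Require Import all_boot all_order all_algebra all_fingroup.
From mathcomp Require Import mxrepresentation.
From mathcomp Require Import finmap.
From mathcomp Require Import zify ring.

Set Implicit Arguments.
Unset Strict Implicit.
Unset Printing Implicit Defensive.

(** * Ambient diagrams *)

(** The recursion branches on the status in [M] of a label, and a shape has forgotten its labels. So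
    for two skew diagrams of the same shape one looks for a single step that both pairs admit. The
    choice of b and c achieves this whenever each label lies on one diagonal. The diagonal of b then
    meets the row of c, or the diagonal of c meets the column of b, in a box of the skew diagram.
    The neighbours of that box inside the skew diagram decide whether it is a corner of [M] or of
    [L], and the other boxes on the diagonal are never corners. When h = w, the boxes b and c share
    a diagonal but may carry different labels, as on the main diagonal of D_n / A_(n-1); the same
    formula then results from two successive steps.

    For E6 and E7 the failure of this rule always comes with one of three local configurations
    ([pattern]). The ambient diagrams of the infinite families exclude all three, so a comparison
    with an infinite family requires no search. Only two exceptional diagrams have to be compared by
    enumeration. *)

Definition left (x : box) : box := (x.1, x.2.-1).
Definition up (x : box) : box := (x.1.-1, x.2).
Definition right (x : box) : box := (x.1, x.2.+1).
Definition down (x : box) : box := (x.1.+1, x.2).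
Definition southwest (x : box) : box := (x.1.+1, x.2.-1).
Definition northeast (x : box) : box := (x.1.-1, x.2.+1).

Definition exceptional (H : hermitian_pair) : bool :=
  match H with E6_D5 | E7_E6 => true | _ => false end.

Lemma some_if_eq (T : eqType) (c : bool) (u k : T) (o : option T) :
  ((if c then Some u else o) == Some k) = if c then u == k else o == Some k.
Proof. by case: c. Qed.

Lemma some_eq (T : eqType) (u k : T) : (Some u == Some k) = (u == k).
Proof. by []. Qed.

Lemma none_eq (T : eqType) (k : T) : (None == Some k) = false.
Proof. by []. Qed.

Lemma some_if (T : Type) (c : bool) (u : T) (o : option T) :
  isSome (if c then Some u else o) = c || o.
Proof. by case: c. Qed.

Lemma if_orb (c x y : bool) : (if c then x else y) = (c && x) || (~~ c && y).
Proof. by case: c; rewrite ?orbF. Qed.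

(** Closed boolean forms of the labellings, one per infinite family, in a shape that [lia] can
    process. *)
Lemma label_A n p a b k : (label (A_AA n p) (a, b) == Some k) =
  [&& 1 <= a, a <= n + 1 - p, 1 <= b, b <= p & p + a - b == k].
Proof. by rewrite /label some_if_eq if_orb andbF orbF -!andbA. Qed.

Lemma label_C n a b k : (label (C_A n) (a, b) == Some k) =
  [&& 1 <= a, a <= b, b <= n & n - (b - a) == k].
Proof. by rewrite /label some_if_eq if_orb andbF orbF -!andbA. Qed.

Lemma label_B n a b k : (label (B_B n) (a, b) == Some k) =
  [&& a == 1, 1 <= b, b <= n & b == k] ||
  [&& 2 <= a, a <= n, b == n & n + 1 - a == k].
Proof. by rewrite /label !some_if_eq !if_orb andbF orbF; lia. Qed.

Lemma label_DA n a b k : (label (D_A n) (a, b) == Some k) =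
  [&& 1 <= a, a <= b, b <= n - 1 &
      [|| [&& a == b, odd a & n == k], [&& a == b, ~~ odd a & n - 1 == k]
        | (a != b) && (n - 1 - (b - a) == k)]].
Proof.
rewrite /label; case: ifP => Hc; last by apply/esym/negbTE; move: Hc; lia.
by rewrite some_if_eq if_orb some_eq; case: (odd a); lia.
Qed.

Lemma label_DD n a b k : 3 <= n -> (label (D_D n) (a, b) == Some k) =
  [|| [&& a == 1, 1 <= b, b <= n - 2 & b == k],
      [&& a == 1, b == n - 1 & n == k],
      [&& a == 2, b == n - 2 & n - 1 == k]
    | [&& 2 <= a, a <= n - 1, b == n - 1 & n - a == k]].
Proof.
move=> Hn; rewrite /label; case: (a =P 1) => [->|Ha] /=.
  case: ifP => Hb; rewrite ?some_eq ?none_eq; first by lia.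
  by case: (b =P n - 1) => Hb'; rewrite ?some_eq ?none_eq /=; lia.
case: (a =P 2) => [->|Ha'] /=.
  case: (b =P n - 2) => Hb; rewrite ?some_eq ?none_eq; first by lia.
  by case: ifP => Hb'; rewrite ?some_eq ?none_eq; lia.
by case: ifP => Hb'; rewrite ?some_eq ?none_eq; lia.
Qed.

Lemma ambient_A n p a b : ((a, b) \in ambient (A_AA n p)) =
  [&& 1 <= a, a <= n + 1 - p, 1 <= b & b <= p].
Proof. by rewrite inE /label some_if orbF -!andbA. Qed.

Lemma ambient_C n a b : ((a, b) \in ambient (C_A n)) = [&& 1 <= a, a <= b & b <= n].
Proof. by rewrite inE /label some_if orbF -!andbA. Qed.

Lemma ambient_B n a b : ((a, b) \in ambient (B_B n)) =
  [&& a == 1, 1 <= b & b <= n] || [&& 2 <= a, a <= n & b == n].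
Proof. by rewrite inE /label !some_if orbF -!andbA. Qed.

Lemma ambient_DA n a b : ((a, b) \in ambient (D_A n)) =
  [&& 1 <= a, a <= b & b <= n - 1].
Proof.
rewrite inE /label; case: ifP => Hc; last by move: Hc => /=; lia.
by case: ifP => _ /=; lia.
Qed.

Lemma ambient_DD n a b : 3 <= n -> ((a, b) \in ambient (D_D n)) =
  [|| [&& a == 1, 1 <= b & b <= n - 1], (a == 2) && (b == n - 2)
    | [&& 2 <= a, a <= n - 1 & b == n - 1]].
Proof.
move=> Hn; rewrite inE /label !some_if orbF; case: (a =P 1) => [->|Ha] /=; last by lia.
lia.
Qed.

(** The summand 3 comes from E6 and E7: their diagrams reach columns 8 and 9, and the bound has to
    be strict. *)
Definition side (H : hermitian_pair) : nat := (rank (hdynkin H)).+3.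

Definition boxes (H : hermitian_pair) : seq box :=
  [seq x <- [seq (i, j) | i <- iota 0 (side H), j <- iota 0 (side H)]
   | x \in ambient H].

Lemma onth_some (T : Type) (s : seq T) i : onth s i -> i < size s.
Proof. by elim: s i => [|x s IH] [|i] //=; apply: IH. Qed.

Lemma table_bound rows i j : isSome (table_label rows i j) ->
  i <= size rows /\ exists2 r, r \in rows & j < r.1 + size r.2.
Proof.
case: i => // i; rewrite /table_label.
case: (ltnP i (size rows)) => Hi; last by rewrite nth_default //; case: j.
have := mem_nth (0, [::]) Hi; case: (nth _ _ _) => j0 l /= Hr.
case: ifP => // Hj /onth_some Hl; split=> //; exists (j0, l) => //=; lia.
Qed.

Lemma ambient_bound H x : admissible H -> x \in ambient H ->
  [&& 1 <= x.1, 1 <= x.2, x.1 < side H & x.2 < side H].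
Proof.
case: x => a b; case: H => [n p|n|n|n|n||] /= Hadm; rewrite /side /=.
- by rewrite ambient_A; lia.
- by rewrite ambient_C; lia.
- by rewrite ambient_B; lia.
- by rewrite ambient_DA; lia.
- by rewrite ambient_DD //; lia.
- move=> Hx; have [Ha [r Hr Hb]] := table_bound Hx.
  have Hs : r.1 + size r.2 <= 9.
    by apply: (allP (_ : all (fun r => r.1 + size r.2 <= 9) E6_table)).
  case: a Hx Ha => // a Hx /= Ha; case: b Hb Hx => [|b] Hb Hx; last by lia.
  by move: Hx {Ha}; do 10 (case: a => [|a] //).
- move=> Hx; have [Ha [r Hr Hb]] := table_bound Hx.
  have Hs : r.1 + size r.2 <= 10.
    by apply: (allP (_ : all (fun r => r.1 + size r.2 <= 10) E7_table)).
  case: a Hx Ha => // a Hx /= Ha; case: b Hb Hx => [|b] Hb Hx; last by lia.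
  by move: Hx {Ha}; do 10 (case: a => [|a] //).
Qed.

Lemma mem_boxes H x : admissible H -> (x \in boxes H) = (x \in ambient H).
Proof.
move=> Hadm; rewrite mem_filter andb_idr // => /(ambient_bound Hadm).
by case: x => a b Hx; apply: allpairs_f; rewrite mem_iota /=; move: Hx => /=; lia.
Qed.

Lemma boxes_uniq H : uniq (boxes H).
Proof.
by apply: filter_uniq; apply: allpairs_uniq; rewrite ?iota_uniq // => -[? ?] [].
Qed.

Lemma ambient_label H x : x \in ambient H -> exists k, label H x == Some k.
Proof. by rewrite inE; case: (label H x) => // k _; exists k. Qed.

Lemma label_ambient H x k : label H x == Some k -> x \in ambient H.
Proof. by move=> /eqP; rewrite inE => ->. Qed.

(** Turns a computation over the finite list [boxes] into a statement about all ambient boxes; this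
    settles the facts about E6 and E7. *)
Lemma all_boxes H (P : pred box) : admissible H -> all P (boxes H) ->
  forall x, x \in ambient H -> P x.
Proof. by move=> Hadm /allP HP x; rewrite -(mem_boxes _ Hadm) => /HP. Qed.

Lemma all_boxes2 H (P : rel box) : admissible H ->
  all (fun x => all (P x) (boxes H)) (boxes H) ->
  forall x y, x \in ambient H -> y \in ambient H -> P x y.
Proof.
by move=> Hadm HP x y /(all_boxes Hadm HP) Hx; apply: (all_boxes Hadm Hx).
Qed.

Lemma label_range H x k : admissible H -> label H x == Some k ->
  1 <= k <= rank (hdynkin H).
Proof.
move=> Hadm Hx; case: (boolP (exceptional H)) => [He|Hreg].
  pose P y := if label H y is Some i then 1 <= i <= rank (hdynkin H) else false.
  have HP : all P (boxes H).
    by rewrite /P; case: H He {P x Hx Hadm} => [? ?|?|?|?|?||] He;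
      try discriminate He; vm_compute.
  by have := all_boxes Hadm HP (label_ambient Hx); rewrite /P (eqP Hx).
case: x Hx => a b; case: H Hadm Hreg => [n p|n|n|n|n||] // Hadm _ Hx.
- by move: Hadm Hx; rewrite label_A /=; lia.
- by move: Hadm Hx; rewrite label_C /=; lia.
- by move: Hadm Hx; rewrite label_B /=; lia.
- by move: Hadm Hx; rewrite label_DA /=; lia.
- by move: Hx; rewrite label_DD //; move: Hadm => /=; lia.
Qed.

Lemma label_origin H : admissible H -> label H (1, 1) == Some (omitted H).
Proof.
case: H => [n p|n|n|n|n||] // Hadm.
- by rewrite label_A; move: Hadm => /=; lia.
- by rewrite label_C; move: Hadm => /=; lia.
- by rewrite label_B; move: Hadm => /=; lia.
- by rewrite label_DA; move: Hadm => /=; lia.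
- by rewrite label_DD //; move: Hadm => /=; lia.
Qed.

(** From [y] one can step left or up without leaving the region above [x]. This is what makes the
    local definition of an addable box, through two neighbours, equivalent to the global ideal
    condition. *)
Lemma ambient_lower H x y : admissible H -> x \in ambient H -> y \in ambient H ->
  x.1 <= y.1 -> x.2 <= y.2 -> x != y ->
  (left y \in ambient H) && (x.2 < y.2) || (up y \in ambient H) && (x.1 < y.1).
Proof.
move=> Hadm; case: (boolP (exceptional H)) => [He|Hreg].
  pose P x y := [==> x.1 <= y.1, x.2 <= y.2, x != y =>
    (left y \in ambient H) && (x.2 < y.2) || (up y \in ambient H) && (x.1 < y.1)].
  have HP : all (fun x => all (P x) (boxes H)) (boxes H).
    by rewrite /P; case: H He {P x y Hadm} => [? ?|?|?|?|?||] He;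
      try discriminate He; vm_compute.
  move=> Hx Hy H1 H2 H3; have := all_boxes2 Hadm HP Hx Hy.
  by rewrite /P H1 H2 H3.
case: x => a b; case: y => c d.
case: H Hadm Hreg => [n p|n|n|n|n||] //= Hadm _; rewrite /left /up /=.
- by rewrite !ambient_A -pair_eqE /=; lia.
- by rewrite !ambient_C -pair_eqE /=; lia.
- by rewrite !ambient_B -pair_eqE /=; lia.
- by rewrite !ambient_DA -pair_eqE /=; lia.
rewrite !ambient_DD // -pair_eqE /= =>
  /or3P[/and3P[/eqP-> ? ?]|/andP[/eqP-> /eqP->]|/and3P[? ? /eqP->]]
  /or3P[/and3P[/eqP-> ? ?]|/andP[/eqP-> /eqP->]|/and3P[? ? /eqP->]]
  ? ? ?; lia.
Qed.

(** The dual step, from [x] towards [y], which plays the same part for removable boxes. *)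
Lemma ambient_upper H x y : admissible H -> x \in ambient H -> y \in ambient H ->
  x.1 <= y.1 -> x.2 <= y.2 -> x != y ->
  (right x \in ambient H) && (x.2 < y.2) || (down x \in ambient H) && (x.1 < y.1).
Proof.
move=> Hadm; case: (boolP (exceptional H)) => [He|Hreg].
  pose P x y := [==> x.1 <= y.1, x.2 <= y.2, x != y =>
    (right x \in ambient H) && (x.2 < y.2) || (down x \in ambient H) && (x.1 < y.1)].
  have HP : all (fun x => all (P x) (boxes H)) (boxes H).
    by rewrite /P; case: H He {P x y Hadm} => [? ?|?|?|?|?||] He;
      try discriminate He; vm_compute.
  move=> Hx Hy H1 H2 H3; have := all_boxes2 Hadm HP Hx Hy.
  by rewrite /P H1 H2 H3.
case: x => a b; case: y => c d.
case: H Hadm Hreg => [n p|n|n|n|n||] //= Hadm _; rewrite /right /down /=.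
- by rewrite !ambient_A -pair_eqE /=; lia.
- by rewrite !ambient_C -pair_eqE /=; lia.
- by rewrite !ambient_B -pair_eqE /=; lia.
- by rewrite !ambient_DA -pair_eqE /=; lia.
rewrite !ambient_DD // -pair_eqE /= =>
  /or3P[/and3P[/eqP-> ? ?]|/andP[/eqP-> /eqP->]|/and3P[? ? /eqP->]]
  /or3P[/and3P[/eqP-> ? ?]|/andP[/eqP-> /eqP->]|/and3P[? ? /eqP->]]
  ? ? ?; lia.
Qed.

Arguments label : simpl never.

(** Boxes of equal label are comparable. Hence a diagram has at most one corner, addable or
    removable, of a given label. *)
Lemma label_chain H x y k : admissible H -> label H x == Some k -> label H y == Some k ->
  (x.1 <= y.1) && (x.2 <= y.2) || (y.1 <= x.1) && (y.2 <= x.2).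
Proof.
move=> Hadm; case: (boolP (exceptional H)) => [He|Hreg].
  pose P x y := (label H x == label H y) ==>
    ((x.1 <= y.1) && (x.2 <= y.2) || (y.1 <= x.1) && (y.2 <= x.2)).
  have HP : all (fun x => all (P x) (boxes H)) (boxes H).
    by rewrite /P; case: H He {P x y Hadm} => [? ?|?|?|?|?||] He;
      try discriminate He; vm_compute.
  move=> Hx Hy; have := all_boxes2 Hadm HP (label_ambient Hx) (label_ambient Hy).
  by rewrite /P (eqP Hx) (eqP Hy) eqxx.
case: x => a b; case: y => c d.
case: H Hadm Hreg => [n p|n|n|n|n||] //= Hadm _.
- by rewrite !label_A; lia.
- by rewrite !label_C; lia.
- by rewrite !label_B; lia.
- by rewrite !label_DA; lia.
rewrite !label_DD // => H1 H2.
by case/or4P: H1 => H1; case/or4P: H2 => H2; lia.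
Qed.

(** * Local change of the corners compared with the Cartan matrix *)

Definition adjacency (X : dynkin) (i j : nat) : nat :=
  if i == j then 0 else if ~~ (bond X i j || bond X j i) then 0 else
  match X with
  | TypeB n => if (i, j) == (n.-1, n) then 2 else 1
  | TypeC n => if (i, j) == (n, n.-1) then 2 else 1
  | _ => 1
  end.

Lemma cartan_adjacency X i j :
  cartan X i j = ((2 * (i == j))%N%:Z - (adjacency X i j)%:Z)%R.
Proof.
rewrite /cartan /adjacency; case: eqP => // _; case: ifP => // _.
by case: X => *; try case: ifP.
Qed.

(* The increase at label [i], not counting [x] itself, of the number of addable
   minus the number of removable boxes when [x] is added to a diagram; [s] and [t]
   tell whether the diagram contains the south-west and north-east neighbours. *)
Definition local_count H (x : box) (i : nat) (s t : bool) : nat :=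
  ((label H (left x) == Some i) && ~~ s) +
  ((label H (down x) == Some i) && (s || (southwest x \notin ambient H))) +
  ((label H (up x) == Some i) && ~~ t) +
  ((label H (right x) == Some i) && (t || (northeast x \notin ambient H))).

Lemma local_count_split H x i (s t : bool) : local_count H x i s t =
  (((label H (left x) == Some i) && ~~ s) +
  ((label H (down x) == Some i) && (s || (southwest x \notin ambient H)))) +
  (((label H (up x) == Some i) && ~~ t) +
  ((label H (right x) == Some i) && (t || (northeast x \notin ambient H)))).
Proof. by rewrite /local_count; lia. Qed.

(** The left and lower neighbours carry the label [k.+1], the upper and right ones [k.-1]. The
    presence of the southwest box decides which of the first two is counted, not how many are;
    likewise for the northeast box and the other two. *)
Lemma local_count_A n p x (k i : nat) (s t : bool) : 1 <= p <= n ->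
  label (A_AA n p) x == Some k -> 1 <= i <= n ->
  (s -> southwest x \in ambient (A_AA n p)) ->
  (t -> northeast x \in ambient (A_AA n p)) ->
  local_count (A_AA n p) x i s t = (k == i.+1) + (i == k.+1).
Proof.
case: x => a b Hp; rewrite label_A => Hx Hi; rewrite local_count_split.
rewrite /left /right /up /down /southwest /northeast /= !ambient_A => Hs Ht.
have -> : (label (A_AA n p) (a.-1, b) == Some i) = (1 < a) && (k == i.+1).
  by rewrite label_A; lia.
have -> : (label (A_AA n p) (a, b.+1) == Some i) = (b < p) && (k == i.+1).
  by rewrite label_A; lia.
have -> : (label (A_AA n p) (a, b.-1) == Some i) = (1 < b) && (i == k.+1).
  by rewrite label_A; lia.
have -> : (label (A_AA n p) (a.+1, b) == Some i) = (a < n + 1 - p) && (i == k.+1).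
  by rewrite label_A; lia.
rewrite addnC; congr (_ + _).
  by case: t Ht {Hs} => Ht; lia.
by case: s Hs {Ht} => Hs; lia.
Qed.

(** The entry 2 arises next to the main diagonal: the left and lower neighbours of [(a, a.+1)] both
    have label [n], and both count because the southwest box is not ambient. *)
Lemma local_count_C n x (k i : nat) (s t : bool) : 2 <= n ->
  label (C_A n) x == Some k -> 1 <= i <= n ->
  (s -> southwest x \in ambient (C_A n)) ->
  (t -> northeast x \in ambient (C_A n)) ->
  local_count (C_A n) x i s t = (k == i.+1) + (i == k.+1) * (1 + (i == n)).
Proof.
case: x => a b Hp; rewrite label_C => Hx Hi; rewrite local_count_split.
rewrite /left /right /up /down /southwest /northeast /= !ambient_C => Hs Ht.
have -> : (label (C_A n) (a.-1, b) == Some i) = (1 < a) && (k == i.+1).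
  by rewrite label_C; lia.
have -> : (label (C_A n) (a, b.+1) == Some i) = (b < n) && (k == i.+1).
  by rewrite label_C; lia.
have -> : (label (C_A n) (a, b.-1) == Some i) = (a < b) && (i == k.+1).
  by rewrite label_C; lia.
have -> : (label (C_A n) (a.+1, b) == Some i) = (a < b) && (i == k.+1).
  by rewrite label_C; lia.
rewrite addnC; congr (_ + _).
  by case: t Ht {Hs} => Ht; lia.
by case: s Hs {Ht} => Hs; lia.
Qed.

(** Here the entry 2 arises at the corner [(1, n)], whose left and lower neighbours both have label
    [n.-1]. *)
Lemma local_count_B n x (k i : nat) (s t : bool) : 2 <= n ->
  label (B_B n) x == Some k -> 1 <= i <= n ->
  (s -> southwest x \in ambient (B_B n)) ->
  (t -> northeast x \in ambient (B_B n)) ->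
  local_count (B_B n) x i s t = (k == i.+1) * (1 + (k == n)) + (i == k.+1).
Proof.
case: x => a b Hp; rewrite label_B => Hx Hi; rewrite local_count_split.
rewrite /left /right /up /down /southwest /northeast /= !ambient_B => Hs Ht.
have {}Hs : s = false by case: s Hs => // /(_ isT); move: Hx; lia.
have {}Ht : t = false by case: t Ht => // /(_ isT); move: Hx; lia.
rewrite {}Hs {}Ht; case/orP: Hx => /and4P[H1 H2 H3 H4].
  have [Ha Hk] : a = 1 /\ k = b by lia.
  by subst a k; rewrite !label_B; case: (b =P n) => [->|Hb]; lia.
have [Hb Hk] : b = n /\ k = n + 1 - a by lia.
subst b k.
have -> : (label (B_B n) (a.-1, n) == Some i) = (i == (n + 1 - a).+1).
  by rewrite label_B; lia.
have -> : (label (B_B n) (a, n.+1) == Some i) = false by rewrite label_B; lia.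
have -> : (label (B_B n) (a, n.-1) == Some i) = false by rewrite label_B; lia.
have -> : (label (B_B n) (a.+1, n) == Some i) = (a < n) && (n + 1 - a == i.+1).
  by rewrite label_B; lia.
lia.
Qed.

Lemma label_DA_off n a b k : a < b -> (label (D_A n) (a, b) == Some k) =
  [&& 1 <= a, b <= n - 1 & n - 1 - (b - a) == k].
Proof. by move=> Hab; rewrite label_DA ltn_eqF // (ltnW Hab). Qed.

Lemma label_DA_diag n a k : (label (D_A n) (a, a) == Some k) =
  [&& 1 <= a, a <= n - 1 & odd a && (n == k) || ~~ odd a && (n - 1 == k)].
Proof. by rewrite label_DA eqxx leqnn /= orbF. Qed.

(** The geometry is that of type C, but the labels alternate along the main diagonal: the two
    neighbours of [(a, a.+1)] on it have labels [n - 1] and [n], one for each branch of the fork. *)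
Lemma local_count_DA n x (k i : nat) (s t : bool) : 3 <= n ->
  label (D_A n) x == Some k -> 1 <= i <= n ->
  (s -> southwest x \in ambient (D_A n)) ->
  (t -> northeast x \in ambient (D_A n)) ->
  local_count (D_A n) x i s t = bond (TypeD n) i k + bond (TypeD n) k i.
Proof.
case: x => a b Hp Hx Hi.
have Hab : [&& 1 <= a, a <= b & b <= n - 1].
  by rewrite -ambient_DA; apply: label_ambient Hx.
move: Hx; rewrite label_DA => Hx; rewrite local_count_split.
rewrite /left /right /up /down /southwest /northeast /= !ambient_DA => Hs Ht.
case: (a =P b) Hx => [Eab|Nab] Hx.
  subst b; have -> : s = false by case: s Hs => // /(_ isT); move: Hab; lia.
  have Hk : (k == n) || (k == n - 1) by move: Hx; clear; lia.
  clear Hx Hs.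
  have -> : (label (D_A n) (a, a.-1) == Some i) = false.
    by rewrite label_DA; clear Ht; lia.
  have -> : (label (D_A n) (a.+1, a) == Some i) = false.
    by rewrite label_DA; clear Ht; lia.
  have -> : (label (D_A n) (a.-1, a) == Some i) = (1 < a) && (i == n - 2).
    by rewrite label_DA_off; clear Ht; lia.
  have -> : (label (D_A n) (a, a.+1) == Some i) = (a < n - 1) && (i == n - 2).
    by rewrite label_DA_off; clear Ht; lia.
  rewrite /= add0n; transitivity (i == n - 2 : nat); last by clear Ht; lia.
  by case: t Ht => Ht; lia.
have {}Nab : a < b by lia.
have {}Hx : k = n - 1 - (b - a) by move: Hx; clear -Nab; lia.
have -> : (label (D_A n) (a.-1, b) == Some i) = (1 < a) && (k == i.+1).
  by rewrite label_DA_off; clear Ht Hs; lia.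
have -> : (label (D_A n) (a, b.+1) == Some i) = (b < n - 1) && (k == i.+1).
  by rewrite label_DA_off; clear Ht Hs; lia.
rewrite addnC.
have -> : (1 < a) && (k == i.+1) && ~~ t + (b < n - 1) && (k == i.+1) &&
   (t || ~~ [&& 0 < a.-1, a.-1 <= b.+1 & b.+1 <= n - 1]) = (k == i.+1).
  by case: t Ht {Hs} => Ht; lia.
clear Ht; case: (b =P a.+1) => [Eb|Nb].
  subst b; have -> : s = false by case: s Hs => // /(_ isT); lia.
  clear Hs; have {}Hx : k = n - 2 by lia.
  have -> : (label (D_A n) (a, a.+1.-1) == Some i) =
      (odd a && (i == n)) || (~~ odd a && (i == n - 1)).
    by rewrite label_DA_diag; case: (odd a); lia.
  have -> : (label (D_A n) (a.+1, a.+1) == Some i) =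
      (odd a && (i == n - 1)) || (~~ odd a && (i == n)).
    by rewrite label_DA_diag /=; case: (odd a); lia.
  by case: (odd a) => /=; lia.
have -> : (label (D_A n) (a, b.-1) == Some i) = (i == k.+1).
  by rewrite label_DA_off; clear Hs; lia.
have -> : (label (D_A n) (a.+1, b) == Some i) = (i == k.+1).
  by rewrite label_DA_off; clear Hs; lia.
have -> : bond (TypeD n) i k + bond (TypeD n) k i = (k == i.+1) + (i == k.+1).
  by rewrite /=; clear Hs; lia.
congr (_ + _); case: s Hs => Hs; lia.
Qed.

(** The fork appears twice: from [(1, n - 2)] to the right and down, and from [(2, n - 1)] to the
    left and up. The four cases are the row, its last box, the extra box [(2, n - 2)] and the
    column. *)
Lemma local_count_DD n x (k i : nat) (s t : bool) : 3 <= n ->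
  label (D_D n) x == Some k -> 1 <= i <= n ->
  (s -> southwest x \in ambient (D_D n)) ->
  (t -> northeast x \in ambient (D_D n)) ->
  local_count (D_D n) x i s t = bond (TypeD n) i k + bond (TypeD n) k i.
Proof.
case: x => a b Hp Hx Hi; rewrite local_count_split.
rewrite /left /right /up /down /southwest /northeast /= !ambient_DD //.
have {Hx} : [\/ a = 1 /\ 1 <= b <= n - 2 /\ k = b, a = 1 /\ b = n - 1 /\ k = n,
    a = 2 /\ b = n - 2 /\ k = n - 1
  | 2 <= a <= n - 1 /\ b = n - 1 /\ k = n - a].
  move: Hx; rewrite label_DD //.
  case/or4P=> [/and4P[? ? ? ?]|/and3P[? ? ?]|/and3P[? ? ?]|/and4P[? ? ? ?]];
    [constructor 1|constructor 2|constructor 3|constructor 4]; lia.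
case=> -[Ha [Hb Hk]] Hs Ht.
- have -> : s = false by case: s Hs => // /(_ isT); move: Ha Hb; clear; lia.
  have -> : t = false by case: t Ht => // /(_ isT); move: Ha Hb; clear; lia.
  subst a k; clear Hs Ht.
  have -> : (label (D_D n) (1, b.-1) == Some i) = (1 < b) && (i == b.-1).
    by rewrite label_DD; lia.
  have -> : (label (D_D n) (2, b) == Some i) = (b == n - 2) && (i == n - 1).
    by rewrite label_DD; lia.
  have -> : (label (D_D n) (0, b) == Some i) = false by rewrite label_DD; lia.
  have -> : (label (D_D n) (1, b.+1) == Some i) =
      (b == n - 2) && (i == n) || (b < n - 2) && (i == b.+1).
    by rewrite label_DD; lia.
  case: (b =P n - 2) => [->|Nb] /=; lia.
- subst a b k; clear Hs Ht.
  have -> : (label (D_D n) (1, (n - 1).-1) == Some i) = (i == n - 2).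
    by rewrite label_DD; lia.
  have -> : (label (D_D n) (2, n - 1) == Some i) = (i == n - 2).
    by rewrite label_DD; lia.
  have -> : (label (D_D n) (0, n - 1) == Some i) = false by rewrite label_DD; lia.
  have -> : (label (D_D n) (1, (n - 1).+1) == Some i) = false by rewrite label_DD; lia.
  case: s => /=; lia.
- subst a b k; clear Hs Ht.
  have -> : (label (D_D n) (2, (n - 2).-1) == Some i) = false by rewrite label_DD; lia.
  have -> : (label (D_D n) (3, n - 2) == Some i) = false by rewrite label_DD; lia.
  have -> : (label (D_D n) (1, n - 2) == Some i) = (i == n - 2) by rewrite label_DD; lia.
  have -> : (label (D_D n) (2, (n - 2).+1) == Some i) = (i == n - 2).
    by rewrite label_DD; lia.
  case: t => /=; lia.
have -> : s = false by case: s Hs => // /(_ isT); move: Ha Hb; clear; lia.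
have -> : t = false by case: t Ht => // /(_ isT); move: Ha Hb; clear -Hp; lia.
subst b k; clear Hs Ht.
have -> : (label (D_D n) (a, (n - 1).-1) == Some i) = (a == 2) && (i == n - 1).
  by rewrite label_DD; lia.
have -> : (label (D_D n) (a.+1, n - 1) == Some i) = (a < n - 1) && (i == n - a.+1).
  by rewrite label_DD; lia.
have -> : (label (D_D n) (a.-1, n - 1) == Some i) =
    (a == 2) && (i == n) || (2 < a) && (i == (n - a).+1).
  by rewrite label_DD; lia.
have -> : (label (D_D n) (a, (n - 1).+1) == Some i) = false by rewrite label_DD; lia.
case: (a =P 2) => [->|Na] /=.
  transitivity ((i == n - 1) + (i == n) + ((3 < n) && (i == n - 3)) : nat); last by lia.
  have [Hi1|Hi1] := leqP (n - 1) i; first by have [->|->] : i = n - 1 \/ i = n; lia.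
  by lia.
transitivity ((a < n - 1) && (i == n - a.+1) + (i == (n - a).+1)); last by lia.
by have : n - a <= n - 3; lia.
Qed.

Lemma local_count_exceptional H x (k i : nat) (s t : bool) : exceptional H ->
  label H x == Some k -> 1 <= i <= rank (hdynkin H) ->
  (s -> southwest x \in ambient H) -> (t -> northeast x \in ambient H) ->
  local_count H x i s t = adjacency (hdynkin H) i k.
Proof.
move=> He Hx Hi Hs Ht.
pose P (y : box) := if label H y is Some l then
  all (fun j => all (fun u : bool => all (fun v : bool =>
    [==> u ==> (southwest y \in ambient H), v ==> (northeast y \in ambient H) =>
     local_count H y j u v == adjacency (hdynkin H) j l]) [:: true; false])
    [:: true; false]) (iota 1 (rank (hdynkin H))) else true.
have HP : all P (boxes H) by rewrite /P; case: H He {x Hx Hi Hs Ht P} => // _; vm_compute.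
have Hadm : admissible H by case: H He {x Hx Hi Hs Ht P HP}.
have := all_boxes Hadm HP (label_ambient Hx); rewrite /P (eqP Hx).
have Hj : i \in iota 1 (rank (hdynkin H)) by rewrite mem_iota; lia.
have Hb (u : bool) : u \in [:: true; false] by case: u.
move=> /allP /(_ i Hj) /allP /(_ s (Hb s)) /allP /(_ t (Hb t)).
by rewrite (introT implyP Hs) (introT implyP Ht) /= => /eqP.
Qed.

Lemma local_countE H x (k i : nat) (s t : bool) : admissible H ->
  label H x == Some k -> 1 <= i <= rank (hdynkin H) ->
  (s -> southwest x \in ambient H) -> (t -> northeast x \in ambient H) ->
  local_count H x i s t = adjacency (hdynkin H) i k.
Proof.
move=> Hadm Hx Hi Hs Ht; have := label_range Hadm Hx.
case: H Hadm Hx Hi Hs Ht => [n p|n|n|n|n||] /= Hadm Hx Hi Hs Ht Hk.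
- rewrite (local_count_A Hadm Hx) // /adjacency /=.
  by case: (i =P k) => ?; [|case: ifP]; lia.
- rewrite (local_count_C Hadm Hx) // /adjacency /= -!pair_eqE /=.
  by case: (i =P k) => ?; [|case: ifP => ?; [|case: ifP]]; lia.
- rewrite (local_count_B Hadm Hx) // /adjacency /= -!pair_eqE /=.
  by case: (i =P k) => ?; [|case: ifP => ?; [|case: ifP]]; lia.
- rewrite (local_count_DA Hadm Hx) // /adjacency /=.
  by case: (i =P k) => ?; [|case: ifP]; lia.
- rewrite (local_count_DD Hadm Hx) // /adjacency /=.
  by case: (i =P k) => ?; [|case: ifP]; lia.
- exact: local_count_exceptional.
- exact: local_count_exceptional.
Qed.

(** The property that separates the infinite families from the exceptional pairs; in E6 the label 2
    occurs at [(2, 3)] and at [(3, 6)], on different diagonals. *)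
Lemma label_diagonal H x y (k : nat) : admissible H -> ~~ exceptional H ->
  label H x == Some k -> label H y == Some k -> x.1 + y.2 = y.1 + x.2.
Proof.
case: x => a b; case: y => c d; case: H => [n p|n|n|n|n||] //= Hadm _.
- by rewrite !label_A; lia.
- by rewrite !label_C; lia.
- by rewrite !label_B; lia.
- by rewrite !label_DA; lia.
- rewrite !label_DD // => H1 H2.
  by case/or4P: H1 => H1; case/or4P: H2 => H2; lia.
Qed.

(** Lets one prove that boxes of a diagonal are not corners: [right x] prevents [x] from being
    removable, [up z] prevents [z] from being addable. *)
Lemma ambient_diagonal H x z l : admissible H -> ~~ exceptional H ->
  x \in ambient H -> z \in ambient H ->
  0 < l -> x.1 + l = z.1 -> x.2 + l = z.2 ->
  (right x \in ambient H) && (up z \in ambient H).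
Proof.
case: x => a b; case: z => c d; rewrite /right /up.
case: H => [n p|n|n|n|n||] //= Hadm _.
- by rewrite !ambient_A; lia.
- by rewrite !ambient_C; lia.
- by rewrite !ambient_B; lia.
- by rewrite !ambient_DA; lia.
- by rewrite !ambient_DD //; lia.
Qed.

Lemma ambient_right H x y : admissible H -> ~~ exceptional H ->
  x \in ambient H -> y \in ambient H -> x.1 <= y.1 -> x.2 < y.2 ->
  right x \in ambient H.
Proof.
case: x => a b; case: y => c d; rewrite /right.
case: H => [n p|n|n|n|n||] //= Hadm _.
- by rewrite !ambient_A; lia.
- by rewrite !ambient_C; lia.
- by rewrite !ambient_B; lia.
- by rewrite !ambient_DA; lia.
- by rewrite !ambient_DD //; lia.
Qed.

(** With [ambient_right] and [ambient_down2], this excludes the three configurations of [pattern] in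
    the infinite families. *)
Lemma ambient_down1 H x : admissible H -> ~~ exceptional H ->
  x \in ambient H -> (x.1.+2, x.2.+1) \in ambient H -> (x.1.+1, x.2.+2) \in ambient H ->
  down x \in ambient H.
Proof.
case: x => a b; rewrite /down.
case: H => [n p|n|n|n|n||] //= Hadm _.
- by rewrite !ambient_A; lia.
- by rewrite !ambient_C; lia.
- by rewrite !ambient_B; lia.
- by rewrite !ambient_DA; lia.
- by rewrite !ambient_DD //; lia.
Qed.

Lemma ambient_down2 H x : admissible H -> ~~ exceptional H ->
  x \in ambient H -> (x.1.+1, x.2.+1) \in ambient H ->
  left x \in ambient H -> up x \in ambient H -> down x \in ambient H.
Proof.
case: x => a b; rewrite /left /up /down.
case: H => [n p|n|n|n|n||] //= Hadm _.
- by rewrite !ambient_A; lia.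
- by rewrite !ambient_C; lia.
- by rewrite !ambient_B; lia.
- by rewrite !ambient_DA; lia.
- by rewrite !ambient_DD //; lia.
Qed.

(** * Subdiagrams and their statuses *)

Lemma reading_order_trans : transitive reading_order.
Proof. by move=> y x z; rewrite /reading_order; lia. Qed.

Lemma reading_order_anti : antisymmetric reading_order.
Proof. by case=> a b [c d]; rewrite /reading_order /= => Hx; congr pair; lia. Qed.

Lemma reading_order_total : total reading_order.
Proof. by move=> x y; rewrite /reading_order; lia. Qed.

Lemma reading_order_last (M : {fset box}) : M != fset0 ->
  exists2 x, x \in M &
    sort reading_order M = rcons (sort reading_order (M `\ x)%fset) x.
Proof.
move=> Mn0; have Hs : sorted reading_order (sort reading_order M).
  exact: sort_sorted reading_order_total _.
have Hm x : (x \in sort reading_order M) = (x \in M) by rewrite mem_sort.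
case/lastP Es: (sort reading_order M) Hs Hm => [|s x] Hs Hm.
  by case/fset0Pn: Mn0 => x; rewrite -Hm.
have xM : x \in M by rewrite -Hm mem_rcons mem_head.
have Us : uniq (rcons s x) by rewrite -Es sort_uniq fset_uniq.
exists x => //; congr rcons; apply: (sorted_eq reading_order_trans reading_order_anti).
- by move: Hs; rewrite -cats1; apply: subseq_sorted (prefix_subseq _ _); apply: reading_order_trans.
- exact: sort_sorted reading_order_total _.
apply: uniq_perm; first by move: Us; rewrite rcons_uniq => /andP[].
  by rewrite sort_uniq fset_uniq.
move=> y; rewrite mem_sort in_fsetD1 -Hm mem_rcons inE.
by move: Us; rewrite rcons_uniq => /andP[xs _]; case: eqP => //= ->; rewrite (negbTE xs).
Qed.

(** Corners are defined for boolean predicates, so that the same notion serves finite sets in proofs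
    and sequences in computations. *)
Definition removable (M : pred box) (b : box) : bool :=
  [&& M b, ~~ M (right b) & ~~ M (down b)].

Lemma eq_removable (M N : pred box) : M =1 N -> removable M =1 removable N.
Proof. by move=> E x; rewrite /removable !E. Qed.

Lemma last_removable (M : {fset box}) x : x \in M ->
  sort reading_order M = rcons (sort reading_order (M `\ x)%fset) x ->
  removable [in M] x.
Proof.
move=> xM Es; have Hs : sorted reading_order (sort reading_order M).
  exact: sort_sorted reading_order_total _.
have Hle y : y \in M -> reading_order y x.
  rewrite -(mem_sort reading_order) Es mem_rcons inE => /orP[/eqP->|ys].
    by rewrite /reading_order; lia.
  move: Hs; rewrite Es (sorted_pairwise reading_order_trans) pairwise_rcons.
  by case/andP=> /allP /(_ y ys).
rewrite /removable /= xM /=; apply/andP; split; apply/negP=> /Hle; rewrite /reading_order /=; lia.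
Qed.

Section Diagrams.

Variable H : hermitian_pair.
Hypothesis Hadm : admissible H.

Local Notation amb := (ambient H).
Local Notation lab x i := (label H x == Some i).
Local Notation sub := (subdiagram H).
Local Notation n := (rank (hdynkin H)).

Lemma right_left x : 0 < x.2 -> right (left x) = x.
Proof. by case: x => a b /= Hb; rewrite /right /= prednK. Qed.

Lemma down_up x : 0 < x.1 -> down (up x) = x.
Proof. by case: x => a b /= Hb; rewrite /down /= prednK. Qed.

Definition addable (M : pred box) (b : box) : bool :=
  [&& b \in amb, ~~ M b, (left b \in amb) ==> M (left b)
    & (up b \in amb) ==> M (up b)].

Implicit Types (M L : {fset box}) (b x y : box) (i j k : nat).

Local Open Scope fset_scope.

Lemma sub_ambient M x : sub M -> x \in M -> x \in amb.
Proof. by case=> HM _; apply: HM. Qed.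

Lemma sub_ideal M x y : sub M -> x \in M -> y \in amb ->
  y.1 <= x.1 -> y.2 <= x.2 -> y \in M.
Proof. by case=> _; apply. Qed.

Lemma sub0 : sub fset0.
Proof. by split=> [b|b b']; rewrite in_fset0. Qed.

Lemma addable_ambient (M : pred box) b : addable M b -> b \in amb.
Proof. by case/and4P. Qed.

Lemma box_pos x : x \in amb -> (0 < x.1) && (0 < x.2).
Proof. by move=> /(ambient_bound Hadm); lia. Qed.

Lemma eq_addable (M N : pred box) : M =1 N -> addable M =1 addable N.
Proof. by move=> E x; rewrite /addable !E. Qed.

Lemma addable_lower M x y : sub M -> addable [in M] x -> y \in amb ->
  y.1 <= x.1 -> y.2 <= x.2 -> y != x -> y \in M.
Proof.
move=> HM /and4P[xa _ /implyP Hl /implyP Hu] ya H1 H2 Hn.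
case/orP: (ambient_lower Hadm ya xa H1 H2 Hn) => /andP[Ha Hlt].
  by apply: (sub_ideal HM (Hl Ha)) => //=; lia.
by apply: (sub_ideal HM (Hu Ha)) => //=; lia.
Qed.

Lemma sub_add M b : sub M -> addable [in M] b -> sub (b |` M).
Proof.
move=> HM Hb; split=> [x|x y].
  by case/fset1UP=> [->|]; [apply: addable_ambient Hb|apply: sub_ambient].
case/fset1UP=> [->|xM] ya H1 H2; last by rewrite in_fsetU (sub_ideal HM xM) ?orbT.
by rewrite in_fset1U; case: eqP => //= /eqP Hn; apply: (addable_lower HM Hb).
Qed.

Lemma sub_rem M b : sub M -> removable [in M] b -> sub (M `\ b).
Proof.
move=> HM /and3P[/= bM rM dM]; split=> [x /fsetD1P[_]|x y /fsetD1P[xb xM] ya H1 H2].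
  exact: sub_ambient.
rewrite in_fsetD1 (sub_ideal HM xM) // andbT; apply: contraTneq xM => Ey; subst y.
apply/negP=> xM; rewrite eq_sym in xb.
case/orP: (ambient_upper Hadm ya (sub_ambient HM xM) H1 H2 xb) => /andP[Ha Hlt].
  by case/negP: rM; apply: (sub_ideal HM xM).
by case/negP: dM; apply: (sub_ideal HM xM).
Qed.

Lemma addable_rem M b : sub M -> removable [in M] b -> addable [in M `\ b] b.
Proof.
move=> HM /and3P[/= bM _ _]; have ba := sub_ambient HM bM.
have /andP[H1 H2] := box_pos ba; rewrite /addable ba /= !in_fsetD1 eqxx /=.
apply/andP; split; apply/implyP=> Ha; rewrite (sub_ideal HM bM) //= ?leq_pred // andbT.
  by rewrite -pair_eqE /=; lia.
by rewrite -pair_eqE /=; lia.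
Qed.

Lemma addable_notin M b : addable [in M] b -> b \notin M.
Proof. by case/and4P. Qed.

Lemma removable_in M b : removable [in M] b -> b \in M.
Proof. by case/and3P. Qed.

Lemma notin_above M x y : sub M -> x \in amb -> x \notin M ->
  x.1 <= y.1 -> x.2 <= y.2 -> y \notin M.
Proof. by move=> HM xa xM H1 H2; apply: contra xM => yM; apply: (sub_ideal HM yM). Qed.

Lemma removable_add M b : sub M -> addable [in M] b -> removable [in b |` M] b.
Proof.
move=> HM Hb; have ba := addable_ambient Hb; have bM := addable_notin Hb.
rewrite /removable /= fset1U1 !in_fset1U.
rewrite !(negbTE (notin_above HM ba bM _ _)) //= ?orbF -?pair_eqE /=; lia.
Qed.

(** The last box in reading order is removable, so every diagram is built by adding boxes one at a
    time. *)
Lemma sub_ind (P : {fset box} -> Prop) : P fset0 ->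
  (forall M b, sub M -> addable [in M] b -> P M -> P (b |` M)) ->
  forall M, sub M -> P M.
Proof.
move=> P0 Padd M; move: {2}#|`M| (leqnn #|`M|) => m.
elim: m M => [|m IH] M; first by rewrite leqn0 cardfs_eq0 => /eqP->.
have [->//|Mn0] := eqVneq M fset0; move=> HMm HM.
have [x xM Es] := reading_order_last Mn0; have Hx := last_removable xM Es.
rewrite -(fsetD1K xM); apply: Padd; [exact: sub_rem|exact: addable_rem|].
apply: IH; last exact: sub_rem.
by rewrite (cardfsD1 x) xM in HMm.
Qed.

(** A signed count, so that the effect of adding a box can be computed by summation. That its values
    are only 1, 0 and -1 is established afterwards, in [statusP]. *)
Definition st M i : int :=
  (\sum_(b <- boxes H | lab b i)
     ((addable [in M] b)%:Z - (removable [in M] b)%:Z))%R.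

(** Adding [x] uses up the addable box [x] and can create new ones only below and to the right of
    it. All terms stand on the side where they are added, which avoids subtraction of natural
    numbers. *)
Lemma addable_step M x b : sub M -> addable [in M] x -> b \in amb ->
  (addable [in x |` M] b + (b == x) = addable [in M] b +
    ((b == down x) && ((southwest x \in M) || (southwest x \notin amb))) +
    ((b == right x) && ((northeast x \in M) || (northeast x \notin amb))))%N.
Proof.
move=> HM Hx ba; have xa := addable_ambient Hx; have xM := addable_notin Hx.
have Hpb := box_pos ba; have Hpx := box_pos xa.
have [->|Nb] := eqVneq b x.
  rewrite Hx {1}/addable /= fset1U1 andbF /= -!pair_eqE /=; lia.
have [Eb|Nr] := eqVneq b (right x).
  have -> : addable [in M] b = false.
    apply/negP=> /and4P[_ _ /implyP /=]; rewrite Eb /left /= -surjective_pairing.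
    by rewrite xa => /(_ isT); rewrite (negbTE xM).
  have -> : (b == down x) = false by rewrite Eb -pair_eqE /=; lia.
  rewrite /= ?addn0 ?add0n; congr (nat_of_bool _).
  have El : left b = x by apply/eqP; rewrite Eb -pair_eqE /=; lia.
  rewrite /addable ba /= !in_fset1U (negbTE Nb) /= El eqxx implybT /=.
  rewrite (notin_above HM xa xM) ?Eb //= /up /= -/(northeast x).
  have -> : (northeast x == x) = false by rewrite -pair_eqE /=; lia.
  by rewrite /= implybE orbC.
have [Eb|Nd] := eqVneq b (down x).
  have -> : addable [in M] b = false.
    apply/negP=> /and4P[_ _ _ /implyP /=]; rewrite Eb /up /= -surjective_pairing.
    by rewrite xa => /(_ isT); rewrite (negbTE xM).
  rewrite /= ?addn0 ?add0n; congr (nat_of_bool _).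
  have Eu : up b = x by apply/eqP; rewrite Eb -pair_eqE /=; lia.
  rewrite /addable ba /= !in_fset1U (negbTE Nb) /= Eu eqxx implybT /= andbT.
  rewrite (notin_above HM xa xM) ?Eb //= /left /= -/(southwest x).
  have -> : (southwest x == x) = false by rewrite -pair_eqE /=; lia.
  by rewrite /= implybE orbC.
rewrite /= ?addn0; congr (nat_of_bool _).
rewrite /addable /= !in_fset1U (negbTE Nb) /=.
have -> : (left b == x) = false.
  by apply: contraNF Nr => /eqP <-; rewrite -pair_eqE /=; lia.
have -> // : (up b == x) = false.
by apply: contraNF Nd => /eqP <-; rewrite -pair_eqE /=; lia.
Qed.

Lemma removable_step M x b : sub M -> addable [in M] x -> b \in amb ->
  (removable [in x |` M] b + ((b == left x) && (southwest x \notin M)) +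
    ((b == up x) && (northeast x \notin M)) = removable [in M] b + (b == x))%N.
Proof.
move=> HM Hx ba; have xa := addable_ambient Hx; have xM := addable_notin Hx.
have Hpb := box_pos ba; have Hpx := box_pos xa.
have [->|Nb] := eqVneq b x.
  rewrite removable_add // {1}/removable /= (negbTE xM) /= -!pair_eqE /=; lia.
have [Eb|Nl] := eqVneq b (left x).
  have Er : right b = x by apply/eqP; rewrite Eb -pair_eqE /=; lia.
  have -> : removable [in x |` M] b = false.
    by rewrite /removable /= Er fset1U1 /= andbF.
  have -> : (b == up x) = false by rewrite Eb -pair_eqE /=; lia.
  rewrite /= ?addn0 ?add0n; congr (nat_of_bool _).
  rewrite /removable /= Er xM /= {2}Eb /down /= -/(southwest x).
  by case/and4P: Hx => _ _ /implyP; rewrite -Eb => /(_ ba) /= ->.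
have [Eb|Nu] := eqVneq b (up x).
  have Ed : down b = x by apply/eqP; rewrite Eb -pair_eqE /=; lia.
  have -> : removable [in x |` M] b = false.
    by rewrite /removable /= Ed fset1U1 /= !andbF.
  rewrite /= ?addn0 ?add0n; congr (nat_of_bool _).
  rewrite /removable /= Ed xM /= {2}Eb /right /= -/(northeast x).
  by case/and4P: Hx => _ _ _ /implyP; rewrite -Eb => /(_ ba) /= ->; rewrite andbT.
rewrite /= ?addn0; congr (nat_of_bool _).
rewrite /removable /= !in_fset1U (negbTE Nb) /=.
have -> : (right b == x) = false.
  by apply: contraNF Nl => /eqP <-; rewrite -pair_eqE /=; lia.
have -> // : (down b == x) = false.
by apply: contraNF Nu => /eqP <-; rewrite -pair_eqE /=; lia.
Qed.

Lemma sum_delta y i (c : bool) :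
  (\sum_(b <- boxes H | lab b i) ((b == y) && c)%:Z = (lab y i && c)%:Z)%R.
Proof.
case: (boolP (lab y i)) => Hy.
  rewrite big_mkcond (bigD1_seq y) ?boxes_uniq //=; last first.
    by rewrite mem_boxes ?(label_ambient Hy).
  rewrite Hy eqxx /= big1 ?GRing.addr0 // => b /negbTE ->; by rewrite if_same.
by rewrite big1 // => b Hb; case: (b =P y) Hb => // ->; rewrite (negbTE Hy).
Qed.

Lemma step_arith (a' a r' r l d u g e : nat) :
  (r' + l + u = r + e)%N -> (a' + e = a + d + g)%N ->
  (a'%:Z - r'%:Z = (a%:Z - r%:Z) + ((l%:Z + d%:Z + u%:Z + g%:Z) - (e%:Z + e%:Z)))%R.
Proof. lia. Qed.

(** Summed over the boxes of label [i], the two local balances give [local_count]. From it 2 is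
    subtracted when [i = k], because [x] stops being addable and becomes removable. *)
Lemma st_add M x i k : sub M -> addable [in M] x -> lab x k -> 1 <= i <= n ->
  (st (x |` M) i = st M i - cartan (hdynkin H) i k)%R.
Proof.
move=> HM Hx Hk Hi.
pose s := southwest x \in M; pose t := northeast x \in M.
have Hs : s -> southwest x \in amb by apply: sub_ambient.
have Ht : t -> northeast x \in amb by apply: sub_ambient.
have := local_countE Hadm Hk Hi Hs Ht; rewrite /local_count cartan_adjacency => <-.
have -> : st (x |` M) i = (\sum_(b <- boxes H | lab b i)
   (((addable [in M] b)%:Z - (removable [in M] b)%:Z) +
   ((((b == left x) && ~~ s)%:Z +
     ((b == down x) && (s || (southwest x \notin amb)))%:Z +
     ((b == up x) && ~~ t)%:Z +
     ((b == right x) && (t || (northeast x \notin amb)))%:Z) -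
    (((b == x) && true)%:Z + ((b == x) && true)%:Z))))%R.
  rewrite /st big_seq_cond [RHS]big_seq_cond; apply: eq_bigr => b /andP[].
  rewrite mem_boxes // => ba _.
  have := addable_step HM Hx ba; have := removable_step HM Hx ba.
  rewrite -/s -/t andbT; exact: step_arith.
rewrite !big_split /= !GRing.sumrN ?big_split /= !sum_delta andbT.
have -> : lab x i = (i == k) by rewrite (eqP Hk) some_eq eq_sym.
by rewrite /st big_split /= GRing.sumrN mul2n -addnn !PoszD; ring.
Qed.

Lemma label_inj x i j : lab x i -> lab x j -> i = j.
Proof. by move=> /eqP -> /eqP[]. Qed.

Lemma label_right x i : lab x i -> ~~ lab (right x) i.
Proof.
move=> Hx; apply/negP=> Hr.
(* With [t] taken to be the membership of the northeast box in the ambient diagram, the right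
   neighbour is counted in every case, whereas the total for the label [i] itself is 0. *)
have := local_countE (s := false) Hadm Hx (label_range Hadm Hx) (fun h => match notF h with end)
  (fun h : northeast x \in amb => h).
by rewrite /local_count /adjacency eqxx Hr; case: (_ \in _) => /=; lia.
Qed.

Lemma label_down x i : lab x i -> ~~ lab (down x) i.
Proof.
move=> Hx; apply/negP=> Hr.
have := local_countE (t := false) Hadm Hx (label_range Hadm Hx)
  (fun h : southwest x \in amb => h) (fun h => match notF h with end).
by rewrite /local_count /adjacency eqxx Hr; case: (southwest x \in _) => /=; lia.
Qed.

Lemma addable_addable M x y i : sub M -> addable [in M] x -> addable [in M] y ->
  lab x i -> lab y i -> x = y.
Proof.
move=> HM Hx Hy Hxi Hyi.
wlog /andP[H1 H2] : x y Hx Hy Hxi Hyi / (x.1 <= y.1) && (x.2 <= y.2).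
  by case/orP: (label_chain Hadm Hxi Hyi) => Hle W; [|symmetry]; apply: W.
apply/eqP; apply: contraT => Hn.
by have := addable_lower HM Hy (addable_ambient Hx) H1 H2 Hn; rewrite (negbTE (addable_notin Hx)).
Qed.

Lemma removable_removable M x y i : sub M -> removable [in M] x -> removable [in M] y ->
  lab x i -> lab y i -> x = y.
Proof.
move=> HM Hx Hy Hxi Hyi.
wlog /andP[H1 H2] : x y Hx Hy Hxi Hyi / (x.1 <= y.1) && (x.2 <= y.2).
  by case/orP: (label_chain Hadm Hxi Hyi) => Hle W; [|symmetry]; apply: W.
apply/eqP; apply: contraT => Hn; have yM := removable_in Hy.
case/and3P: Hx => xM /= rM dM.
case/orP: (ambient_upper Hadm (sub_ambient HM xM) (sub_ambient HM yM) H1 H2 Hn) => /andP[Ha Hlt].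
  by case/negP: rM; apply: (sub_ideal HM yM).
by case/negP: dM; apply: (sub_ideal HM yM).
Qed.

(** Comparability leaves [y] below [x]. One step from [y] towards [x] lands in [M], contradicting
    removability, unless it lands on [x]; but adjacent boxes have different labels. *)
Lemma addable_removable M x y i : sub M -> addable [in M] x -> removable [in M] y ->
  lab x i -> ~~ lab y i.
Proof.
move=> HM Hx Hy Hxi; apply/negP=> Hyi; have yM := removable_in Hy.
have xM := addable_notin Hx; have xa := label_ambient Hxi.
case/orP: (label_chain Hadm Hxi Hyi) => /andP[H1 H2].
  by case/negP: xM; apply: (sub_ideal HM yM).
have Hn : y != x by apply: contraNneq xM => <-.
case/and3P: Hy => _ /= rM dM.
case/orP: (ambient_upper Hadm (sub_ambient HM yM) xa H1 H2 Hn) => /andP[Ha Hlt].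
  case/negP: rM; apply: (addable_lower HM Hx Ha) => //.
  by apply: contraTneq Hxi => <-; apply: label_right.
case/negP: dM; apply: (addable_lower HM Hx Ha) => //.
by apply: contraTneq Hxi => <-; apply: label_down.
Qed.

Lemma st_addable M x i : sub M -> addable [in M] x -> lab x i -> st M i = 1%R.
Proof.
move=> HM Hx Hxi; rewrite /st big_mkcond.
rewrite (bigD1_seq x) ?boxes_uniq ?mem_boxes ?(label_ambient Hxi) //=.
rewrite Hxi Hx big1 ?GRing.addr0 => [|y Hn]; last case: ifP => // Hyi.
  case: (boolP (removable [in M] x)) => // Hr.
  by have := addable_removable HM Hx Hr Hxi; rewrite Hxi.
case: (boolP (removable [in M] y)) => [Hr|_].
  by have := addable_removable HM Hx Hr Hxi; rewrite Hyi.
case: (boolP (addable [in M] y)) => // Ha.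
by rewrite (addable_addable HM Hx Ha Hxi Hyi) eqxx in Hn.
Qed.

Lemma st_removable M x i : sub M -> removable [in M] x -> lab x i -> st M i = (-1)%R.
Proof.
move=> HM Hx Hxi; rewrite /st big_mkcond.
rewrite (bigD1_seq x) ?boxes_uniq ?mem_boxes ?(label_ambient Hxi) //=.
rewrite Hxi Hx big1 ?GRing.addr0 => [|y Hn]; last case: ifP => // Hyi.
  case: (boolP (addable [in M] x)) => // Ha.
  by have := addable_removable HM Ha Hx Hxi; rewrite Hxi.
case: (boolP (addable [in M] y)) => [Ha|_].
  by have := addable_removable HM Ha Hx Hyi; rewrite Hxi.
case: (boolP (removable [in M] y)) => // Hr.
by rewrite (removable_removable HM Hx Hr Hxi Hyi) eqxx in Hn.
Qed.

Definition neutral (M : pred box) i : bool :=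
  all (fun x => lab x i ==> ~~ addable M x && ~~ removable M x) (boxes H).

Lemma eq_neutral (M N : pred box) : M =1 N -> neutral M =1 neutral N.
Proof.
by move=> E i; apply: eq_all => x; rewrite (eq_addable E) (eq_removable E).
Qed.

Lemma neutralP (M : pred box) i : reflect
  (forall x, lab x i -> ~~ addable M x && ~~ removable M x) (neutral M i).
Proof.
apply: (iffP allP) => HM x; last by move=> _; apply/implyP/HM.
by move=> Hx; apply: (implyP (HM x _)); rewrite // mem_boxes ?(label_ambient Hx).
Qed.

Lemma st_neutral M i : neutral [in M] i -> st M i = 0%R.
Proof.
by move=> /neutralP HM; rewrite /st big1 // => x /HM /andP[/negbTE-> /negbTE->].
Qed.

Variant status_spec M i : int -> bool -> Prop :=
| StAdd x of addable [in M] x & lab x i : status_spec M i 1%R false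
| StRem x of removable [in M] x & lab x i : status_spec M i (-1)%R false
| StNeutral of neutral [in M] i : status_spec M i 0%R true.

Lemma statusP M i : sub M -> status_spec M i (st M i) (neutral [in M] i).
Proof.
move=> HM; case: (boolP (neutral [in M] i)) => [Hn|].
  by rewrite st_neutral //; constructor.
case/allPn=> x _; rewrite negb_imply negb_and !negbK => /andP[Hx /orP[Ha|Hr]].
  by rewrite (st_addable HM Ha Hx); apply: (StAdd Ha).
by rewrite (st_removable HM Hr Hx); apply: (StRem Hr).
Qed.

Lemma neutral_st M i : sub M -> neutral [in M] i = (st M i == 0%R).
Proof. by move=> HM; case: (statusP i HM). Qed.

Lemma st0 i : 1 <= i <= n -> st fset0 i = (i == omitted H)%:Z%R.
Proof.
move=> Hi; have Ho := label_origin Hadm.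
have Ha : addable [in fset0] (1, 1).
  rewrite /addable (label_ambient Ho) in_fset0 /=.
  by apply/andP; split; apply/implyP=> /box_pos; rewrite /= ?andbF.
case: eqP => [->|Hn]; first exact: st_addable sub0 Ha Ho.
case: (statusP i sub0) => [x Hx Hxi|x /removable_in //|//].
have xa := addable_ambient Hx; have Hp := box_pos xa.
have [Ex|Ex] := eqVneq (1, 1) x.
  by case: Hn; apply: label_inj Hxi _; rewrite -Ex.
have := addable_lower sub0 Hx (label_ambient Ho); rewrite in_fset0 /=.
by case/andP: Hp => -> -> /(_ isT isT Ex).
Qed.

(* The diagram of [s_i w] when [M] is the diagram of [w], provided [s_i w] is
   again a minimal coset representative; and [M] otherwise. *)
Definition toggle i M : {fset box} :=
  if [seq x <- boxes H | lab x i && addable [in M] x] is x :: _ then x |` M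
  else if [seq x <- boxes H | lab x i && removable [in M] x] is x :: _ then M `\ x
  else M.

Lemma toggle_addable M x i : sub M -> addable [in M] x -> lab x i ->
  toggle i M = x |` M.
Proof.
move=> HM Hx Hxi; rewrite /toggle.
case E: [seq _ <- _ | _] => [|y s].
  have : x \in [seq x <- boxes H | lab x i && addable [in M] x].
    by rewrite mem_filter Hxi Hx mem_boxes ?(label_ambient Hxi).
  by rewrite E.
have : y \in [seq x <- boxes H | lab x i && addable [in M] x] by rewrite E mem_head.
rewrite mem_filter => /andP[/andP[Hyi Hy] _].
by rewrite (addable_addable HM Hx Hy Hxi Hyi).
Qed.

Lemma toggle_removable M x i : sub M -> removable [in M] x -> lab x i ->
  toggle i M = M `\ x.
Proof.
move=> HM Hx Hxi; rewrite /toggle.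
have -> : [seq x <- boxes H | lab x i && addable [in M] x] = [::].
  apply/eqP; rewrite -(negbK (_ == _)) -has_filter; apply/hasPn=> y _.
  by apply/negP=> /andP[Hyi Hy]; have := addable_removable HM Hy Hx Hyi; rewrite Hxi.
case E: [seq _ <- _ | _] => [|y s].
  have : x \in [seq x <- boxes H | lab x i && removable [in M] x].
    by rewrite mem_filter Hxi Hx mem_boxes ?(label_ambient Hxi).
  by rewrite E.
have : y \in [seq x <- boxes H | lab x i && removable [in M] x] by rewrite E mem_head.
rewrite mem_filter => /andP[/andP[Hyi Hy] _].
by rewrite (removable_removable HM Hx Hy Hxi Hyi).
Qed.

Lemma toggle_neutral M i : neutral [in M] i -> toggle i M = M.
Proof.
move=> /neutralP HM; rewrite /toggle.
have Hf (P : pred box) : (forall x, lab x i -> ~~ P x) ->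
    [seq x <- boxes H | lab x i && P x] = [::].
  move=> HP; apply/eqP; rewrite -(negbK (_ == _)) -has_filter; apply/hasPn=> y _.
  by apply/negP=> /andP[Hyi Hy]; have := HP y Hyi; rewrite Hy.
by rewrite !Hf // => x /HM /andP[].
Qed.

Lemma sub_toggle M i : sub M -> sub (toggle i M).
Proof.
move=> HM; case: (statusP i HM) => [x Hx Hi|x Hx Hi|Hn].
- by rewrite (toggle_addable HM Hx Hi); apply: sub_add.
- by rewrite (toggle_removable HM Hx Hi); apply: sub_rem.
- by rewrite toggle_neutral.
Qed.

(** On status vectors, [toggle i] is the simple reflection acting on coweights. *)
Lemma st_toggle M i j : sub M -> 1 <= j <= n ->
  (st (toggle i M) j = st M j - st M i * cartan (hdynkin H) j i)%R.
Proof.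
move=> HM Hj; case: (statusP i HM) => [x Hx Hi|x Hx Hi|Hn].
- by rewrite (toggle_addable HM Hx Hi) (st_add HM Hx Hi) // GRing.mul1r.
- rewrite (toggle_removable HM Hx Hi) GRing.mulN1r GRing.opprK.
  rewrite -[in RHS](fsetD1K (removable_in Hx)).
  rewrite (st_add (sub_rem HM Hx) (addable_rem HM Hx) Hi) //.
  by rewrite GRing.subrK.
- by rewrite toggle_neutral // GRing.mul0r GRing.subr0.
Qed.

Lemma toggleK M i : sub M -> toggle i (toggle i M) = M.
Proof.
move=> HM; case: (statusP i HM) => [x Hx Hi|x Hx Hi|Hn].
- rewrite (toggle_addable HM Hx Hi).
  by rewrite (toggle_removable (sub_add HM Hx) (removable_add HM Hx) Hi) fsetU1K ?addable_notin.
- rewrite (toggle_removable HM Hx Hi).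
  rewrite (toggle_addable (sub_rem HM Hx) (addable_rem HM Hx) Hi).
  by rewrite fsetD1K ?removable_in.
- by rewrite !toggle_neutral.
Qed.

End Diagrams.

(** * Weyl groups *)

Import GRing.Theory.

Lemma cartan_cases X i j : 1 <= i <= rank X -> 1 <= j <= rank X -> i != j ->
  [\/ cartan X i j = 0%R /\ cartan X j i = 0%R,
      cartan X i j = (-1)%R /\ cartan X j i = (-1)%R,
      cartan X i j = (-1)%R /\ cartan X j i = (-2)%R
    | cartan X i j = (-2)%R /\ cartan X j i = (-1)%R].
Proof.
move=> Hi Hj Hij; rewrite /cartan (negbTE Hij) eq_sym (negbTE Hij) orbC.
case: ifP => Hb; first by constructor 1.
case: X Hi Hj Hb => [n|n|n|n||] /= Hi Hj Hb; try by constructor 2.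
  rewrite -!pair_eqE /=.
  case: ifP => H1; case: ifP => H2; [exfalso|constructor 4|constructor 3|constructor 2] => //.
  by move: H1 H2 Hi Hj; clear; lia.
rewrite -!pair_eqE /=.
case: ifP => H1; case: ifP => H2; [exfalso|constructor 4|constructor 3|constructor 2] => //.
by move: H1 H2 Hi Hj; clear; lia.
Qed.

Lemma cartan_diag X i : cartan X i i = 2%R.
Proof. by rewrite /cartan eqxx. Qed.

Section Reflections.

Variables (X : dynkin) (W : weyl_group X).
Local Notation n := (rank X).
Local Notation s := (refl W).
Local Notation rho := (root_action W).

Local Open Scope ring_scope.

(** Multiplying by a simple reflection on the right is a column operation. In the relations below,
    an identity matrix is put in front of each word so that its letters are absorbed one after the
    other and only identities between entries remain. *)
Lemma mulmx_reflection m (A : 'M[int]_(m, n)) k l (i : 'I_n) :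
  (A *m simple_reflection_mx X i.+1) k l = A k l - A k i * cartan X l.+1 i.+1.
Proof.
rewrite mxE (eq_bigr (fun j => A k j * (j == l)%:R -
    A k j * ((j == i)%:R * cartan X l.+1 i.+1))); last first.
  by move=> j _; rewrite mxE mulrBr eqSS.
rewrite sumrB; congr (_ - _).
  by rewrite (bigD1 l) //= eqxx mulr1 big1 ?addr0 // => j /negbTE->; rewrite mulr0.
by rewrite (bigD1 i) //= eqxx mul1r big1 ?addr0 // => j /negbTE->; rewrite mul0r mulr0.
Qed.

Lemma rho_inj : injective rho.
Proof.
by move=> x y; apply: (mx_faithful_inj (root_action_faithful W)); rewrite in_setT.
Qed.

Lemma rhoM x y : rho (x * y)%g = rho x *m rho y.
Proof. by rewrite repr_mxM ?in_setT. Qed.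

Lemma rho_refl (i : 'I_n) : rho (s i.+1) = simple_reflection_mx X i.+1.
Proof. by apply: root_action_refl; apply: ltn_ord. Qed.

Lemma ordS_ex i : (1 <= i <= n)%N -> exists o : 'I_n, i = o.+1.
Proof. by case: i => // i Hi; exists (Ordinal (Hi : (i < n)%N)). Qed.

Lemma refl_square i : (1 <= i <= n)%N -> (s i * s i = 1)%g.
Proof.
case/ordS_ex=> o ->; apply: rho_inj; rewrite rhoM repr_mx1 -[rho _ *m _]mul1mx mulmxA.
rewrite rho_refl; apply/matrixP=> k l; rewrite !mulmx_reflection cartan_diag; ring.
Qed.

Lemma refl_neq1 i : (1 <= i <= n)%N -> s i != 1%g.
Proof.
case/ordS_ex=> o ->; apply/eqP=> /(congr1 rho); rewrite repr_mx1 rho_refl.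
by move/matrixP=> /(_ o o); rewrite !mxE !eqxx cartan_diag.
Qed.

Lemma refl_commute i j : (1 <= i <= n)%N -> (1 <= j <= n)%N ->
  cartan X i j = 0 -> cartan X j i = 0 -> (s i * s j = s j * s i)%g.
Proof.
case/ordS_ex=> o ->; case/ordS_ex=> o' -> H1 H2; apply: rho_inj.
rewrite !rhoM -[rho _ *m _]mul1mx -[RHS]mul1mx !mulmxA !rho_refl.
apply/matrixP=> k l; rewrite !mulmx_reflection H1 H2; ring.
Qed.

Lemma refl_braid3 i j : (1 <= i <= n)%N -> (1 <= j <= n)%N ->
  cartan X i j = -1 -> cartan X j i = -1 -> (s i * s j * s i = s j * s i * s j)%g.
Proof.
case/ordS_ex=> o ->; case/ordS_ex=> o' -> H1 H2; apply: rho_inj.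
rewrite !rhoM -[rho _ *m _ *m _]mul1mx -[RHS]mul1mx !mulmxA !rho_refl.
apply/matrixP=> k l; rewrite !mulmx_reflection H1 H2 !cartan_diag; ring.
Qed.

Lemma refl_braid4 i j : (1 <= i <= n)%N -> (1 <= j <= n)%N ->
  cartan X i j = -1 -> cartan X j i = -2 ->
  (s i * s j * s i * s j = s j * s i * s j * s i)%g.
Proof.
case/ordS_ex=> o ->; case/ordS_ex=> o' -> H1 H2; apply: rho_inj.
rewrite !rhoM -[rho _ *m _ *m _ *m _]mul1mx -[RHS]mul1mx !mulmxA !rho_refl.
apply/matrixP=> k l; rewrite !mulmx_reflection H1 H2 !cartan_diag; ring.
Qed.

(** * Words, length and Bruhat order *)

Lemma has_word1 : has_word (1%g : W) 0.
Proof. by apply/existsP; exists [tuple]; rewrite big_nil. Qed.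

Lemma has_word_mul (w : W) i k : (1 <= i <= n)%N -> has_word w k ->
  has_word (s i * w)%g k.+1.
Proof.
case/ordS_ex=> o -> /existsP[t /eqP->]; apply/existsP; exists [tuple of o :: t].
by rewrite big_cons.
Qed.

Lemma has_word_ind (P : W -> nat -> Prop) : P 1%g 0%N ->
  (forall w i k, (1 <= i <= n)%N -> has_word w k -> P w k -> P (s i * w)%g k.+1) ->
  forall w k, has_word w k -> P w k.
Proof.
move=> P1 PS w k; elim: k w => [|k IH] w /existsP[t /eqP->].
  by rewrite tuple0 big_nil.
case/tupleP: t => o t; rewrite big_cons; have Ht : has_word (\prod_(i <- t) s i.+1)%g k.
  by apply/existsP; exists t.
by apply: PS => //; [rewrite ltn_ord|apply: IH].
Qed.

Lemma has_word_ex (w : W) : exists k, has_word w k.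
Proof.
have: w \in <<[set s i.+1 | i : 'I_n]>>%g by rewrite refl_generate in_setT.
case/gen_prodgP=> m [c Hc ->].
have /fin_all_exists[f Hf] : forall i, exists o : 'I_n, c i = s o.+1.
  by move=> i; case/imsetP: (Hc i) => o _ ->; exists o.
exists m; apply/existsP; exists [tuple f i | i < m].
by rewrite big_tuple; apply/eqP/eq_bigr => i _; rewrite tnth_mktuple Hf.
Qed.

Definition cayley : rel W := fun x y => [exists i : 'I_n, y == s i.+1 * x]%g.

Lemma cayley_path (w : W) k : has_word w k ->
  exists2 p, path cayley 1%g p & last 1%g p = w /\ size p = k.
Proof.
move: w k; apply: has_word_ind => [|w i k Hi _ [p Hp [Hl Hs]]]; first by exists [::].
exists (rcons p (s i * w)%g); last by rewrite last_rcons size_rcons Hs.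
rewrite rcons_path Hp Hl; case: (ordS_ex Hi) => o ->.
by apply/existsP; exists o.
Qed.

Lemma path_has_word p : path cayley 1%g p -> has_word (last 1%g p) (size p).
Proof.
elim/last_ind: p => [|p y IH]; first by rewrite has_word1.
rewrite rcons_path last_rcons size_rcons => /andP[/IH Hw /existsP[o /eqP->]].
by apply: has_word_mul Hw; apply: ltn_ord.
Qed.

(** [length] searches only below [#|W|]. A word is a path from 1 in the Cayley graph, and shortening
    it to a path through distinct elements leaves fewer than [#|W|] letters, so the search
    succeeds. *)
Lemma length_has_word (w : W) : has_word w (length w).
Proof.
have [k /cayley_path[p Hp [Hl _]]] := has_word_ex w.
case/shortenP: Hp Hl => p' Hp' Up' _ Hl.
have Hw := path_has_word Hp'; rewrite Hl in Hw.
have Hs : (size p' < #|W|)%N.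
  by rewrite -[(size p').+1]/(size (1%g :: p')) -(card_uniqP Up') max_card.
have Hh : has (has_word w) (iota 0 #|W|).
  by apply/hasP; exists (size p'); rewrite // mem_iota.
have := nth_find 0%N Hh; rewrite nth_iota //.
by move: Hh; rewrite has_find size_iota.
Qed.

Lemma length_leq (w : W) k : has_word w k -> (length w <= k)%N.
Proof.
move=> Hw; have [Hk|Hk] := ltnP k #|W|; last first.
  by apply: leq_trans Hk; rewrite -[X in (_ <= X)%N](size_iota 0) find_size.
rewrite leqNgt; apply/negP=> Hlt.
by have := before_find 0%N Hlt; rewrite nth_iota // add0n Hw.
Qed.

(** Left multiplication of [u] by [s i] is right multiplication by the conjugate reflection
    [s i ^ u]. *)
Lemma bruhat_lt_refl (u : W) i : (1 <= i <= n)%N -> (length u < length (s i * u)%g)%N ->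
  bruhat_lt u (s i * u)%g.
Proof.
move=> Hi Hlt; rewrite /bruhat_lt; apply/andP; split.
  by apply: contraTneq Hlt => <-; rewrite ltnn.
apply: connect1; apply/existsP; exists (s i ^ u)%g; rewrite Hlt andbT.
apply/andP; split; last by rewrite -conjgC.
case: (ordS_ex Hi) => o ->; apply/existsP; exists o; apply/existsP; exists u.
exact: eqxx.
Qed.

Lemma bruhat_1 (u : W) : bruhat u 1%g -> u = 1%g.
Proof.
case/connectP=> p; case/lastP: p => [|p y]; first by [].
rewrite rcons_path last_rcons => /andP[_ /existsP[t /and3P[_ _ Hlt]]] Ey.
have := length_leq has_word1; rewrite Ey; lia.
Qed.

End Reflections.

(** * Elements attached to diagrams *)

Section Elements.

Variables (H : hermitian_pair) (W : weyl_group (hdynkin H)).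
Hypothesis Hadm : admissible H.

Local Notation amb := (ambient H).
Local Notation lab x i := (label H x == Some i).
Local Notation sub := (subdiagram H).
Local Notation n := (rank (hdynkin H)).
Local Notation s := (refl W).
Local Notation rho := (root_action W).
Local Notation elt := (diagram_element W).
Local Notation st := (st H).
Local Notation toggle := (toggle H).
Local Notation addable := (addable H).
Local Notation neutral := (neutral H).
Local Notation cartan := (cartan (hdynkin H)).

Implicit Types (M L N : {fset box}) (b x y : box) (i j k : nat) (w : W).

Local Open Scope fset_scope.

Lemma omitted_range : 1 <= omitted H <= n.
Proof. exact: label_range (label_origin Hadm). Qed.

Lemma omitted_pred : (omitted H).-1 < n.
Proof. by have := omitted_range; lia. Qed.

Let p0 : 'I_n := Ordinal omitted_pred.

Lemma p0S : p0.+1 = omitted H.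
Proof. by have := omitted_range; rewrite /=; lia. Qed.

(* Row [p0] of the matrix of [w^-1] holds the pairings of the simple roots with
   the image under [w] of the fundamental coweight stabilized by W_J. *)
Definition has_weight w M : Prop := forall l : 'I_n, rho w^-1%g p0 l = st M l.+1.

Lemma has_weight1 : has_weight 1%g fset0.
Proof.
move=> l; rewrite invg1 repr_mx1 mxE st0 ?ltn_ord // -p0S eqSS.
by rewrite [RHS]/= -[(l : nat) == p0]/(l == p0) eq_sym; case: (l == p0).
Qed.

Lemma reflV i : 1 <= i <= n -> ((s i)^-1 = s i)%g.
Proof. by move=> Hi; apply/eqP; rewrite eq_invg_mul refl_square. Qed.

Lemma has_weight_mul w M i : sub M -> 1 <= i <= n -> has_weight w M ->
  has_weight (s i * w)%g (toggle i M).
Proof.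
move=> HM Hi Hw l; rewrite invMg reflV // rhoM st_toggle ?ltn_ord //.
case: (ordS_ex Hi) => o ->; rewrite rho_refl mulmx_reflection !Hw; ring.
Qed.

(** Row [p0] of the matrix of [s i] is a row of the identity matrix unless [i] is the omitted node:
    W_J fixes the fundamental coweight. *)
Lemma has_weight_mulr w M i : 1 <= i <= n -> i != omitted H -> has_weight w M ->
  has_weight (w * s i)%g M.
Proof.
move=> Hi Hio Hw l; rewrite invMg reflV // rhoM -Hw.
case: (ordS_ex Hi) => o Eo; rewrite Eo rho_refl mxE (bigD1 p0) //= big1 ?addr0.
  by rewrite mxE eqxx -[p0 : nat]/(_.-1) prednK ?(andP omitted_range).1 // -Eo
     eq_sym (negbTE Hio) mul0r subr0 mul1r.
move=> j Hj; rewrite mxE -[p0 : nat]/(_.-1) prednK ?(andP omitted_range).1 //.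
by rewrite -Eo [omitted H == i]eq_sym (negbTE Hio) mul0r subr0 eq_sym (negbTE Hj) mul0r.
Qed.

Lemma elt0 : elt fset0 = 1%g.
Proof.
rewrite /diagram_element /reading_word.
have -> : sort reading_order (fset0 : {fset box}) = [::].
  by apply: size0nil; rewrite size_sort cardfs0.
by rewrite big_nil.
Qed.

Lemma elt_last M x k : sort reading_order M = rcons (sort reading_order (M `\ x)) x ->
  lab x k -> elt M = (s k * elt (M `\ x))%g.
Proof.
move=> Es /eqP Hk; rewrite /diagram_element /reading_word Es -cats1 pmap_cat /= Hk.
by rewrite rev_cat big_cons.
Qed.

Lemma st_sym_zero i k : 1 <= i <= n -> 1 <= k <= n -> cartan i k = 0%R -> cartan k i = 0%R.
Proof.
move=> Hi Hk; have [->//|Hik] := eqVneq i k.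
by case: (cartan_cases Hi Hk Hik) => -[-> ->].
Qed.

(** If [b] is not the last box of the new diagram, its letter has to move past that of the last box
    [x]. Since [b] is addable both with and without [x], adding [x] does not change the status of
    [k]; so the Cartan entry vanishes and the letters commute. *)
Lemma elt_add M b k : sub M -> addable [in M] b -> lab b k ->
  elt (b |` M) = (s k * elt M)%g.
Proof.
move: {2}#|`M| (leqnn #|`M|) => m; elim: m M b k => [|m IH] M b k.
all: move=> HMm HM Hb Hbk.
all: have bM := addable_notin Hb.
all: have N0 : b |` M != fset0 by apply/fset0Pn; exists b; rewrite fset1U1.
all: have [x xN Es] := reading_order_last N0.
all: have [Ex|Nx] := eqVneq x b;
  first by subst x; rewrite (elt_last Es Hbk) fsetU1K.
all: have xM : x \in M by move: xN; rewrite in_fset1U (negbTE Nx).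
  by move: HMm; rewrite leqn0 cardfs_eq0 => /eqP M0; rewrite M0 in xM.
have HN := sub_add Hadm HM Hb; have HxN := last_removable xN Es.
have Hx : removable [in M] x.
  case/and3P: HxN => _ /=; rewrite !in_fset1U !negb_or => /andP[_ Hr] /andP[_ Hd].
  by rewrite /removable /= xM Hr Hd.
have [kx Hkx] := ambient_label (sub_ambient HM xM).
have HM' := sub_rem Hadm HM Hx; have Hx' := addable_rem Hadm HM Hx.
have Hb' : addable [in M `\ x] b.
  case/and4P: Hb => ba _ /= Hl Hu; rewrite /addable ba /= !in_fsetD1 (negbTE bM) andbF /=.
  have Hpb := box_pos Hadm ba; case/and3P: HxN => _ /= rN dN.
  apply/andP; split; [move: Hl|move: Hu]; case: (_ \in amb) => //= ->; rewrite andbT.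
    by apply: contraNneq rN => <-; rewrite right_left ?fset1U1 ?(andP Hpb).2.
  by apply: contraNneq dN => <-; rewrite down_up ?fset1U1 ?(andP Hpb).1.
have Hlt : #|`M `\ x| <= m by move: HMm; rewrite (cardfsD1 x M) xM.
have EM : elt M = (s kx * elt (M `\ x))%g.
  by rewrite -{1}(fsetD1K xM); apply: IH.
have EN : (b |` M) `\ x = b |` (M `\ x).
  by apply/fsetP=> y; rewrite !inE; case: (y =P b) => [->|//]; rewrite eq_sym Nx.
rewrite (elt_last Es Hkx) EN (IH _ _ _ Hlt HM' Hb' Hbk) EM !mulgA.
have Hrb := label_range Hadm Hbk; have Hrx := label_range Hadm Hkx.
have Hc : cartan k kx = 0%R.
  have := st_add Hadm HM' Hx' Hkx Hrb; rewrite (fsetD1K xM).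
  by rewrite (st_addable Hadm HM Hb Hbk) (st_addable Hadm HM' Hb' Hbk); clear; lia.
by rewrite (refl_commute W Hrx Hrb _ Hc) // (st_sym_zero _ _ Hc).
Qed.

Lemma elt_toggle M i : sub M -> st M i != 0%R -> elt (toggle i M) = (s i * elt M)%g.
Proof.
move=> HM; case: (statusP Hadm i HM) => [x Hx Hi|x Hx Hi|//] _.
  by rewrite (toggle_addable Hadm HM Hx Hi) (elt_add HM Hx Hi).
rewrite (toggle_removable Hadm HM Hx Hi).
rewrite -[in RHS](fsetD1K (removable_in Hx)).
rewrite (elt_add (sub_rem Hadm HM Hx) (addable_rem Hadm HM Hx) Hi).
by rewrite mulgA refl_square ?mul1g ?(label_range Hadm Hi).
Qed.

Lemma has_weight_elt M : sub M -> has_weight (elt M) M.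
Proof.
move: M; apply: (sub_ind Hadm) => [|M b HM Hb IH]; first by rewrite elt0; apply: has_weight1.
have [k Hk] := ambient_label (addable_ambient Hb).
rewrite (elt_add HM Hb Hk) -(toggle_addable Hadm HM Hb Hk).
by apply: has_weight_mul => //; apply: label_range Hk.
Qed.

Lemma card_toggle M i : sub M -> (#|`toggle i M|%:Z = #|`M|%:Z + st M i)%R.
Proof.
move=> HM; case: (statusP Hadm i HM) => [x Hx Hi|x Hx Hi|Hn].
- by rewrite (toggle_addable Hadm HM Hx Hi) cardfsU1 (addable_notin Hx) /=; lia.
- rewrite (toggle_removable Hadm HM Hx Hi).
  by have := cardfsD1 x M; rewrite (removable_in Hx); lia.
- by rewrite toggle_neutral // addr0.
Qed.

Lemma has_word_elt M : sub M -> has_word (elt M) #|`M|.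
Proof.
move: M; apply: (sub_ind Hadm) => [|M b HM Hb IH].
  by rewrite elt0 cardfs0 has_word1.
have [k Hk] := ambient_label (addable_ambient Hb).
rewrite (elt_add HM Hb Hk) cardfsU1 (addable_notin Hb) add1n.
by apply: has_word_mul => //; apply: label_range Hk.
Qed.

(** Toggling along a word yields a diagram with at most one box per letter. If the number of boxes
    equals the number of letters, every toggle added a box, and the word spells the element of the
    diagram. *)
Lemma has_word_weight w k : has_word w k -> exists M,
  [/\ sub M, has_weight w M, #|`M| <= k & #|`M| = k -> w = elt M].
Proof.
move: w k; apply: has_word_ind => [|w i k Hi _ [M [HM Hw Hk HE]]].
  exists fset0; split; [exact: sub0|exact: has_weight1|by rewrite cardfs0|].
  by rewrite elt0.
exists (toggle i M); have Hc := card_toggle i HM; split.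
- exact: sub_toggle.
- exact: has_weight_mul.
- by move: Hc; case: (statusP Hadm i HM) => *; lia.
move=> Ek; have Hs : st M i = 1%R.
  by move: Hc; case: (statusP Hadm i HM) => *; lia.
by rewrite elt_toggle // ?Hs // HE //; lia.
Qed.

(** A removable box of [M] gives a label of status -1, hence also one in [N]; toggling it shrinks
    both. The empty diagram is recognized because it has no status -1. *)
Lemma st_inj M N : sub M -> sub N ->
  (forall i, 1 <= i <= n -> st M i = st N i) -> M = N.
Proof.
move: {2}#|`M| (leqnn #|`M|) => m; elim: m M N => [|m IH] M N HMm HM HN HE.
all: have Hempty (A B : {fset box}) : sub A -> sub B -> A = fset0 ->
   (forall i, 1 <= i <= n -> st A i = st B i) -> A = B.
1,3: move=> HA HB A0 HAB; rewrite A0; apply/eqP; rewrite eq_sym; apply: contraT => B0;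
  have [x xB Es] := reading_order_last B0; have Hx := last_removable xB Es;
  have [k Hk] := ambient_label (sub_ambient HB xB); have Hr := label_range Hadm Hk;
  have := HAB k Hr; rewrite A0 st0 // (st_removable Hadm HB Hx Hk); by case: eqP.
  by apply: Hempty => //; move: HMm; rewrite leqn0 cardfs_eq0 => /eqP.
have [M0|M0] := eqVneq M fset0; first exact: Hempty.
have [x xM Es] := reading_order_last M0; have Hx := last_removable xM Es.
have [k Hk] := ambient_label (sub_ambient HM xM); have Hr := label_range Hadm Hk.
rewrite -(toggleK Hadm k HM) -(toggleK Hadm k HN); congr toggle.
apply: IH; [|exact: sub_toggle|exact: sub_toggle|].
  by have := card_toggle k HM; rewrite (st_removable Hadm HM Hx Hk); lia.
by move=> i Hi; rewrite !st_toggle // !HE.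
Qed.

Lemma has_weight_inj w M N : sub M -> sub N -> has_weight w M -> has_weight w N -> M = N.
Proof.
move=> HM HN Hw Hw'; apply: st_inj => // i /ordS_ex[o ->]; by rewrite -Hw -Hw'.
Qed.

(** Among the elements with the weight of [M], [elt M] is the only one of minimal length. This
    yields lengths and membership in W^J. *)
Lemma has_weight_length w M : sub M -> has_weight w M ->
  #|`M| <= length w /\ (length w <= #|`M| -> w = elt M).
Proof.
move=> HM Hw; have [N [HN HwN Hle HE]] := has_word_weight (length_has_word w).
have EN := has_weight_inj HM HN Hw HwN; subst N; split=> // Hge.
by apply: HE; apply/eqP; rewrite eqn_leq Hle.
Qed.

Lemma length_elt M : sub M -> length (elt M) = #|`M|.
Proof.
move=> HM; apply/eqP; rewrite eqn_leq (length_leq (has_word_elt HM)).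
by have [-> _] := has_weight_length HM (has_weight_elt HM).
Qed.

Lemma elt_inj M N : sub M -> sub N -> elt M = elt N -> M = N.
Proof.
move=> HM HN E; apply: has_weight_inj (has_weight_elt HM) _ => //.
by rewrite E; apply: has_weight_elt.
Qed.

Lemma elt_quotient M : sub M -> elt M \in quotient_reps W (hJ H).
Proof.
move=> HM; rewrite inE; apply/forallP=> i; apply/implyP=> /andP[Hi Hio].
have Hw := has_weight_mulr Hi Hio (has_weight_elt HM).
have [Hle HE] := has_weight_length HM Hw; rewrite (length_elt HM) ltnNge.
apply/negP=> /HE /eqP; rewrite -{2}[elt M]mulg1 (inj_eq (mulgI _)).
by rewrite (negbTE (refl_neq1 W Hi)).
Qed.

Lemma st_range M i : sub M -> (st M i == 1%R) || (st M i == 0%R) || (st M i == (-1)%R).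
Proof. by move=> HM; case: (statusP Hadm i HM). Qed.

(** Peel off the letter [t] of the last box and, according to the bond between [i] and [t], none,
    one or two further letters. The commutation or braid relation then reduces the claim to a
    smaller diagram on which [i] or [t] is neutral. A Cartan entry -2 at [(i, t)] would produce the
    status -2. *)
Lemma elt_neutral M i : sub M -> 1 <= i <= n -> st M i = 0%R ->
  exists2 j, hJ H j & (s i * elt M = elt M * s j)%g.
Proof.
move: {2}#|`M| (leqnn #|`M|) => m; elim: m M i => [|m IH] M i HMm HM Hi Hs.
  move: HMm Hs; rewrite leqn0 cardfs_eq0 => /eqP->; rewrite st0 // => Hio.
  exists i; last by rewrite elt0 mulg1 mul1g.
  by rewrite /hJ /= Hi; case: eqP Hio.
have [M0|M0] := eqVneq M fset0; first by apply: IH => //; rewrite M0 cardfs0.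
have [x xM Es] := reading_order_last M0; have Hx := last_removable xM Es.
have [t Ht] := ambient_label (sub_ambient HM xM); have Hr := label_range Hadm Ht.
have Hst := st_removable Hadm HM Hx Ht.
have Hit : i != t by apply/eqP=> E; move: Hs; rewrite E Hst.
have step N k : sub N -> st N k = (-1)%R ->
    [/\ sub (toggle k N), #|`toggle k N| < #|`N| & elt N = s k * elt (toggle k N)]%g.
  move=> HN Hk; have HtN := sub_toggle Hadm k HN.
  have := card_toggle k HN; rewrite Hk; split=> //; first by lia.
  rewrite -{1}(toggleK Hadm k HN) elt_toggle //.
  case: (statusP Hadm k HN) Hk => // y Hy Hyk _.
  rewrite (toggle_removable Hadm HN Hy Hyk).
  by rewrite (st_addable Hadm (sub_rem Hadm HN Hy) (addable_rem Hadm HN Hy) Hyk).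
have [HM1 Hc1 ->] := step _ _ HM Hst; set M1 := toggle t M in HM1 Hc1 *.
have Hs1 : st M1 i = cartan i t by rewrite st_toggle // Hs Hst; ring.
have Ht1 : st M1 t = 1%R by rewrite st_toggle // Hst cartan_diag; ring.
have Hle1 : #|`M1| <= m by move: HMm Hc1; clear; lia.
case: (cartan_cases Hi Hr Hit) => -[H1 H2]; rewrite H1 in Hs1.
- have [j Hj E] := IH M1 i Hle1 HM1 Hi Hs1.
  exists j => //; rewrite mulgA (refl_commute W Hi Hr) //.
  by rewrite -mulgA E mulgA.
- have [HM2 Hc2 ->] := step _ _ HM1 Hs1; set M2 := toggle i M1 in HM2 Hc2 *.
  have Ht2 : st M2 t = 0%R by rewrite st_toggle // Ht1 Hs1 H2.
  have Hle2 : #|`M2| <= m by move: Hle1 Hc2; clear; lia.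
  have [j Hj E] := IH M2 t Hle2 HM2 Hr Ht2.
  exists j => //; rewrite !mulgA (refl_braid3 W Hi Hr) //.
  by rewrite -!mulgA E.
- have [HM2 Hc2 ->] := step _ _ HM1 Hs1; set M2 := toggle i M1 in HM2 Hc2 *.
  have Ht2 : st M2 t = (-1)%R by rewrite st_toggle // Ht1 Hs1 H2.
  have Hi2 : st M2 i = 1%R by rewrite st_toggle // Hs1 cartan_diag.
  have [HM3 Hc3 ->] := step _ _ HM2 Ht2; set M3 := toggle t M2 in HM3 Hc3 *.
  have Hi3 : st M3 i = 0%R by rewrite st_toggle // Hi2 Ht2 H1.
  have Hle3 : #|`M3| <= m by move: Hle1 Hc2 Hc3; clear; lia.
  have [j Hj E] := IH M3 i Hle3 HM3 Hi Hi3.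
  exists j => //; rewrite !mulgA (refl_braid4 W Hi Hr) //.
  by rewrite -!mulgA E.
by have := st_range i HM1; rewrite Hs1.
Qed.

(** Provides the conditions of [relR_out]: [s i * elt M] equals [elt M * s j] with [j] in J, so
    multiplying it by [s j] on the right shortens it. *)
Lemma mul_neutral_notin M i : sub M -> 1 <= i <= n -> st M i = 0%R ->
  length (elt M) < length (s i * elt M)%g /\ (s i * elt M)%g \notin quotient_reps W (hJ H).
Proof.
move=> HM Hi Hs; have [j Hj E] := elt_neutral HM Hi Hs.
have Hw : has_weight (s i * elt M)%g M.
  have := has_weight_mul HM Hi (has_weight_elt HM).
  by rewrite toggle_neutral // neutral_st // Hs.
have [Hle HE] := has_weight_length HM Hw.
have Hlt : length (elt M) < length (s i * elt M)%g.
  rewrite length_elt // ltnNge; apply/negP=> /HE /eqP.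
  by rewrite -{2}[elt M]mul1g (inj_eq (mulIg _)) (negbTE (refl_neq1 W Hi)).
split=> //; have /andP[Hjr _] := Hj; have [o Eo] := ordS_ex Hjr.
rewrite inE; apply/forallPn; exists o; rewrite -Eo Hj /= E -mulgA refl_square // mulg1.
by rewrite -E -leqNgt ltnW.
Qed.

Lemma bruhat_toggle M i : sub M -> st M i = 1%R -> bruhat_lt (elt M) (s i * elt M)%g.
Proof.
move=> HM Hs; have Hi : 1 <= i <= n.
  by case: (statusP Hadm i HM) Hs => // x _ Hx _; apply: label_range Hx.
apply: bruhat_lt_refl => //; rewrite -elt_toggle ?Hs // !length_elt //.
  by have := card_toggle i HM; rewrite Hs; lia.
exact: sub_toggle.
Qed.

Lemma removable_diff M L : sub M -> sub L -> M `<=` L -> M != L ->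
  exists2 x, removable [in L] x & x \notin M.
Proof.
move=> HM HL ML Hne; have D0 : L `\` M != fset0.
  by rewrite fsetD_eq0; apply: contra Hne => LM; rewrite eqEfsubset ML LM.
have [x xD Es] := reading_order_last D0.
have /and3P[_ /= rD dD] := last_removable xD Es.
move: xD; rewrite in_fsetD => /andP[xM xL]; exists x => //.
have xa := sub_ambient HL xL.
rewrite /removable /= xL /=; apply/andP; split.
  apply: contra rD => rL; rewrite in_fsetD rL andbT.
  by apply: (notin_above HM xa xM) => //=.
apply: contra dD => dL; rewrite in_fsetD dL andbT.
by apply: (notin_above HM xa xM) => //=.
Qed.

Lemma bruhat_elt M L : sub M -> sub L -> M `<=` L -> bruhat (elt M) (elt L).
Proof.
move: {2}#|`L| (leqnn #|`L|) => m; elim: m L => [|m IH] L HLm HM HL ML.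
all: have [->|Hne] := eqVneq M L; first by apply: connect0.
all: have [x Hx xM] := removable_diff HM HL ML Hne.
  by move: HLm (removable_in Hx); rewrite leqn0 cardfs_eq0 => /eqP->.
have [k Hk] := ambient_label (sub_ambient HL (removable_in Hx)).
have HL' := sub_rem Hadm HL Hx; have Hx' := addable_rem Hadm HL Hx.
apply: (@connect_trans _ _ (elt (L `\ x))); last rewrite -/(bruhat _ _).
  apply: IH => //; first by move: HLm; rewrite (cardfsD1 x L) (removable_in Hx).
  by rewrite fsubsetD1 ML xM.
rewrite -[X in bruhat _ (elt X)](fsetD1K (removable_in Hx)) (elt_add HL' Hx' Hk).
by have /andP[] := bruhat_toggle HL' (st_addable Hadm HL' Hx' Hk).
Qed.

Lemma bruhat_lt_elt M L : sub M -> sub L -> M `<=` L -> M != L ->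
  bruhat_lt (elt M) (elt L).
Proof.
move=> HM HL ML Hne; rewrite /bruhat_lt bruhat_elt // andbT.
by apply: contra Hne => /eqP /elt_inj ->.
Qed.

End Elements.

(** * Relative R-polynomials on diagrams *)

Section Hecke.

Variable H : hermitian_pair.
Hypothesis Hadm : admissible H.

Local Notation lab x i := (label H x == Some i).
Local Notation sub := (subdiagram H).
Local Notation n := (rank (hdynkin H)).
Local Notation st := (st H).
Local Notation toggle := (toggle H).
Local Notation cartan := (cartan (hdynkin H)).

Implicit Types (M L N : {fset box}) (b x y : box) (i j k : nat).
Implicit Types (g : {fset box} -> {poly int}).

Local Open Scope ring_scope.

(* The action of the standard generator T_i on the parabolic module of the
   Hecke algebra whose basis is indexed by the diagrams. *)
Definition hecke i g M : {poly int} :=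
  if st M i == 1 then ('X - 1) * g M + 'X * g (toggle i M)
  else if st M i == -1 then g (toggle i M) else 'X * g M.

Lemma hecke1 i g M : st M i = 1 -> hecke i g M = ('X - 1) * g M + 'X * g (toggle i M).
Proof. by rewrite /hecke => ->. Qed.

Lemma heckeN1 i g M : st M i = -1 -> hecke i g M = g (toggle i M).
Proof. by rewrite /hecke => ->. Qed.

Lemma hecke0 i g M : st M i = 0 -> hecke i g M = 'X * g M.
Proof. by rewrite /hecke => ->. Qed.

Lemma hecke_ext i g g' M : (forall N, sub N -> g N = g' N) -> sub M ->
  hecke i g M = hecke i g' M.
Proof. by move=> Hg HM; rewrite /hecke !Hg //; apply: sub_toggle. Qed.

Lemma heckeZ i g M : hecke i (fun N => 'X * g N) M = 'X * hecke i g M.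
Proof. by rewrite /hecke; case: ifP => _; [ring|case: ifP]. Qed.

Lemma hecke_eq0 i g M : g M = 0 -> g (toggle i M) = 0 -> hecke i g M = 0.
Proof.
by rewrite /hecke => -> ->; rewrite !mulr0 addr0 !if_same.
Qed.

Lemma toggle_commute i j M : (1 <= i <= n)%N -> (1 <= j <= n)%N -> sub M ->
  cartan i j = 0 -> cartan j i = 0 -> toggle i (toggle j M) = toggle j (toggle i M).
Proof.
move=> Hi Hj HM H1 H2; have Hti := sub_toggle Hadm i HM; have Htj := sub_toggle Hadm j HM.
apply: (st_inj Hadm); [exact: sub_toggle|exact: sub_toggle|].
by move=> l Hl; rewrite !st_toggle // H1 H2; ring.
Qed.

Lemma hecke_commute i j g M : (1 <= i <= n)%N -> (1 <= j <= n)%N -> sub M ->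
  cartan i j = 0 -> cartan j i = 0 ->
  hecke i (hecke j g) M = hecke j (hecke i g) M.
Proof.
move=> Hi Hj HM H1 H2; rewrite /hecke !st_toggle // H1 H2 !mulr0 !subr0.
rewrite (toggle_commute Hj Hi) //.
case: (st M i == 1); case: (st M j == 1); try ring.
- by case: (st M j == -1); ring.
- by case: (st M i == -1); ring.
by case: (st M i == -1); case: (st M j == -1); ring.
Qed.

(** Under the two toggles [M] generates a chain of three diagrams with statuses (1, 0), (-1, 1), (0,
    -1). The braid relation is a polynomial identity on it. *)
Lemma hecke_chain3 i j g M : (1 <= i <= n)%N -> (1 <= j <= n)%N -> sub M ->
  cartan i j = -1 -> cartan j i = -1 -> st M i = 1 -> st M j = 0 ->
  let eq N := hecke i (hecke j (hecke i g)) N = hecke j (hecke i (hecke j g)) N in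
  [/\ eq M, eq (toggle i M) & eq (toggle j (toggle i M))].
Proof.
move=> Hi Hj HM H1 H2 Ei Ej /=; set M1 := toggle i M; set M2 := toggle j M1.
have HM1 : sub M1 by apply: sub_toggle.
have Ei1 : st M1 i = -1 by rewrite st_toggle // Ei cartan_diag.
have Ej1 : st M1 j = 1 by rewrite st_toggle // Ei Ej H2.
have Ei2 : st M2 i = 0 by rewrite st_toggle // Ei1 Ej1 H1.
have Ej2 : st M2 j = -1 by rewrite st_toggle // Ej1 cartan_diag.
have T1 : toggle i M1 = M by rewrite toggleK.
have T2 : toggle j M2 = M1 by rewrite toggleK.
have A0 g' := hecke1 g' Ei; have B0 g' := hecke0 g' Ej.
have A1 g' := heckeN1 g' Ei1; have B1 g' := hecke1 g' Ej1.
have A2 g' := hecke0 g' Ei2; have B2 g' := heckeN1 g' Ej2.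
rewrite -/M1 in A0; rewrite T1 in A1; rewrite -/M2 in B1; rewrite T2 in B2.
by split; rewrite !(A0, B0, A1, B1, A2, B2); ring.
Qed.

(** For a double bond the chain has four diagrams, with statuses (0, 1), (1, -1), (-1, 1), (0,
    -1). *)
Lemma hecke_chain4 i j g M : (1 <= i <= n)%N -> (1 <= j <= n)%N -> sub M ->
  cartan i j = -1 -> cartan j i = -2 -> st M i = 0 -> st M j = 1 ->
  let eq N := hecke i (hecke j (hecke i (hecke j g))) N =
              hecke j (hecke i (hecke j (hecke i g))) N in
  [/\ eq M, eq (toggle j M), eq (toggle i (toggle j M))
    & eq (toggle j (toggle i (toggle j M)))].
Proof.
move=> Hi Hj HM H1 H2 Ei Ej /=.
set M1 := toggle j M; set M2 := toggle i M1; set M3 := toggle j M2.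
have HM1 : sub M1 by apply: sub_toggle.
have HM2 : sub M2 by apply: sub_toggle.
have Ej1 : st M1 j = -1 by rewrite st_toggle // Ej cartan_diag.
have Ei1 : st M1 i = 1 by rewrite st_toggle // Ei Ej H1.
have Ei2 : st M2 i = -1 by rewrite st_toggle // Ei1 cartan_diag.
have Ej2 : st M2 j = 1 by rewrite st_toggle // Ei1 Ej1 H2.
have Ej3 : st M3 j = -1 by rewrite st_toggle // Ej2 cartan_diag.
have Ei3 : st M3 i = 0 by rewrite st_toggle // Ei2 Ej2 H1.
have T1 : toggle j M1 = M by rewrite toggleK.
have T2 : toggle i M2 = M1 by rewrite toggleK.
have T3 : toggle j M3 = M2 by rewrite toggleK.
have A0 g' := hecke0 g' Ei; have B0 g' := hecke1 g' Ej.
have A1 g' := hecke1 g' Ei1; have B1 g' := heckeN1 g' Ej1.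
have A2 g' := heckeN1 g' Ei2; have B2 g' := hecke1 g' Ej2.
have A3 g' := hecke0 g' Ei3; have B3 g' := heckeN1 g' Ej3.
rewrite -/M1 in B0; rewrite T1 in B1; rewrite -/M2 in A1; rewrite T2 in A2.
rewrite -/M3 in B2; rewrite T3 in B3.
by split; rewrite !(A0, B0, A1, B1, A2, B2, A3, B3); ring.
Qed.

(** The two statuses of [M] tell its position in a chain, whose first diagram is then reached by
    toggling back. Pairs such as (1, 1) cannot occur, since a toggle would create a status 2. *)
Lemma hecke_braid3 i j g M : (1 <= i <= n)%N -> (1 <= j <= n)%N -> sub M ->
  cartan i j = -1 -> cartan j i = -1 ->
  hecke i (hecke j (hecke i g)) M = hecke j (hecke i (hecke j g)) M.
Proof.
move=> Hi Hj HM H1 H2; have Hti := sub_toggle Hadm i HM; have Htj := sub_toggle Hadm j HM.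
have Sij := st_toggle Hadm j HM Hi; rewrite H1 in Sij.
have Sji := st_toggle Hadm i HM Hj; rewrite H2 in Sji.
have Sii := st_toggle Hadm i HM Hi; rewrite cartan_diag in Sii.
have Sjj := st_toggle Hadm j HM Hj; rewrite cartan_diag in Sjj.
have Rji := st_range Hadm j Hti; have Rij := st_range Hadm i Htj.
have := st_range Hadm i HM; have := st_range Hadm j HM.
case/orP=> [/orP[]|] /eqP Ej; case/orP=> [/orP[]|] /eqP Ei;
  rewrite Ei Ej in Sij Sji Sii Sjj; rewrite ?Sij ?Sji in Rij Rji;
  try discriminate Rij; try discriminate Rji.
- by have [-> _ _] := hecke_chain3 g Hj Hi HM H2 H1 Ej Ei.
- have [_ + _] := hecke_chain3 g Hi Hj Hti H1 H2 Sii Sji; by rewrite toggleK.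
- by have [-> _ _] := hecke_chain3 g Hi Hj HM H1 H2 Ei Ej.
- by rewrite /hecke Ei Ej /=.
- have Sjij := st_toggle Hadm j Hti Hj; have Siij := st_toggle Hadm j Hti Hi.
  rewrite Sji Sii H1 cartan_diag in Sjij Siij.
  have Htji := sub_toggle Hadm j Hti.
  have [_ _] := hecke_chain3 g Hj Hi Htji H2 H1 Sjij Siij.
  by rewrite !toggleK.
- have [_ + _] := hecke_chain3 g Hj Hi Htj H2 H1 Sjj Sij; by rewrite toggleK.
- have Siji := st_toggle Hadm i Htj Hi; have Sjji := st_toggle Hadm i Htj Hj.
  rewrite Sij Sjj H2 cartan_diag in Siji Sjji.
  have Htij := sub_toggle Hadm i Htj.
  have [_ _] := hecke_chain3 g Hi Hj Htij H1 H2 Siji Sjji.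
  by rewrite !toggleK.
Qed.

Lemma hecke_braid4 i j g M : (1 <= i <= n)%N -> (1 <= j <= n)%N -> sub M ->
  cartan i j = -1 -> cartan j i = -2 ->
  hecke i (hecke j (hecke i (hecke j g))) M = hecke j (hecke i (hecke j (hecke i g))) M.
Proof.
move=> Hi Hj HM H1 H2; have Hti := sub_toggle Hadm i HM; have Htj := sub_toggle Hadm j HM.
have Sij := st_toggle Hadm j HM Hi; rewrite H1 in Sij.
have Sji := st_toggle Hadm i HM Hj; rewrite H2 in Sji.
have Sii := st_toggle Hadm i HM Hi; rewrite cartan_diag in Sii.
have Sjj := st_toggle Hadm j HM Hj; rewrite cartan_diag in Sjj.
have Rji := st_range Hadm j Hti; have Rij := st_range Hadm i Htj.
have := st_range Hadm i HM; have := st_range Hadm j HM.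
case/orP=> [/orP[]|] /eqP Ej; case/orP=> [/orP[]|] /eqP Ei;
  rewrite Ei Ej in Sij Sji Sii Sjj; rewrite ?Sij ?Sji in Rij Rji;
  try discriminate Rij; try discriminate Rji.
- by have [-> _ _ _] := hecke_chain4 g Hi Hj HM H1 H2 Ei Ej.
- have Siji := st_toggle Hadm j Hti Hi; have Sjji := st_toggle Hadm j Hti Hj.
  rewrite Sji Sii H1 cartan_diag in Siji Sjji.
  have Htij := sub_toggle Hadm j Hti.
  have [_ _ + _] := hecke_chain4 g Hi Hj Htij H1 H2 Siji Sjji.
  by rewrite !toggleK.
- by rewrite /hecke Ei Ej /=.
- have [_ + _ _] := hecke_chain4 g Hi Hj Htj H1 H2 Sij Sjj; by rewrite toggleK.
have Si2 := st_toggle Hadm i Htj Hi; have Sj2 := st_toggle Hadm i Htj Hj.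
rewrite Sij Sjj H2 cartan_diag in Si2 Sj2.
have Ht2 := sub_toggle Hadm i Htj.
have Si3 := st_toggle Hadm j Ht2 Hi; have Sj3 := st_toggle Hadm j Ht2 Hj.
rewrite Si2 Sj2 H1 cartan_diag in Si3 Sj3.
have Ht3 := sub_toggle Hadm j Ht2.
have [_ _ _] := hecke_chain4 g Hi Hj Ht3 H1 H2 Si3 Sj3.
by rewrite !toggleK.
Qed.

End Hecke.

(** * The recursion transported to diagrams, from above and from below *)

Section RelativeR.

Variables (H : hermitian_pair) (W : weyl_group (hdynkin H)).
Hypothesis Hadm : admissible H.
Variable R : W -> W -> {poly int}.
Hypothesis HR : relative_R_polynomials (hJ H) R.

Local Notation lab x i := (label H x == Some i).
Local Notation sub := (subdiagram H).
Local Notation n := (rank (hdynkin H)).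
Local Notation st := (st H).
Local Notation toggle := (toggle H).
Local Notation cartan := (cartan (hdynkin H)).
Local Notation elt := (diagram_element W).
Local Notation hecke := (hecke H).
Local Notation s := (refl W).

Implicit Types (M L N : {fset box}) (b x y : box) (i j k : nat).

Local Open Scope fset_scope.
Local Open Scope ring_scope.

Definition rpoly L M : {poly int} := R (elt M) (elt L).

Lemma rpoly_diag M : sub M -> rpoly M M = 1.
Proof. by move=> HM; apply: (relR_diag HR); apply: elt_quotient. Qed.

Lemma st_label M i : sub M -> st M i != 0 -> (1 <= i <= n)%N.
Proof.
by move=> HM; case: (statusP Hadm i HM) => // x _ Hx _; apply: label_range Hx.
Qed.

Lemma rpoly_descent L M i : sub M -> sub L -> st L i = -1 ->
  bruhat_lt (elt M) (elt L) -> rpoly L M = hecke i (rpoly (toggle i L)) M.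
Proof.
move=> HM HL Hi Hlt; have Hr := st_label HL (i := i); rewrite Hi in Hr.
have {}Hr := Hr isT.
have HtL := sub_toggle Hadm i HL; have HtM := sub_toggle Hadm i HM.
have EL : (s i * elt L)%g = elt (toggle i L) by rewrite elt_toggle // Hi.
have Hd : left_descent (elt L) i.
  rewrite /left_descent Hr EL !length_elt //.
  by have := card_toggle Hadm i HL; rewrite Hi; clear; lia.
have qM := elt_quotient W Hadm HM; have qL := elt_quotient W Hadm HL.
have := st_range Hadm i HM; case/orP=> [/orP[]|] /eqP Ei.
- have EM : (s i * elt M)%g = elt (toggle i M) by rewrite elt_toggle // Ei.
  have HB := bruhat_toggle W Hadm HM Ei.
  rewrite hecke1 // /rpoly (relR_up HR qM qL Hlt Hd HB) ?EL ?EM //.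
  exact: elt_quotient.
- have [Hl Hn] := mul_neutral_notin W Hadm HM Hr Ei.
  rewrite hecke0 // /rpoly (relR_out HR qM qL Hlt Hd) ?EL //.
  exact: bruhat_lt_refl.
have EM : (s i * elt M)%g = elt (toggle i M) by rewrite elt_toggle // Ei.
rewrite heckeN1 // /rpoly (relR_down HR qM qL Hlt Hd) ?EL ?EM //.
have Ei' : st (toggle i M) i = 1 by rewrite st_toggle // Ei cartan_diag.
have := bruhat_toggle W Hadm HtM Ei'.
by rewrite -EM mulgA refl_square // mul1g.
Qed.

Lemma removable_of_st M i : sub M -> st M i = -1 ->
  exists x, [/\ removable [in M] x, lab x i & toggle i M = M `\ x].
Proof.
move=> HM; case: (statusP Hadm i HM) => // x Hx Hi _.
by exists x; rewrite (toggle_removable Hadm HM Hx Hi).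
Qed.

Lemma addable_of_st M i : sub M -> st M i = 1 ->
  exists x, [/\ addable H [in M] x, lab x i & toggle i M = x |` M].
Proof.
move=> HM; case: (statusP Hadm i HM) => // x Hx Hi _.
by exists x; rewrite (toggle_addable Hadm HM Hx Hi).
Qed.

(** The removed boxes [y] of [M] and [x] of [L] have the same label, so they are comparable. If [y]
    were not in [L], then [x] would lie strictly below [y] and remain in the smaller inner diagram,
    but not in the outer one. *)
Lemma toggle_subset M L i : sub M -> sub L -> st M i = -1 -> st L i = -1 ->
  toggle i M `<=` toggle i L -> M `<=` L.
Proof.
move=> HM HL /(removable_of_st HM)[y [Hy Hyi ->]] /(removable_of_st HL)[x [Hx Hxi ->]] Hsub.
have yM := removable_in Hy; have xL := removable_in Hx.
have yL : y \in L.
  apply: contraT => yL; have ya := sub_ambient HM yM; have xa := sub_ambient HL xL.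
  have Hn : x != y by apply: contraNneq yL => <-.
  case/orP: (label_chain Hadm Hxi Hyi) => /andP[H1 H2].
    have : x \in M `\ y by rewrite in_fsetD1 Hn (sub_ideal HM yM).
    by move/(fsubsetP Hsub); rewrite in_fsetD1 eqxx.
  by case/negP: yL; apply: (sub_ideal HL xL).
rewrite -(fsetD1K yM) fsubUset fsub1set yL /=.
by apply: fsubset_trans Hsub _; apply: fsubD1set.
Qed.

Lemma hecke_notin g M L i : sub M -> sub L -> st L i = -1 -> ~~ (M `<=` L) ->
  (forall N, sub N -> ~~ (N `<=` toggle i L) -> g N = 0) -> hecke i g M = 0.
Proof.
move=> HM HL Hi ML Hg; have HtM := sub_toggle Hadm i HM.
have M0 : ~~ (M `<=` toggle i L).
  have [x [_ _ ->]] := removable_of_st HL Hi.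
  by apply: contra ML => /fsubset_trans; apply; apply: fsubD1set.
have := st_range Hadm i HM; case/orP=> [/orP[]|] /eqP Ei.
- rewrite hecke1 // !Hg ?mulr0 ?addr0 //; have [x [_ _ ->]] := addable_of_st HM Ei.
  by apply: contra M0 => /(fsubset_trans _); apply; apply: fsubsetU1.
- by rewrite hecke0 // Hg // mulr0.
by rewrite heckeN1 // Hg //; apply: contra ML; apply: toggle_subset.
Qed.

Lemma last_status M : sub M -> M != fset0 -> exists i, st M i = -1.
Proof.
move=> HM M0; have [x xM Es] := reading_order_last M0; have Hx := last_removable xM Es.
have [k Hk] := ambient_label (sub_ambient HM xM).
by exists k; apply: st_removable Hk.
Qed.

Lemma card_toggleN1 M i : sub M -> st M i = -1 -> (#|`toggle i M| < #|`M|)%N.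
Proof. by move=> HM Hi; have := card_toggle Hadm i HM; rewrite Hi; clear; lia. Qed.

(** [relR_nle] settles pairs that are incomparable in Bruhat order. For a comparable pair without
    containment the recursion still produces 0, by induction on [L]. Containment thereby takes over
    the role of the Bruhat order. *)
Lemma rpoly_notin L M : sub M -> sub L -> ~~ (M `<=` L) -> rpoly L M = 0.
Proof.
move: {2}#|`L| (leqnn #|`L|) => m; elim: m L M => [|m IH] L M HLm HM HL ML.
all: case: (boolP (bruhat (elt M) (elt L))) => HB;
  last by apply: (relR_nle HR) => //; apply: elt_quotient.
  move: HLm HB ML; rewrite leqn0 cardfs_eq0 => /eqP->; rewrite {1}elt0 => /bruhat_1.
  by rewrite -[1%g](elt0 W) => /(elt_inj Hadm HM (sub0 H)) ->; rewrite fsubset_refl.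
have [L0|L0] := eqVneq L fset0; first by apply: IH => //; rewrite L0 cardfs0.
have [i Hi] := last_status HL L0.
have Hlt : bruhat_lt (elt M) (elt L).
  rewrite /bruhat_lt HB andbT; apply: contraNneq ML.
  by move/(elt_inj Hadm HM HL) ->; rewrite fsubset_refl.
rewrite (rpoly_descent HM HL Hi Hlt); apply: (hecke_notin HM HL Hi ML) => N HN.
have HtL := sub_toggle Hadm i HL; apply: IH => //.
by move: HLm (card_toggleN1 HL Hi); clear; lia.
Qed.

(** Valid for every diagram [M], also for [M = L] and without containment. Only as an identity of
    functions of [M] can it be iterated under the operators. *)
Lemma rpoly_down L M i : sub M -> sub L -> st L i = -1 ->
  rpoly L M = hecke i (rpoly (toggle i L)) M.
Proof.
move=> HM HL Hi; have HtL := sub_toggle Hadm i HL.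
have [->|Hne] := eqVneq M L; first by rewrite heckeN1 // !rpoly_diag.
case: (boolP (M `<=` L)) => ML.
  by apply: rpoly_descent => //; apply: bruhat_lt_elt.
rewrite rpoly_notin //; symmetry; apply: (hecke_notin HM HL Hi ML) => N HN.
exact: rpoly_notin.
Qed.

(** Follows the descent of [elt_neutral]: [rpoly L] is written with one to three operators applied
    to a smaller diagram, and the relations between operators move [hecke i] inward to a neutral
    label. *)
Lemma rpoly_neutral L M i : sub M -> sub L -> (1 <= i <= n)%N -> st L i = 0 ->
  hecke i (rpoly L) M = 'X * rpoly L M.
Proof.
move: {2}#|`L| (leqnn #|`L|) => m; elim: m L M i => [|m IH] L M i HLm HM HL Hi Hs.
  move: HLm Hs; rewrite leqn0 cardfs_eq0 => /eqP-> Hs; have HtM := sub_toggle Hadm i HM.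
  have T0 : toggle i fset0 = fset0 by rewrite toggle_neutral // neutral_st ?Hs //; apply: sub0.
  have [->|M0] := eqVneq M fset0; first by rewrite hecke0.
  have Z N : sub N -> N != fset0 -> rpoly fset0 N = 0.
    by move=> HN N0; rewrite rpoly_notin ?fsubset0 //; apply: sub0.
  have tM0 : toggle i M != fset0.
    by apply: contraNneq M0 => E; rewrite -(toggleK Hadm i HM) E T0.
  by rewrite hecke_eq0 ?Z // mulr0.
have [L0|L0] := eqVneq L fset0; first by apply: IH => //; rewrite L0 cardfs0.
have [t Ht] := last_status HL L0.
have Hr : (1 <= t <= n)%N by apply: (st_label HL); rewrite Ht.
have Hit : i != t by apply/eqP=> E; move: Hs; rewrite E Ht.
set L1 := toggle t L; have HL1 : sub L1 by apply: sub_toggle.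
have Hc1 := card_toggleN1 HL Ht; rewrite -/L1 in Hc1.
have Hle1 : (#|`L1| <= m)%N by move: HLm Hc1; clear; lia.
have Si1 : st L1 i = cartan i t by rewrite st_toggle // Hs Ht; ring.
have St1 : st L1 t = 1 by rewrite st_toggle // Ht cartan_diag.
have E1 N : sub N -> rpoly L N = hecke t (rpoly L1) N by move=> HN; apply: rpoly_down.
rewrite (hecke_ext Hadm i E1) // E1 //.
case: (cartan_cases Hi Hr Hit) => -[H1 H2]; rewrite H1 in Si1.
- rewrite (hecke_commute Hadm _ Hi Hr) //.
  rewrite (hecke_ext Hadm t (g' := fun N => 'X * rpoly L1 N)) ?heckeZ //.
  by move=> N HN; apply: IH.
- set L2 := toggle i L1; have HL2 : sub L2 by apply: sub_toggle.
  have Hc2 := card_toggleN1 HL1 Si1; rewrite -/L2 in Hc2.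
  have Hle2 : (#|`L2| <= m)%N by move: Hle1 Hc2; clear; lia.
  have St2 : st L2 t = 0 by rewrite st_toggle // St1 Si1 H2.
  have E2 N : sub N -> rpoly L1 N = hecke i (rpoly L2) N by move=> HN; apply: rpoly_down.
  rewrite (hecke_ext Hadm i (fun N HN => hecke_ext Hadm t E2 HN)) //.
  rewrite (hecke_ext Hadm t E2) //.
  rewrite (hecke_braid3 Hadm _ Hi Hr) //.
  rewrite -heckeZ; apply: (hecke_ext Hadm) => // N HN.
  rewrite -heckeZ; apply: (hecke_ext Hadm) => // N' HN'.
  exact: IH.
- set L2 := toggle i L1; have HL2 : sub L2 by apply: sub_toggle.
  have Hc2 := card_toggleN1 HL1 Si1; rewrite -/L2 in Hc2.
  have St2 : st L2 t = -1 by rewrite st_toggle // St1 Si1 H2.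
  have Si2 : st L2 i = 1 by rewrite st_toggle // Si1 cartan_diag.
  set L3 := toggle t L2; have HL3 : sub L3 by apply: sub_toggle.
  have Hc3 := card_toggleN1 HL2 St2; rewrite -/L3 in Hc3.
  have Hle3 : (#|`L3| <= m)%N by move: Hle1 Hc2 Hc3; clear; lia.
  have Si3 : st L3 i = 0 by rewrite st_toggle // Si2 St2 H1.
  have E3 N : sub N -> rpoly L2 N = hecke t (rpoly L3) N by move=> HN; apply: rpoly_down.
  have E2 N : sub N -> rpoly L1 N = hecke i (hecke t (rpoly L3)) N.
    by move=> HN; rewrite (rpoly_down HN HL1 Si1); apply: (hecke_ext Hadm).
  rewrite (hecke_ext Hadm i (fun N HN => hecke_ext Hadm t E2 HN)) //.
  rewrite (hecke_ext Hadm t E2) //.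
  rewrite (hecke_braid4 Hadm _ Hi Hr) //.
  rewrite -heckeZ; apply: (hecke_ext Hadm) => // N HN.
  rewrite -heckeZ; apply: (hecke_ext Hadm) => // N' HN'.
  rewrite -heckeZ; apply: (hecke_ext Hadm) => // N'' HN''.
  exact: IH.
by have := st_range Hadm i HL1; rewrite Si1.
Qed.

Lemma rpoly_top L M i : sub M -> sub L -> st L i = -1 -> st M i = 0 ->
  rpoly L M = 'X * rpoly (toggle i L) M.
Proof. by move=> HM HL Hi Hs; rewrite (rpoly_down HM HL Hi) hecke0. Qed.

Lemma rpoly_both L M i : sub M -> sub L -> st L i = -1 -> st M i = 1 ->
  rpoly L M = ('X - 1) * rpoly (toggle i L) M + 'X * rpoly (toggle i L) (toggle i M).
Proof. by move=> HM HL Hi Hs; rewrite (rpoly_down HM HL Hi) hecke1. Qed.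

(** At [toggle i M] the status is -1, so there [hecke i] returns the value at [M]; [rpoly_neutral]
    evaluates the same expression. *)
Lemma rpoly_bottom L M i : sub M -> sub L -> st L i = 0 -> st M i = 1 ->
  rpoly L M = 'X * rpoly L (toggle i M).
Proof.
move=> HM HL Hi Hs; have HtM := sub_toggle Hadm i HM.
have Hr : (1 <= i <= n)%N by apply: (st_label HM); rewrite Hs.
rewrite -(rpoly_neutral HtM HL Hr Hi) heckeN1 ?toggleK //.
by rewrite st_toggle // Hs cartan_diag.
Qed.

End RelativeR.

(** * Reduction moves *)

(** [Top] acts on the upper end [L] of the interval, [Bottom] on the lower end [M]. *)
Inductive move : Type := Top of box | Bottom of box | Both of box & box.

Definition neutral_at H (M : pred box) x : bool :=
  if label H x is Some i then neutral H M i else false.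

Definition delete (L : pred box) b : pred box := fun x => (x != b) && L x.

Definition valid H (M L : pred box) (mv : move) : bool :=
  match mv with
  | Top b => [&& removable L b, ~~ M b & neutral_at H M b]
  | Bottom c => [&& addable H M c, L c & neutral_at H L c]
  | Both b c => [&& removable L b, ~~ M b, addable H M c, L c &
      (label H b == label H c) || neutral_at H M b && neutral_at H (delete L b) c]
  end.

Lemma neutral_at_lab H M x i : label H x == Some i -> neutral_at H M x = neutral H M i.
Proof. by rewrite /neutral_at => /eqP->. Qed.

Section Soundness.

Variables (H : hermitian_pair) (W : weyl_group (hdynkin H)).
Hypothesis Hadm : admissible H.
Variable R : W -> W -> {poly int}.
Hypothesis HR : relative_R_polynomials (hJ H) R.

Local Notation lab x i := (label H x == Some i).
Local Notation sub := (subdiagram H).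
Local Notation rpoly := (rpoly R).

Implicit Types (M L N : {fset box}) (b c x y : box).

Local Open Scope fset_scope.
Local Open Scope ring_scope.

Lemma mem_delete L b : delete [in L] b =1 [in L `\ b].
Proof. by move=> x; rewrite /delete /= in_fsetD1. Qed.

Lemma sub_valid_top M L b : sub L -> M `<=` L -> removable [in L] b -> b \notin M ->
  sub (L `\ b) /\ M `<=` L `\ b.
Proof. by move=> HL ML Hb bM; rewrite fsubsetD1 ML bM; split=> //; apply: sub_rem. Qed.

Lemma sub_valid_bottom M L c : sub M -> M `<=` L -> addable H [in M] c -> c \in L ->
  sub (c |` M) /\ c |` M `<=` L.
Proof.
move=> HM ML Hc cL; split; first exact: sub_add.
by rewrite fsubUset fsub1set cL ML.
Qed.

Lemma rpoly_valid_top M L b : sub M -> sub L -> valid H [in M] [in L] (Top b) ->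
  rpoly L M = 'X * rpoly (L `\ b) M.
Proof.
move=> HM HL /and3P[Hb _ Hn]; have [i Hi] := ambient_label (sub_ambient HL (removable_in Hb)).
rewrite (neutral_at_lab _ Hi) in Hn.
rewrite -(toggle_removable Hadm HL Hb Hi); apply: rpoly_top => //.
  exact: st_removable Hi.
exact: st_neutral.
Qed.

Lemma rpoly_valid_bottom M L c : sub M -> sub L -> valid H [in M] [in L] (Bottom c) ->
  rpoly L M = 'X * rpoly L (c |` M).
Proof.
move=> HM HL /and3P[Hc _ Hn]; have [i Hi] := ambient_label (addable_ambient Hc).
rewrite (neutral_at_lab _ Hi) in Hn.
rewrite -(toggle_addable Hadm HM Hc Hi); apply: rpoly_bottom => //.
  exact: st_neutral.
exact: st_addable Hi.
Qed.

(** With equal labels this is one step of the recursion. Otherwise a top move gives R = q R', a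
    bottom move gives R' = q R'', and q R' = (q - 1) R' + q R'' has the same form. *)
Lemma rpoly_valid_both M L b c : sub M -> sub L -> valid H [in M] [in L] (Both b c) ->
  rpoly L M = ('X - 1) * rpoly (L `\ b) M + 'X * rpoly (L `\ b) (c |` M).
Proof.
move=> HM HL /and5P[Hb bM Hc cL].
have [i Hi] := ambient_label (sub_ambient HL (removable_in Hb)).
have [j Hj] := ambient_label (addable_ambient Hc).
rewrite (neutral_at_lab _ Hi) (neutral_at_lab _ Hj) (eqP Hi) (eqP Hj).
case/orP=> [/eqP[Eij]|/andP[Hn Hn']].
  subst j; rewrite -(toggle_removable Hadm HL Hb Hi) -(toggle_addable Hadm HM Hc Hj).
  apply: rpoly_both => //; first exact: st_removable Hi.
  exact: st_addable Hj.
have HL' := sub_rem Hadm HL Hb.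
have E := rpoly_top Hadm HR HM HL (st_removable Hadm HL Hb Hi) (st_neutral Hadm Hn).
rewrite (toggle_removable Hadm HL Hb Hi) in E.
rewrite (eq_neutral H (mem_delete L b)) in Hn'.
have Ha := st_addable Hadm HM Hc Hj; have Hz := st_neutral Hadm Hn'.
have := rpoly_bottom Hadm HR HM HL' Hz Ha.
rewrite (toggle_addable Hadm HM Hc Hj) E => ->; ring.
Qed.

End Soundness.

Definition rule_move (c : box) (w h : nat) : move :=
  if h < w then Top (c.1 + h, c.2 + w) else
  if w < h then Bottom c else Both (c.1 + h, c.2 + w) c.

Definition rule_spec (D : pred box) (c : box) (w h : nat) : Prop :=
  [/\ (forall x, D x -> reading_order c x),
      (forall k, k <= w -> D (c.1, c.2 + k)) /\ ~~ D (c.1, c.2 + w.+1)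
    & (forall k, k <= h -> D (c.1 + k, c.2 + w)) /\ ~~ D (c.1 + h.+1, c.2 + w)].

(** * Validity of the rule in the infinite families *)

Section Regular.

Variable H : hermitian_pair.
Hypotheses (Hadm : admissible H) (Hreg : ~~ exceptional H).
Variables (M L : {fset box}) (c : box) (w h : nat).
Hypotheses (HM : subdiagram H M) (HL : subdiagram H L).
Local Open Scope fset_scope.
Hypothesis Hrule : rule_spec [in L `\` M] c w h.

Local Notation amb := (ambient H).
Local Notation lab x i := (label H x == Some i).
Implicit Types (x y z : box) (i j k l : nat).

Let b : box := ((c.1 + h)%N, (c.2 + w)%N).

Lemma in_diff x : (x \in L `\` M) = (x \in L) && (x \notin M).
Proof. by rewrite in_fsetD andbC. Qed.

Lemma rule_row k : (k <= w)%N -> (c.1, (c.2 + k)%N) \in L /\ (c.1, (c.2 + k)%N) \notin M.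
Proof. by case: Hrule => _ [Hr _] _ /Hr /=; rewrite in_diff => /andP. Qed.

Lemma rule_column k : (k <= h)%N ->
  ((c.1 + k)%N, (c.2 + w)%N) \in L /\ ((c.1 + k)%N, (c.2 + w)%N) \notin M.
Proof. by case: Hrule => _ _ [Hr _] /Hr /=; rewrite in_diff => /andP. Qed.

Lemma rule_first : c \in L /\ c \notin M.
Proof. by have := rule_row (leq0n w); rewrite addn0 -surjective_pairing. Qed.

Lemma rule_above x : x \in L -> (x.1 < c.1)%N -> x \in M.
Proof.
move=> xL Hlt; apply: contraLR Hlt => xM; rewrite -leqNgt.
case: Hrule => Hf _ _; have := Hf x; rewrite /= in_diff xL xM => /(_ isT).
by rewrite /reading_order; clear; lia.
Qed.

(** An ambient box further right and not higher would force the ambient diagram, and then the skew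
    diagram, to continue the run to the right of [c]. *)
Lemma rule_beyond x : (c.1 <= x.1)%N -> (c.2 + w < x.2)%N -> x \notin L.
Proof.
move=> H1 H2; apply/negP=> xL; have [yL yM] := rule_row (leqnn w).
have ya := sub_ambient HL yL.
have ra := ambient_right Hadm Hreg ya (sub_ambient HL xL) H1 H2.
case: Hrule => _ [_ /negP Hn] _; apply: Hn; rewrite /= in_diff addnS.
rewrite (sub_ideal HL xL ra) //=.
by apply: (notin_above HM ya yM).
Qed.

Lemma rule_removable : removable [in L] b.
Proof.
have [bL bM] := rule_column (leqnn h); rewrite /removable /= bL /=.
rewrite (rule_beyond (x := right b)) /=; [|exact: leq_addr|by []].
case: Hrule => _ _ [_]; rewrite /= in_diff addnS; apply: contra => dL; rewrite dL /=.
exact: (notin_above HM (sub_ambient HL bL) bM).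
Qed.

Lemma rule_addable : addable H [in M] c.
Proof.
have [cL cM] := rule_first; have ca := sub_ambient HL cL.
have /andP[H1 H2] := box_pos Hadm ca.
rewrite /addable ca /= cM /=; apply/andP; split; apply/implyP=> Ha.
  have lL : left c \in L by apply: (sub_ideal HL cL Ha) => //=; apply: leq_pred.
  apply: contraT => lM; case: Hrule => Hf _ _.
  have := Hf (left c); rewrite /= in_diff lL lM => /(_ isT).
  by rewrite /reading_order /=; move: H2; clear; lia.
apply: rule_above => /=; last by rewrite prednK.
by apply: (sub_ideal HL cL Ha) => //=; apply: leq_pred.
Qed.

(** Boxes of the diagonal before [z] lie in [M] together with their right neighbours, and boxes
    after [z] lie outside [M] together with their upper neighbours. So only [z] itself could be a
    corner of [M]. *)
Lemma rule_neutral_bottom z i : z \in L -> z \notin M -> z.1 = c.1 ->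
  (forall x, lab x i -> (x.1 + z.2 = z.1 + x.2)%N) ->
  ~~ (lab z i && addable H [in M] z) -> neutral H [in M] i.
Proof.
move=> zL zM Ez Hdiag Hz; apply/neutralP => // x Hx; have Hd := Hdiag x Hx.
have xa := label_ambient Hx; have za := sub_ambient HL zL.
case: (ltngtP x.1 c.1) => Hxc.
- have H2 : (x.2 < z.2)%N by move: Hd Hxc Ez; clear; lia.
  have H1 : (x.1 < z.1)%N by rewrite Ez.
  have xM : x \in M.
    by apply: rule_above => //; apply: (sub_ideal HL zL xa); apply: ltnW.
  rewrite /addable /= xM andbF /=; apply/negP=> /and3P[_ /= /negP rM _]; apply: rM.
  have /andP[ra _] : (right x \in amb) && (up z \in amb).
    apply: (ambient_diagonal Hadm Hreg xa za (l := (z.1 - x.1)%N));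
      by move: Hd H1; clear; lia.
  by apply: rule_above => //; apply: (sub_ideal HL zL ra) => //=; apply: ltnW.
- have H2 : (z.2 < x.2)%N by move: Hd Hxc Ez; clear; lia.
  have H1 : (z.1 < x.1)%N by rewrite Ez.
  have zup y : y \in M -> (z.1 <= y.1)%N -> (z.2 <= y.2)%N -> False.
    by move=> yM H3 H4; case/negP: zM; apply: (sub_ideal HM yM).
  apply/andP; split; apply/negP.
    case/and4P=> _ _ _ /implyP Hup.
    have /andP[_ ua] : (right z \in amb) && (up x \in amb).
      apply: (ambient_diagonal Hadm Hreg za xa (l := (x.1 - z.1)%N));
        by move: Hd H1; clear; lia.
    by apply: (zup _ (Hup ua)) => /=; move: H1 H2; clear; lia.
  by case/and3P=> /= xM _ _; apply: (zup _ xM); apply: ltnW.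
have Exz : x = z.
  by apply/eqP; rewrite [x]surjective_pairing [z]surjective_pairing xpair_eqE;
     move: Hd Hxc Ez; clear; lia.
rewrite Exz in Hx *; move: Hz; rewrite Hx /= => -> /=.
by rewrite /removable /= (negbTE zM).
Qed.

(** The counterpart for the outer diagram: boxes of the diagonal after [z] lie to the right of the
    last column that [L] reaches from the row of [c] on. [L0] stands for [L] or for [L] without the
    box [b]. *)
Lemma rule_neutral_top (L0 : {fset box}) z i : L0 `<=` L -> z \in L ->
  (c.1 <= z.1)%N -> z.2 = (c.2 + w)%N ->
  (forall x, x \in L -> x != z -> x \in L0) ->
  (forall x, lab x i -> (x.1 + z.2 = z.1 + x.2)%N) ->
  (lab z i -> ~~ addable H [in L0] z && ~~ removable [in L0] z) ->
  neutral H [in L0] i.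
Proof.
move=> HL0 zL Hcz Ez Hz0 Hdiag Hz; apply/neutralP => // x Hx; have Hd := Hdiag x Hx.
have xa := label_ambient Hx; have za := sub_ambient HL zL.
case: (ltngtP x.1 z.1) => Hxz.
- have H2 : (x.2 < z.2)%N by move: Hd Hxz; clear; lia.
  have Hn y : (y.1 <= x.1)%N -> y != z.
    by move=> Hy; apply/eqP=> E; move: Hy Hxz; rewrite E; clear; lia.
  have xL : x \in L by apply: (sub_ideal HL zL xa); apply: ltnW.
  rewrite /addable /= (Hz0 _ xL (Hn _ (leqnn _))) andbF /=.
  apply/negP=> /and3P[_ /= /negP rM _]; apply: rM.
  have /andP[ra _] : (right x \in amb) && (up z \in amb).
    apply: (ambient_diagonal Hadm Hreg xa za (l := (z.1 - x.1)%N));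
      by move: Hd Hxz; clear; lia.
  apply: Hz0; last exact: Hn.
  by apply: (sub_ideal HL zL ra) => //=; apply: ltnW.
- have H2 : (z.2 < x.2)%N by move: Hd Hxz; clear; lia.
  apply/andP; split; apply/negP.
    case/and4P=> _ _ _ /implyP Hup.
    have /andP[_ ua] : (right z \in amb) && (up x \in amb).
      apply: (ambient_diagonal Hadm Hreg za xa (l := (x.1 - z.1)%N));
        by move: Hd Hxz; clear; lia.
    suff /negP[] : up x \notin L by apply: (fsubsetP HL0); apply: Hup.
    by apply: rule_beyond => /=; move: Hcz Hxz Ez H2; clear; lia.
  case/and3P=> /= xL0 _ _.
  suff /negP[] : x \notin L by apply: (fsubsetP HL0).
  by apply: rule_beyond; move: Hcz Hxz Ez H2; clear; lia.
have Exz : x = z.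
  by apply/eqP; rewrite [x]surjective_pairing [z]surjective_pairing xpair_eqE;
     move: Hd Hxz; clear; lia.
by rewrite Exz in Hx *; apply: Hz.
Qed.

Lemma rule_valid : valid H [in M] [in L] (rule_move c w h).
Proof.
have [cL cM] := rule_first; have [bL bM] := rule_column (leqnn h).
have ba := sub_ambient HL bL; have ca := sub_ambient HL cL.
have [i Hi] := ambient_label ba; have [j Hj] := ambient_label ca.
have Hdb x : lab x i -> (x.1 + b.2 = b.1 + x.2)%N.
  by move=> Hx; apply: (label_diagonal Hadm Hreg Hx Hi).
have Hdc x : lab x j -> (x.1 + c.2 = c.1 + x.2)%N.
  by move=> Hx; apply: (label_diagonal Hadm Hreg Hx Hj).
rewrite /= in Hdb; rewrite /rule_move; case: ltngtP => Hhw.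
- rewrite /valid rule_removable /= bM (neutral_at_lab _ Hi).
  (* The diagonal of [b] meets the row of [c] at [w - h] steps from [c]. As [w - h] is positive, the
     left neighbour of this box is in the skew diagram, so the box is not addable to [M]. *)
  have Hk : (w - h <= w)%N by apply: leq_subr.
  have [zL zM] := rule_row Hk.
  apply: (rule_neutral_bottom zL zM) => //.
    by move=> x /Hdb /=; move: Hhw; clear; lia.
  rewrite negb_and; apply/orP; right.
  have Hk' : (w - h.+1 <= w)%N by apply: leq_subr.
  have [lL lM] := rule_row Hk'.
  have El : left (c.1, (c.2 + (w - h))%N) = (c.1, (c.2 + (w - h.+1))%N).
    by rewrite /left /=; congr pair; move: Hhw; clear; lia.
  by rewrite /addable El (sub_ambient HL lL) /= (negbTE lM) /= !andbF.
- rewrite /valid rule_addable /= cL (neutral_at_lab _ Hj).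
  (* The diagonal of [c] meets the column of [b] at [w] steps below its top; since [w < h], a box of
     [L] lies below it, so it is not removable. *)
  have [zL zM] := rule_column (ltnW Hhw); have [dL dM] := rule_column Hhw.
  apply: (rule_neutral_top (fsubset_refl L) zL) => //=.
  + exact: leq_addr.
  + by move=> x /Hdc /=; clear; lia.
  rewrite addnS in dL.
  by move=> _; rewrite /addable /removable /= zL /down /= dL !andbF.
rewrite /valid rule_removable rule_addable /= bM cL /=.
case: eqP => //= Hne; rewrite (neutral_at_lab _ Hi) (neutral_at_lab _ Hj).
apply/andP; split.
  apply: (rule_neutral_bottom cL cM) => //.
    by move=> x /Hdb /=; move: Hhw; clear; lia.
  apply/negP=> /andP[/eqP Hci _]; case: Hne.
  by rewrite (eqP Hi) Hci.
rewrite (eq_neutral H (mem_delete L b)).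
apply: (rule_neutral_top _ bL) => //=.
- exact: fsubD1set.
- exact: leq_addr.
- by move=> x xL xb; rewrite in_fsetD1 xb.
- by move=> x /Hdc /=; move: Hhw; clear; lia.
move=> Hbj; case: Hne; by rewrite (eqP Hj) (eqP Hbj).
Qed.

End Regular.

(** * The pairs of types E6 and E7 *)

(** Every initial segment of a subdiagram in reading order is a subdiagram, so one pass over the
    boxes reaches them all. *)
Definition ideals H : seq (seq box) :=
  foldl (fun acc x => acc ++ [seq rcons s x | s <- acc & addable H [in s] x])
    [:: [::]] (boxes H).

(* Configurations which do not occur in the infinite families. *)
Definition pattern (D : pred box) (x : box) : bool :=
  [|| [&& D (down x), D (x.1.+1, x.2.+1) & ~~ D (right x)],
      [&& D (right x), D (x.1.+1, x.2.+1), D (x.1.+2, x.2.+1), D (x.1.+1, x.2.+2)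
        & ~~ D (down x)]
    | [&& D (right x), D (x.1.+1, x.2.+1), D (left x), D (up x) & ~~ D (down x)]].

Lemma eq_pattern (D D' : pred box) : D =1 D' -> pattern D =1 pattern D'.
Proof. by move=> E x; rewrite /pattern !E. Qed.

Lemma eq_valid H (M M' L L' : pred box) : M =1 M' -> L =1 L' ->
  valid H M L =1 valid H M' L'.
Proof.
move=> EM EL mv.
have En (N N' : pred box) x : N =1 N' -> neutral_at H N x = neutral_at H N' x.
  by move=> E; rewrite /neutral_at; case: (label H x) => // i; rewrite (eq_neutral H E).
have Ed y : delete L y =1 delete L' y by move=> x; rewrite /delete EL.
case: mv => [b|c|b c] /=.
- by rewrite (eq_removable EL) EM (En _ _ _ EM).
- by rewrite (eq_addable H EM) EL (En _ _ _ EL).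
by rewrite (eq_removable EL) (eq_addable H EM) EM EL (En _ _ _ EM) (En _ _ _ (Ed b)).
Qed.

Definition diff (s l : seq box) : seq box := [seq x <- l | x \notin s].

Definition run (D : seq box) (f : nat -> box) : nat :=
  find (fun k => f k.+1 \notin D) (iota 0 (size D)).

(** Correctness is verified by evaluation: [check_rule] tests [rule_specb] on the result for every
    skew pair. *)
Definition rule_of (D : seq box) : box * nat * nat :=
  let c := head (0, 0) D in
  let w := run D (fun k => (c.1, c.2 + k)) in
  (c, w, run D (fun k => (c.1 + k, c.2 + w))).

Definition rule_specb (D : seq box) (c : box) (w h : nat) : bool :=
  [&& all (reading_order c) D,
      all (fun k => (c.1, c.2 + k) \in D) (iota 0 w.+1), (c.1, c.2 + w.+1) \notin D,
      all (fun k => (c.1 + k, c.2 + w) \in D) (iota 0 h.+1)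
    & (c.1 + h.+1, c.2 + w) \notin D].

Definition rule_ok H (s l D : seq box) : bool :=
  let: (c, w, h) := rule_of D in valid H [in s] [in l] (rule_move c w h).

Definition skew_pairs H : seq (seq box * seq box * seq box) :=
  [seq t <- [seq (p, diff p.1 p.2) | p <- [seq (s, l) | s <- ideals H, l <- ideals H]
      & if size p.1 <= size p.2 then all [in p.2] p.1 else false] | t.2 != [::]].

(** Closure under adding a box, from which [sub_ind] gives completeness. The enlarged diagram is
    listed in the order of [boxes], as in [ideals], so membership means equality of sequences. *)
Definition check_ideals H : bool :=
  ([::] \in ideals H) &&
  all (fun s => uniq s && all (fun x => if addable H [in s] x then
    [seq y <- boxes H | (y == x) || (y \in s)] \in ideals H else true) (boxes H))
    (ideals H).

Definition check_rule H : bool :=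
  all (fun p => let: (s, l, D) := p in let: (c, w, h) := rule_of D in
    rule_specb D c w h && (rule_ok H s l D || has (pattern [in D]) D))
    (skew_pairs H).

Definition shift_box (c c' x : box) : box := (x.1 + c'.1 - c.1, x.2 + c'.2 - c.2).

Definition shift_move (c c' : box) (m : move) : move :=
  match m with
  | Top b => Top (shift_box c c' b)
  | Bottom b => Bottom (shift_box c c' b)
  | Both b b' => Both (shift_box c c' b) (shift_box c c' b')
  end.

(* Conditionals rather than [&&]: call-by-value evaluation would otherwise
   compute both operands. *)
Definition same_shapeb (D D' : seq box) : bool :=
  if size D == size D' then
    all (fun x => shift_box (head (0, 0) D) (head (0, 0) D') x \in D') D
  else false.

Definition candidates H (s l D : seq box) : seq move :=
  let tops := [seq x <- D | removable [in l] x] in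
  let bottoms := [seq x <- D | addable H [in s] x] in
  map Top tops ++ map Bottom bottoms ++ [seq Both b c | b <- tops, c <- bottoms].

Definition common_move H H' (s l D s' l' D' : seq box) : bool :=
  has (fun m => if valid H [in s] [in l] m then
        valid H' [in s'] [in l'] (shift_move (head (0, 0) D) (head (0, 0) D') m)
      else false) (candidates H s l D).

(** A search takes place only when the rule fails for the first diagram; its failure for the second
    is covered by exchanging the two pairs. *)
Definition check_common H H' : bool :=
  let ps := skew_pairs H' in
  all (fun p => let: (s, l, D) := p in
    if rule_ok H s l D then true else
    all (fun p' => let: (s', l', D') := p' in
      if same_shapeb D D' then common_move H H' s l D s' l' D' else true) ps)
    (skew_pairs H).

Lemma exceptional_ideals H : exceptional H -> check_ideals H.
Proof. by case: H => [? ?|?|?|?|?||] He; try discriminate He; vm_compute. Qed.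

Lemma exceptional_rule H : exceptional H -> check_rule H.
Proof. by case: H => [? ?|?|?|?|?||] He; try discriminate He; vm_compute. Qed.

Lemma exceptional_common H H' : exceptional H -> exceptional H' -> check_common H H'.
Proof.
case: H => [? ?|?|?|?|?||] He; try discriminate He;
  by case: H' => [? ?|?|?|?|?||] He'; try discriminate He'; vm_compute.
Qed.

Lemma exceptional_admissible H : exceptional H -> admissible H.
Proof. by case: H. Qed.

Lemma rule_specP (D : seq box) c w h : rule_specb D c w h -> rule_spec [in D] c w h.
Proof.
case/and5P=> /allP Hc /allP Hw Hw' /allP Hh Hh'; split; first exact: Hc.
  by split=> // k Hk; apply: Hw; rewrite mem_iota.
by split=> // k Hk; apply: Hh; rewrite mem_iota.
Qed.

Lemma eq_rule_spec (D D' : pred box) c w h : D =1 D' ->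
  rule_spec D c w h -> rule_spec D' c w h.
Proof.
move=> E [H1 [H2 H3] [H4 H5]]; split; first by move=> x; rewrite -E; apply: H1.
  by split; [move=> k Hk; rewrite -E; apply: H2|rewrite -E].
by split; [move=> k Hk; rewrite -E; apply: H4|rewrite -E].
Qed.

Lemma rule_spec_first (D : pred box) c w h : rule_spec D c w h -> D c.
Proof. by case=> _ [/(_ 0 (leq0n w))]; rewrite addn0 -surjective_pairing. Qed.

(** The data of the rule depend on the skew diagram alone, so translated diagrams prescribe
    corresponding moves. *)
Lemma rule_spec_uniq (D : pred box) c w h c' w' h' :
  rule_spec D c w h -> rule_spec D c' w' h' -> [/\ c = c', w = w' & h = h'].
Proof.
move=> S S'; have Dc := rule_spec_first S; have Dc' := rule_spec_first S'.
case: S S' => [H1 [H2 /negP H3] [H4 /negP H5]] [H1' [H2' /negP H3'] [H4' /negP H5']].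
have Ec : c = c' by apply: reading_order_anti; rewrite H1 ?H1'.
subst c'; have Ew : w = w'.
  by case: (ltngtP w w') => // Hlt; [case: H3; apply: H2'|case: H3'; apply: H2].
rewrite -Ew in H4' H5'; split=> //.
by case: (ltngtP h h') => // Hlt; [case: H5; apply: H4'|case: H5'; apply: H4].
Qed.

(** * From the enumerations to arbitrary subdiagrams of E6 and E7 *)

Section Exceptional.

Variable H : hermitian_pair.
Hypothesis He : exceptional H.

Implicit Types (M L : {fset box}) (b c x : box).

Local Open Scope fset_scope.

Lemma ideals_complete M : subdiagram H M ->
  exists s, [/\ s \in ideals H, uniq s & s =i M].
Proof.
have Hadm := exceptional_admissible He.
have /andP[H0 /allP Hs] := exceptional_ideals He.
have Hu s : s \in ideals H -> uniq s by move=> /Hs /andP[].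
suff Hex : subdiagram H M -> exists2 s, s \in ideals H & s =i M.
  by move=> /Hex[s Hi E]; exists s; split=> //; apply: Hu.
move: M; apply: (sub_ind Hadm) => [|M b HM Hb [s Hi E]].
  by exists [::] => // x; rewrite in_fset0.
have ba := addable_ambient Hb.
exists [seq y <- boxes H | (y == b) || (y \in s)].
  have /andP[_ /allP /(_ b)] := Hs s Hi; rewrite mem_boxes // ba => /(_ isT).
  by rewrite (eq_addable H (E : [in s] =1 [in M])) Hb.
move=> x; rewrite mem_filter in_fset1U E mem_boxes // andb_idr //.
by case/orP=> [/eqP->//|]; apply: sub_ambient.
Qed.

Lemma skew_complete M L : subdiagram H M -> subdiagram H L -> M `<=` L -> L `\` M != fset0 ->
  exists s l D, [/\ (s, l, D) \in skew_pairs H, s =i M, l =i L, D =i L `\` M & uniq D].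
Proof.
move=> HM HL ML D0; have [s [Hs Us Es]] := ideals_complete HM.
have [l [Hl Ul El]] := ideals_complete HL.
have ED : diff s l =i L `\` M.
  by move=> x; rewrite mem_filter in_fsetD Es El.
exists s, l, (diff s l); split=> //; last exact: filter_uniq.
rewrite mem_filter /=; apply/andP; split.
  case/fset0Pn: D0 => x; rewrite -ED; by case: (diff s l).
have sl : {subset s <= l} by move=> x; rewrite Es => /(fsubsetP ML); rewrite -El.
apply/mapP; exists (s, l) => //; rewrite mem_filter /= uniq_leq_size //.
by rewrite (introT allP sl); apply: allpairs_f.
Qed.

Lemma rule_spec_of s l D : (s, l, D) \in skew_pairs H -> exists c w h,
  [/\ rule_of D = (c, w, h), rule_spec [in D] c w h
    & rule_ok H s l D || has (pattern [in D]) D].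
Proof.
move=> Hp; have /allP /(_ _ Hp) := exceptional_rule He.
have [c [w [h E]]] : exists c w h, rule_of D = (c, w, h) by do 3 eexists.
rewrite E => /andP[/rule_specP HS Hv].
by exists c, w, h; split.
Qed.

Lemma exceptional_valid M L c w h : subdiagram H M -> subdiagram H L -> M `<=` L ->
  rule_spec [in L `\` M] c w h ->
  valid H [in M] [in L] (rule_move c w h) \/ exists2 x, x \in L `\` M & pattern [in L `\` M] x.
Proof.
move=> HM HL ML HD; have D0 : L `\` M != fset0.
  by apply/fset0Pn; exists c; apply: (rule_spec_first HD).
have [s [l [D [Hp Es El ED UD]]]] := skew_complete HM HL ML D0.
have [c' [w' [h' [Er HS Hv]]]] := rule_spec_of Hp.
have [E1 E2 E3] := rule_spec_uniq (eq_rule_spec (ED : [in D] =1 _) HS) HD.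
rewrite /rule_ok Er E1 E2 E3 in Hv.
case/orP: Hv => [Hv|/hasP[x xD Hx]]; [left|right].
  by rewrite -(eq_valid H (Es : [in s] =1 _) (El : [in l] =1 _)).
by exists x; rewrite -?ED // -(eq_pattern (ED : [in D] =1 _)).
Qed.

End Exceptional.

(** * Comparison of two skew diagrams *)

Section Translation.

Variables p q : box.
Implicit Types (D : {fset box}) (x y b c : box) (k w h : nat).

Local Open Scope fset_scope.

(* [x] translated by [p - q] is [x']. *)
Definition corresponds x x' : bool :=
  ((x.1 + p.1 == x'.1 + q.1) && (x.2 + p.2 == x'.2 + q.2))%N.

Definition translated D D' : Prop :=
  (forall x, x \in D -> exists2 x', x' \in D' & corresponds x x') /\
  (forall x', x' \in D' -> exists2 x, x \in D & corresponds x x').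

Lemma corresponds_inj x y x' : corresponds x x' -> corresponds y x' -> x = y.
Proof.
case: x => a b; case: y => a' b'; rewrite /corresponds /= => H1 H2.
by congr pair; move: H1 H2; lia.
Qed.

Lemma corresponds_fun x x' y' : corresponds x x' -> corresponds x y' -> x' = y'.
Proof.
case: x' => a b; case: y' => a' b'; rewrite /corresponds /= => H1 H2.
by congr pair; move: H1 H2; lia.
Qed.

Lemma corresponds_eq x x' y y' : corresponds x x' -> corresponds y y' ->
  (x == y) = (x' == y').
Proof.
move=> Hx Hy; apply/eqP/eqP=> E; subst.
  exact: corresponds_fun Hx Hy.
exact: corresponds_inj Hx Hy.
Qed.

Lemma translated_mem D D' x x' : translated D D' -> corresponds x x' ->
  (x \in D) = (x' \in D').
Proof.
move=> [H1 H2] Hx; apply/idP/idP=> [/H1[y yD Hy]|/H2[y yD Hy]].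
  by rewrite (corresponds_fun Hx Hy).
by rewrite (corresponds_inj Hx Hy).
Qed.

Lemma translated_del D D' b b' : translated D D' -> corresponds b b' ->
  translated (D `\ b) (D' `\ b').
Proof.
move=> [H1 H2] Hb; split=> x.
  case/fsetD1P=> xb /H1[x' xD Hx]; exists x' => //.
  by rewrite in_fsetD1 xD -(corresponds_eq Hx Hb) xb.
case/fsetD1P=> xb /H2[x' xD Hx]; exists x' => //.
by rewrite in_fsetD1 xD (corresponds_eq Hx Hb) xb.
Qed.

Lemma translated_rule D D' c c' w h : translated D D' -> corresponds c c' ->
  rule_spec [in D] c w h -> rule_spec [in D'] c' w h.
Proof.
move=> HD Hc [H1 [H2 H3] [H4 H5]].
have Hm k l : ((c.1 + k)%N, (c.2 + l)%N) \in D = (((c'.1 + k)%N, (c'.2 + l)%N) \in D').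
  by apply: (translated_mem HD); move: Hc; rewrite /corresponds /=; lia.
split=> [x' /= /(HD.2)[x xD Hx]||].
- by have := H1 x xD; move: Hc Hx; rewrite /corresponds /reading_order; lia.
- split=> [k /H2|]; first by rewrite -[c.1]addn0 -[c'.1]addn0 /= Hm.
  by move: H3; rewrite -[c.1]addn0 -[c'.1]addn0 /= Hm.
by split=> [k /H4|]; [|move: H5]; rewrite /= Hm.
Qed.

Definition corresponds_move (m m' : move) : bool :=
  match m, m' with
  | Top b, Top b' | Bottom b, Bottom b' => corresponds b b'
  | Both b c, Both b' c' => corresponds b b' && corresponds c c'
  | _, _ => false
  end.

Lemma corresponds_rule_move c c' w h : corresponds c c' ->
  corresponds_move (rule_move c w h) (rule_move c' w h).
Proof.
move=> Hc; have Hb : corresponds ((c.1 + h)%N, (c.2 + w)%N) ((c'.1 + h)%N, (c'.2 + w)%N).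
  by move: Hc; rewrite /corresponds /=; lia.
by rewrite /rule_move; case: ifP => _ //; case: ifP => _ //=; rewrite Hb.
Qed.

Lemma corresponds_shift c c' x x' : corresponds c c' -> corresponds x x' ->
  shift_box c c' x = x'.
Proof.
case: x' => a b; rewrite /corresponds /shift_box /= => Hc Hx.
by congr pair; move: Hc Hx; lia.
Qed.

(** [left] truncates at column 0; positivity ensures that the step is a genuine one and commutes
    with the translation. *)
Lemma corresponds_left x x' y : corresponds x x' -> corresponds (left x) y ->
  0 < x.2.-1 -> left x' = y.
Proof.
case: y => a b; rewrite /corresponds /left /= => Hx Hy H2.
by congr pair; move: Hx Hy H2; lia.
Qed.

Lemma corresponds_up x x' y : corresponds x x' -> corresponds (up x) y ->
  0 < x.1.-1 -> up x' = y.
Proof.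
case: y => a b; rewrite /corresponds /up /= => Hx Hy H1.
by congr pair; move: Hx Hy H1; lia.
Qed.

Lemma translated_pattern D D' x x' : (forall y, y \in D -> 0 < y.1 /\ 0 < y.2) ->
  translated D D' -> x \in D -> corresponds x x' ->
  pattern [in D] x -> pattern [in D'] x'.
Proof.
move=> Hpos HD xD Hx.
have Hm k l : (((x.1 + k)%N, (x.2 + l)%N) \in D) = (((x'.1 + k)%N, (x'.2 + l)%N) \in D').
  by apply: (translated_mem HD); move: Hx; rewrite /corresponds /=; lia.
have Hd : (down x \in D) = (down x' \in D').
  by have := Hm 1 0; rewrite !addn1 !addn0.
have Hr : (right x \in D) = (right x' \in D').
  by have := Hm 0 1; rewrite !addn1 !addn0.
have H11 := Hm 1 1; have H21 := Hm 2 1; have H12 := Hm 1 2.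
rewrite !addn1 ?addn2 in H11 H21 H12.
have Hl : left x \in D -> left x' \in D'.
  move=> lD; have [y yD Hy] := HD.1 _ lD; have [_ H2] := Hpos _ lD; rewrite /= in H2.
  by rewrite (corresponds_left Hx Hy H2).
have Hu : up x \in D -> up x' \in D'.
  move=> uD; have [y yD Hy] := HD.1 _ uD; have [H2 _] := Hpos _ uD; rewrite /= in H2.
  by rewrite (corresponds_up Hx Hy H2).
rewrite /pattern /= Hd Hr H11 H21 H12; case/or3P=> [->//|->|/and5P[-> -> /Hl -> /Hu -> ->]].
  by rewrite orbT.
by rewrite !orbT.
Qed.

End Translation.

Lemma translated_sym p q D D' : translated p q D D' -> translated q p D' D.
Proof.
case=> H1 H2; split=> x; [case/H2|case/H1] => y yD Hy; exists y => //;
  by move: Hy; rewrite /corresponds; lia.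
Qed.

Lemma same_shape_translated D D' : same_shape D D' -> exists p q, translated p q D D'.
Proof.
case=> -[c1 c2] /= /fsetP E.
(* The integral translation is written as the difference of two vectors of natural numbers, c + |c|
   and |c| in each coordinate. *)
pose p := (`|(c1 + `|c1|%N%:Z)%R|%N, `|(c2 + `|c2|%N%:Z)%R|%N); pose q := (`|c1|%N, `|c2|%N).
have Hcor (x x' : box) : (x.1%:Z + c1 = x'.1%:Z)%R -> (x.2%:Z + c2 = x'.2%:Z)%R ->
    corresponds p q x x'.
  by rewrite /corresponds /p /q /=; lia.
exists p, q; split=> x xD.
  have : ((x.1%:Z + c1)%R, (x.2%:Z + c2)%R) \in translate (c1, c2) D by apply: in_imfset.
  rewrite E => /imfsetP[y /= yD [H1 H2]]; exists y => //.
  by apply: Hcor; rewrite ?H1 ?H2 addr0.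
have : ((x.1%:Z + 0)%R, (x.2%:Z + 0)%R) \in translate (0%R, 0%R) D'.
  exact: (in_imfset _ (fun b : box => ((b.1%:Z + 0)%R, (b.2%:Z + 0)%R))).
rewrite -E => /imfsetP[y /= yD [H1 H2]]; exists y => //.
by apply: Hcor; rewrite -?H1 -?H2 addr0.
Qed.

Local Open Scope fset_scope.

Lemma rule_spec_ex H (D : {fset box}) : admissible H ->
  (forall x : box, x \in D -> x \in ambient H) -> D != fset0 ->
  exists c w h, rule_spec [in D] c w h.
Proof.
move=> Hadm Ha D0.
have [c cD Hc] : exists2 c : box, c \in D & forall x : box, x \in D -> reading_order c x.
  have Hs : sorted reading_order (sort reading_order D).
    exact: sort_sorted reading_order_total _.
  case Es: (sort reading_order D) Hs => [|c s] Hs.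
    by case/fset0Pn: D0 => x; rewrite -(mem_sort reading_order) Es.
  exists c; first by rewrite -(mem_sort reading_order) Es mem_head.
  move=> x; rewrite -(mem_sort reading_order) Es inE => /orP[/eqP->|xs].
    by rewrite /reading_order; lia.
  by move: Hs; rewrite /= (path_sortedE reading_order_trans) => /andP[/allP /(_ x xs)].
have Hbound (x : box) : x \in D -> (x.1 < side H) && (x.2 < side H).
  by move=> /Ha /(ambient_bound Hadm); lia.
have Hrun (f : nat -> box) : f 0 \in D -> (exists k, f k.+1 \notin D) ->
    exists w, (forall k, k <= w -> f k \in D) /\ f w.+1 \notin D.
  move=> f0 Hk; exists (ex_minn Hk); case: ex_minnP => w Hw Hmin; split=> // k Hkw.
  case: k Hkw => // k Hkw; apply: contraLR Hkw => Hf; rewrite -ltnNge ltnS; exact: Hmin.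
have [||w [Hw Hw']] := Hrun (fun k => (c.1, (c.2 + k)%N)).
- by rewrite addn0 -surjective_pairing.
- by exists (side H); apply/negP=> /Hbound /=; lia.
have [||h [Hh Hh']] := Hrun (fun k => ((c.1 + k)%N, (c.2 + w)%N)).
- by rewrite addn0; apply: Hw.
- by exists (side H); apply/negP=> /Hbound /=; lia.
by exists c, w, h; split.
Qed.

(** A skew diagram is convex inside the ambient diagram. A box missing from a pattern would thus be
    missing from the ambient diagram, which is impossible in an infinite family. *)
Lemma regular_no_pattern H (M L : {fset box}) x : admissible H -> ~~ exceptional H ->
  subdiagram H M -> subdiagram H L -> x \in L `\` M -> ~~ pattern [in L `\` M] x.
Proof.
move=> Hadm Hreg HM HL; rewrite in_diff => /andP[xL xM].
have xa := sub_ambient HL xL.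
have Hin y z : z \in L `\` M -> y \in ambient H -> x.1 <= y.1 -> x.2 <= y.2 ->
    y.1 <= z.1 -> y.2 <= z.2 -> y \in L `\` M.
  rewrite !in_diff => /andP[zL _] ya H1 H2 H3 H4.
  by rewrite (sub_ideal HL zL ya) // (notin_above HM xa xM).
have Ha y : y \in L `\` M -> y \in ambient H.
  by rewrite in_diff => /andP[/(sub_ambient HL)].
apply/negP; rewrite /pattern /= => /or3P[/and3P[_ H1 /negP]|/and5P[_ H1 H2 H3 /negP]|].
- apply; apply: (Hin _ _ H1) => //=.
  by apply: (ambient_right Hadm Hreg xa (Ha _ H1)) => /=.
- apply; apply: (Hin _ _ H1) => //=.
  exact: (ambient_down1 Hadm Hreg xa (Ha _ H2) (Ha _ H3)).
case/and5P=> _ H1 H2 H3 /negP; apply; apply: (Hin _ _ H1) => //=.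
exact: (ambient_down2 Hadm Hreg xa (Ha _ H1) (Ha _ H2) (Ha _ H3)).
Qed.

Lemma translated_size p q (D D' : {fset box}) (s s' : seq box) : translated p q D D' ->
  uniq s -> s =i D -> s' =i D' -> size s <= size s'.
Proof.
move=> [H1 _] Us Es Es'; pose f := shift_box q p.
have Hf x : x \in s -> f x \in s' /\ corresponds p q x (f x).
  rewrite Es => /H1[y yD Hy]; have -> : f x = y.
    case: y {yD} Hy => a b; rewrite /corresponds /f /shift_box /= => Hy.
    by congr pair; move: Hy; lia.
  by rewrite Es'.
rewrite -(size_map f); apply: uniq_leq_size.
  rewrite map_inj_in_uniq // => x y /Hf[_ Hx] /Hf[_ Hy] E.
  by rewrite E in Hx; apply: corresponds_inj Hx Hy.
by move=> _ /mapP[x /Hf[Hx _] ->].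
Qed.

Lemma corresponds_shift_move p q c c' (D D' : {fset box}) H (M L : {fset box}) m :
  D = L `\` M -> translated p q D D' -> corresponds p q c c' ->
  valid H [in M] [in L] m -> corresponds_move p q m (shift_move c c' m).
Proof.
move=> ED HD Hc; have Hin x : x \in L -> x \notin M -> corresponds p q x (shift_box c c' x).
  move=> xL xM; have xD : x \in D by rewrite ED in_diff xL xM.
  have [y _ Hy] := HD.1 x xD.
  by rewrite (corresponds_shift Hc Hy).
case: m => [b|b|b b'] /=.
- by case/and3P=> /removable_in bL bM _; apply: Hin.
- by case/and3P=> /addable_notin bM bL _; apply: Hin.
by case/and5P=> /removable_in bL bM /addable_notin bM' bL' _; rewrite !Hin.
Qed.

Lemma corresponds_sym p q x x' : corresponds p q x x' -> corresponds q p x' x.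
Proof. by rewrite /corresponds; lia. Qed.

Lemma corresponds_move_sym p q m m' : corresponds_move p q m m' -> corresponds_move q p m' m.
Proof.
case: m => [b|b|b c]; case: m' => [b'|b'|b' c'] //=; try exact: corresponds_sym.
by case/andP=> /corresponds_sym -> /corresponds_sym ->.
Qed.

(* The move prescribed by [rule_move] is replaced by one found by exhaustion. *)
Lemma exceptional_bad_common H H' s l D s' l' D' (M L M' L' : {fset box}) p q :
  exceptional H -> exceptional H' ->
  (s, l, D) \in skew_pairs H -> (s', l', D') \in skew_pairs H' ->
  [/\ s =i M, l =i L, D =i L `\` M & uniq D] ->
  [/\ s' =i M', l' =i L', D' =i L' `\` M' & uniq D'] ->
  translated p q (L `\` M) (L' `\` M') -> ~~ rule_ok H s l D ->
  exists m m', [/\ corresponds_move p q m m', valid H [in M] [in L] m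
    & valid H' [in M'] [in L'] m'].
Proof.
move=> He He' Hp Hp' [Es El ED UD] [Es' El' ED' UD'] HD Hbad.
have [c [w [h [Er HS _]]]] := rule_spec_of He Hp.
have [c' [w' [h' [Er' HS' _]]]] := rule_spec_of He' Hp'.
have Hc0 : head (0, 0) D = c by rewrite -[LHS]/((rule_of D).1.1) Er.
have Hc0' : head (0, 0) D' = c' by rewrite -[LHS]/((rule_of D').1.1) Er'.
have {}HS := eq_rule_spec (ED : [in D] =1 [in L `\` M]) HS.
have {}HS' := eq_rule_spec (ED' : [in D'] =1 [in L' `\` M']) HS'.
have [c2 _ Hc] := HD.1 c (rule_spec_first HS).
have [Ec _ _] := rule_spec_uniq (translated_rule HD Hc HS) HS'; rewrite {}Ec in Hc.
have Hsame : same_shapeb D D'.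
  have -> : same_shapeb D D' = (size D == size D') &&
      all (fun x => shift_box (head (0, 0) D) (head (0, 0) D') x \in D') D by [].
  rewrite eqn_leq (translated_size HD UD ED ED').
  rewrite (translated_size (translated_sym HD) UD' ED' ED) /= Hc0 Hc0'.
  apply/allP => x; rewrite ED => /HD.1[y yD Hy].
  by rewrite (corresponds_shift Hc Hy) ED'.
have /(has_nthP (Top c))[i _] : common_move H H' s l D s' l' D'.
  have /allP /(_ _ Hp) := exceptional_common He He'; rewrite (negbTE Hbad).
  by move=> /allP /(_ _ Hp'); rewrite Hsame.
move: (nth _ _ i) => m; rewrite Hc0 Hc0'.
rewrite (eq_valid H (Es : [in s] =1 [in M]) (El : [in l] =1 [in L])).
rewrite (eq_valid H' (Es' : [in s'] =1 [in M']) (El' : [in l'] =1 [in L'])).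
case: ifP => // Hv Hv'; exists m, (shift_move c c' m); split=> //.
exact: (corresponds_shift_move (erefl _) HD Hc Hv).
Qed.

(** If the rule is valid on both sides, it gives corresponding moves. If it fails on one side, the
    search is started from that side. *)
Lemma exceptional_common_valid H H' (M L M' L' : {fset box}) p q :
  exceptional H -> exceptional H' ->
  subdiagram H M -> subdiagram H L -> M `<=` L ->
  subdiagram H' M' -> subdiagram H' L' -> M' `<=` L' ->
  L `\` M != fset0 -> translated p q (L `\` M) (L' `\` M') ->
  exists m m', [/\ corresponds_move p q m m', valid H [in M] [in L] m
    & valid H' [in M'] [in L'] m'].
Proof.
move=> He He' HM HL ML HM' HL' ML' D0 HD.
have D0' : L' `\` M' != fset0.
  by case/fset0Pn: D0 => x /HD.1[y yD _]; apply/fset0Pn; exists y.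
have [s [l [D [Hp Es El ED UD]]]] := skew_complete He HM HL ML D0.
have [s' [l' [D' [Hp' Es' El' ED' UD']]]] := skew_complete He' HM' HL' ML' D0'.
case: (boolP (rule_ok H s l D)) => [Hok|Hbad]; last first.
  by apply: (exceptional_bad_common He He' Hp Hp' _ _ HD Hbad).
case: (boolP (rule_ok H' s' l' D')) => [Hok'|Hbad]; last first.
  have [||m' [m [Hm Hm' Hm2]]] :=
    exceptional_bad_common (M := M') (L := L') (M' := M) (L' := L)
      He' He Hp' Hp _ _ (translated_sym HD) Hbad; [by []|by []|].
  by exists m, m'; split=> //; apply: corresponds_move_sym.
have [c [w [h [Er HS _]]]] := rule_spec_of He Hp.
have [c' [w' [h' [Er' HS' _]]]] := rule_spec_of He' Hp'.
have {}HS := eq_rule_spec (ED : [in D] =1 [in L `\` M]) HS.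
have {}HS' := eq_rule_spec (ED' : [in D'] =1 [in L' `\` M']) HS'.
have [c2 _ Hc] := HD.1 c (rule_spec_first HS).
have [Ec Ew Eh] := rule_spec_uniq (translated_rule HD Hc HS) HS'.
rewrite {}Ec in Hc; rewrite -{}Ew -{}Eh in Er'.
move: Hok; rewrite /rule_ok Er (eq_valid H (Es : [in s] =1 [in M]) (El : [in l] =1 [in L])) => Hv.
move: Hok'; rewrite /rule_ok Er'.
rewrite (eq_valid H' (Es' : [in s'] =1 [in M']) (El' : [in l'] =1 [in L'])) => Hv'.
exists (rule_move c w h), (rule_move c' w h); split=> //.
exact: corresponds_rule_move.
Qed.

(** If the rule failed for an exceptional [H], the skew diagram would contain a pattern; its
    translate would lie in a diagram of the infinite family of [H'], which has none. *)
Lemma mixed_common_valid H H' (M L M' L' : {fset box}) p q :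
  admissible H -> admissible H' -> ~~ exceptional H' ->
  subdiagram H M -> subdiagram H L -> M `<=` L ->
  subdiagram H' M' -> subdiagram H' L' -> M' `<=` L' ->
  L `\` M != fset0 -> translated p q (L `\` M) (L' `\` M') ->
  exists m m', [/\ corresponds_move p q m m', valid H [in M] [in L] m
    & valid H' [in M'] [in L'] m'].
Proof.
move=> Hadm Hadm' Hreg' HM HL ML HM' HL' ML' D0 HD.
have Ha x : x \in L `\` M -> x \in ambient H.
  by rewrite in_diff => /andP[/(sub_ambient HL)].
have [c [w [h HS]]] := rule_spec_ex Hadm Ha D0.
have [c' _ Hc] := HD.1 c (rule_spec_first HS).
have HS' := translated_rule HD Hc HS.
exists (rule_move c w h), (rule_move c' w h); split.
- exact: corresponds_rule_move.
- case: (boolP (exceptional H)) => He; last exact: (rule_valid Hadm He HM HL HS).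
  have [//|[x xD Hx]] := exceptional_valid He HM HL ML HS.
  have [x' xD' Hxx'] := HD.1 x xD.
  have Hpos y : y \in L `\` M -> 0 < y.1 /\ 0 < y.2.
    by move=> /Ha /(box_pos Hadm) /andP.
  have := translated_pattern Hpos HD xD Hxx' Hx.
  by rewrite (negbTE (regular_no_pattern Hadm' Hreg' HM' HL' xD')).
exact: (rule_valid Hadm' Hreg' HM' HL' HS').
Qed.

Lemma common_valid H H' (M L M' L' : {fset box}) p q :
  admissible H -> admissible H' ->
  subdiagram H M -> subdiagram H L -> M `<=` L ->
  subdiagram H' M' -> subdiagram H' L' -> M' `<=` L' ->
  L `\` M != fset0 -> translated p q (L `\` M) (L' `\` M') ->
  exists m m', [/\ corresponds_move p q m m', valid H [in M] [in L] m
    & valid H' [in M'] [in L'] m'].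
Proof.
move=> Hadm Hadm' HM HL ML HM' HL' ML' D0 HD.
case: (boolP (exceptional H')) => He'; last exact: mixed_common_valid HD.
case: (boolP (exceptional H)) => He; first exact: exceptional_common_valid HD.
have D0' : L' `\` M' != fset0.
  by case/fset0Pn: D0 => x /HD.1[y yD _]; apply/fset0Pn; exists y.
have [m' [m [Hm Hv' Hv]]] :=
  mixed_common_valid Hadm' Hadm He HM' HL' ML' HM HL ML D0' (translated_sym HD).
by exists m, m'; split=> //; apply: corresponds_move_sym.
Qed.

(** * Induction on the number of boxes of the skew diagram *)

Section Comparison.

Variables (H H' : hermitian_pair) (W : weyl_group (hdynkin H)) (W' : weyl_group (hdynkin H')).
Hypotheses (Hadm : admissible H) (Hadm' : admissible H').
Variables (R : W -> W -> {poly int}) (R' : W' -> W' -> {poly int}).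
Hypotheses (HR : relative_R_polynomials (hJ H) R) (HR' : relative_R_polynomials (hJ H') R').

Lemma diffD1l (L M : {fset box}) b : (L `\ b) `\` M = (L `\` M) `\ b.
Proof. by apply/fsetP=> x; rewrite !inE andbCA. Qed.

Lemma diffU1r (L M : {fset box}) c : L `\` (c |` M) = (L `\` M) `\ c.
Proof. by apply/fsetP=> x; rewrite !inE negb_or andbA. Qed.

Lemma card_del (D : {fset box}) b m : b \in D -> #|`D| <= m.+1 -> #|`D `\ b| <= m.
Proof. by move=> bD; rewrite (cardfsD1 b D) bD. Qed.

Lemma rpoly_shape p q (M L M' L' : {fset box}) :
  subdiagram H M -> subdiagram H L -> M `<=` L ->
  subdiagram H' M' -> subdiagram H' L' -> M' `<=` L' ->
  translated p q (L `\` M) (L' `\` M') -> rpoly R L M = rpoly R' L' M'.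
Proof.
move: {2}#|`L `\` M| (leqnn #|`L `\` M|) => m.
elim: m M L M' L' => [|m IH] M L M' L' Hm HM HL ML HM' HL' ML' HD.
all: have Hzero : L `\` M = fset0 -> rpoly R L M = rpoly R' L' M'.
1,3: move=> D0; have D0' : L' `\` M' = fset0 by
      apply/eqP; apply: contraT => /fset0Pn[x /HD.2[y]]; rewrite D0 in_fset0.
1,2: have -> : L = M by apply/eqP; rewrite eqEfsubset ML -fsetD_eq0 D0 eqxx.
1,2: have -> : L' = M' by apply/eqP; rewrite eqEfsubset ML' -fsetD_eq0 D0' eqxx.
1,2: by rewrite !rpoly_diag.
  by apply: Hzero; apply/eqP; rewrite -cardfs_eq0 -leqn0.
have [/Hzero//|D0] := eqVneq (L `\` M) fset0.
have [mv [mv' [Hmv Hv Hv']]] := common_valid Hadm Hadm' HM HL ML HM' HL' ML' D0 HD.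
case: mv Hmv Hv => [b|c|b c]; case: mv' Hv' => [b'|c'|b' c'] //= Hv' Hmv Hv.
- rewrite (rpoly_valid_top Hadm HR HM HL Hv) (rpoly_valid_top Hadm' HR' HM' HL' Hv').
  case/and3P: Hv => Hb bM _; case/and3P: Hv' => Hb' bM' _.
  have [HLb MLb] := sub_valid_top Hadm HL ML Hb bM.
  have [HLb' MLb'] := sub_valid_top Hadm' HL' ML' Hb' bM'.
  congr (_ * _)%R; apply: IH => //; rewrite !diffD1l; last exact: translated_del.
  by apply: card_del; rewrite ?in_diff ?(removable_in Hb).
- rewrite (rpoly_valid_bottom Hadm HR HM HL Hv) (rpoly_valid_bottom Hadm' HR' HM' HL' Hv').
  case/and3P: Hv => Hc cL _; case/and3P: Hv' => Hc' cL' _.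
  have [HMc MLc] := sub_valid_bottom Hadm HM ML Hc cL.
  have [HMc' MLc'] := sub_valid_bottom Hadm' HM' ML' Hc' cL'.
  congr (_ * _)%R; apply: IH => //; rewrite !diffU1r; last exact: translated_del.
  by apply: card_del; rewrite ?in_diff ?(addable_notin Hc) ?andbT.
rewrite (rpoly_valid_both Hadm HR HM HL Hv) (rpoly_valid_both Hadm' HR' HM' HL' Hv').
case/and5P: Hv => Hb bM Hc cL _; case/and5P: Hv' => Hb' bM' Hc' cL' _.
case/andP: Hmv => Hbb Hcc.
have [HLb MLb] := sub_valid_top Hadm HL ML Hb bM.
have [HLb' MLb'] := sub_valid_top Hadm' HL' ML' Hb' bM'.
have [HMc _] := sub_valid_bottom Hadm HM ML Hc cL.
have [HMc' _] := sub_valid_bottom Hadm' HM' ML' Hc' cL'.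
have Hdb := translated_del HD Hbb; have Hlt : #|`(L `\` M) `\ b| <= m.
  by apply: card_del; rewrite ?in_diff ?(removable_in Hb).
congr (_ * _ + _ * _)%R; first by apply: IH; rewrite ?diffD1l.
have Ebc := corresponds_eq Hbb Hcc.
(* When [w = h = 0] the boxes [b] and [c] coincide; adding [c] to [M] then leaves the diagram [L]
   without [b], and the last term vanishes on both sides. *)
have [Ecb|Nbc] := eqVneq b c.
  have Eb' : b' = c' by apply/eqP; rewrite -Ebc Ecb.
  rewrite !rpoly_notin //.
    by rewrite -Eb'; apply/fsubsetPn; exists b'; rewrite ?fset1U1 // in_fsetD1 eqxx.
  by rewrite -Ecb; apply/fsubsetPn; exists b; rewrite ?fset1U1 // in_fsetD1 eqxx.
apply: IH => //.
- by rewrite diffU1r (diffD1l L M); apply: leq_trans Hlt; apply/fsubset_leq_card/fsubD1set.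
- by rewrite fsubUset fsub1set MLb in_fsetD1 cL eq_sym Nbc.
- by rewrite fsubUset fsub1set MLb' in_fsetD1 cL' eq_sym -Ebc Nbc.
by rewrite !diffU1r (diffD1l L M) (diffD1l L' M'); apply: translated_del.
Qed.

End Comparison.

Theorem theorem10p6
  (H H' : hermitian_pair) (hH : admissible H) (hH' : admissible H')
  (W : weyl_group (hdynkin H)) (W' : weyl_group (hdynkin H'))
  (R : W -> W -> {poly int}) (R' : W' -> W' -> {poly int})
  (hR : relative_R_polynomials (hJ H) R)
  (hR' : relative_R_polynomials (hJ H') R')
  (u v : W) (u' v' : W')
  (hu : u \in quotient_reps W (hJ H)) (hv : v \in quotient_reps W (hJ H))
  (hu' : u' \in quotient_reps W' (hJ H'))
  (hv' : v' \in quotient_reps W' (hJ H'))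
  (huv : bruhat u v) (huv' : bruhat u' v')
  (M L M' L' : {fset box})
  (hM : is_diagram_of M u) (hL : is_diagram_of L v)
  (hM' : is_diagram_of M' u') (hL' : is_diagram_of L' v')
  (hML : M `<=` L) (hML' : M' `<=` L')
  (hshape : same_shape (L `\` M) (L' `\` M')) :
  R u v = R' u' v'.
Proof.
case: hM hL hM' hL' => [HM ->] [HL ->] [HM' ->] [HL' ->].
have [p [q HD]] := same_shape_translated hshape.
exact: (rpoly_shape hH hH' hR hR' HM HL hML HM' HL' hML' HD).
Qed.
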